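(* Let $C$ be a precontact structure of rank $(2r+1)$ on a manifold $M$. If the characteristic foliation $\mathcal F_C$ is simple, with $M_0=M/\mathcal F_C$ the manifold of leaves and $p_0:M\to M_0$ the canonical projection, then $M_0$ carries a canonical contact structure $C_0$ such that $C_0(p_0(y))=\mathsf Tp_0(C(y))$ for all $y\in M$. Moreover, if $\eta$ is a precontact form defined in a neighbourhood of $y\in M$ and inducing $C$, then $p_0^*(\eta_0)=f_\eta\,\eta$ for any contact form $\eta_0$ defined in a neighbourhood of $p_0(y)$ and inducing $C_0$, where $f_\eta$ is a nonvanishing function.
   Context: All objects are smooth. A field of hyperplanes on $M$ is a smooth corank 1 distribution $C\subset\mathsf TM$. It is a precontact structure of rank $(2r+1)$ if the bilinear map $\nu^C:C\times_MC\to\mathsf TM/C$, $\nu^C(X,Y)=[X,Y]\bmod C$ for vector fields $X,Y$ with values in $C$, has constant rank $2r$; it is a contact structure if moreover $2r+1=\dim M$. The characteristic distribution $\chi(C)=\ker(\nu^C)$ is regular (of rank $\dim M-2r-1$) and involutive; its maximal connected integral submanifolds are the leaves of the characteristic foliation $\mathcal F_C$. A (local) nonvanishing 1-form $\eta$ with $C=\ker(\eta)$ is called a precontact form inducing $C$ (a contact form if $C$ is contact). The foliation $\mathcal F_C$ is simple if the space of leaves $M_0=M/\mathcal F_C$ has a smooth manifold structure such that the canonical projection $p_0:M\to M_0$, sending a point to the leaf through it, is a surjective submersion. *)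

(* Defs.v *)
From HB Require Import structures.
From mathcomp Require Import all_boot all_order all_algebra.
From mathcomp Require Import all_classical all_reals all_analysis.
Set Implicit Arguments.
Unset Strict Implicit.
Unset Printing Implicit Defensive.
Import Order.TTheory GRing.Theory Num.Theory.
Import numFieldNormedType.Exports.
Local Open Scope classical_set_scope.
Local Open Scope ring_scope.

(* [Ck k A f]: all iterated partial derivatives of f of order <= k exist and
   are continuous at the points of A. It is only used for open sets A. *)
Fixpoint Ck (R : realType) (n : nat) (V : normedModType R) (k : nat)
    (A : set 'rV[R]_n) (f : 'rV[R]_n -> V) : Prop :=
  (forall u, A u -> {for u, continuous f}) /\
  match k with
  | 0 => True
  | k'.+1 => forall i : 'I_n,
      (forall u, A u -> derivable f u (delta_mx 0 i)) /\
      Ck k' A (fun u => 'D_(delta_mx 0 i) f u)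
  end.

Definition smooth_on (R : realType) (n : nat) (V : normedModType R)
    (A : set 'rV[R]_n) (f : 'rV[R]_n -> V) : Prop :=
  forall k, Ck k A f.

(* The maps are total, but only their restrictions to [chart_dom] and to
   [chart_map @` chart_dom] are meaningful. *)
Record chart (R : realType) (n : nat) (T : topologicalType) := Chart {
  chart_dom : set T;
  chart_map : T -> 'rV[R]_n;
  chart_inv : 'rV[R]_n -> T;
  chart_dom_open : open chart_dom;
  chart_cod_open : open (chart_map @` chart_dom);
  chart_mapK : forall x, chart_dom x -> chart_inv (chart_map x) = x;
  chart_map_continuous :
    forall x, chart_dom x -> {for x, continuous chart_map};
  chart_inv_continuous :
    forall x, chart_dom x -> {for chart_map x, continuous chart_inv} }.

(* A nonempty Hausdorff second countable smooth manifold of dimension n. The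
   smooth structure is the one generated by the atlas {chart_at p | p}; every
   smooth structure is of this form, by choosing a chart around each point.

   The chosen chart also provides the model of the tangent space:
   T_pM is 'rV[R]_n, a tangent vector at p being represented by its components
   in the chart [chart_at p]. *)
Record manifold (R : realType) (n : nat) := Manifold {
  points :> topologicalType;
  chart_at : points -> chart R n points;
  chart_at_dom : forall p, chart_dom (chart_at p) p;
  chart_compatible : forall p q,
    smooth_on (chart_map (chart_at p) @`
                 (chart_dom (chart_at p) `&` chart_dom (chart_at q)))
              (chart_map (chart_at q) \o chart_inv (chart_at p));
  manifold_nonempty : [set: points] !=set0;
  manifold_hausdorff : hausdorff_space points;
  manifold_second_countable : @second_countable points }.

Section Manifolds.
Context (R : realType).
Implicit Types (m n : nat).

Definition smooth_fun n (M : manifold R n) (W : set M) (f : M -> R) : Prop :=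
  forall q : M, smooth_on
    (chart_map (chart_at q) @` (W `&` chart_dom (chart_at q)))
    (f \o chart_inv (chart_at q)).

Definition smooth_map m n (N : manifold R m) (M : manifold R n)
    (f : N -> M) : Prop :=
  continuous f /\
  forall (p : N) (q : M), smooth_on
    (chart_map (chart_at p) @`
       (chart_dom (chart_at p) `&` f @^-1` chart_dom (chart_at q)))
    (chart_map (chart_at q) \o f \o chart_inv (chart_at p)).

(* T_pf : T_pN -> T_(f p)M *)
Definition tangent_map m n (N : manifold R m) (M : manifold R n)
    (f : N -> M) (p : N) : 'Hom('rV[R]_m, 'rV[R]_n) :=
  linfun ('d (chart_map (chart_at (f p)) \o f \o chart_inv (chart_at p))
             (chart_map (chart_at p) p)).

Definition immersion m n (N : manifold R m) (M : manifold R n)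
    (f : N -> M) : Prop :=
  forall p, lker (tangent_map f p) = 0%VS.

Definition submersion m n (N : manifold R m) (M : manifold R n)
    (f : N -> M) : Prop :=
  forall p, limg (tangent_map f p) = fullv.

(* Passage from components in [chart_at p] to components in [chart_at q] for
   tangent vectors at x, where x lies in the domains of both charts. *)
Definition coord_change n (M : manifold R n) (p q x : M) :
    'Hom('rV[R]_n, 'rV[R]_n) :=
  linfun ('d (chart_map (chart_at q) \o chart_inv (chart_at p))
             (chart_map (chart_at p) x)).

(* Vector fields are functions [X : M -> 'rV[R]_n] with X p in T_pM = 'rV_n. *)
Definition vf_in n (M : manifold R n) (q : M) (X : M -> 'rV[R]_n)
    (u : 'rV[R]_n) : 'rV[R]_n :=
  let x := chart_inv (chart_at q) u in coord_change x q x (X x).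

Definition smooth_vf n (M : manifold R n) (W : set M) (X : M -> 'rV[R]_n) :
    Prop :=
  forall q : M, smooth_on
    (chart_map (chart_at q) @` (W `&` chart_dom (chart_at q))) (vf_in q X).

(* [X, Y](p), from the coordinate formula [X, Y] = DY(X) - DX(Y) in the chart
   [chart_at p]. *)
Definition lie_bracket n (M : manifold R n) (X Y : M -> 'rV[R]_n) (p : M) :
    'rV[R]_n :=
  let u := chart_map (chart_at p) p in
  'D_(vf_in p X u) (vf_in p Y) u - 'D_(vf_in p Y u) (vf_in p X) u.

Definition tangent_distribution n (M : manifold R n) := M -> {vspace 'rV[R]_n}.

Definition smooth_distribution n (M : manifold R n) (k : nat)
    (C : tangent_distribution M) : Prop :=
  (forall p, \dim (C p) = k) /\
  forall p, exists (U : set M) (X : 'I_k -> M -> 'rV[R]_n),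
    [/\ open U, U p, forall i, smooth_vf U (X i) &
        forall q, U q -> C q = <<[seq X i q | i : 'I_k]>>%VS].

Definition hyperplane_field n (M : manifold R n)
    (C : tangent_distribution M) : Prop :=
  exists2 k, k.+1 = n & smooth_distribution k C.

Definition vf_valued_in n (M : manifold R n) (C : tangent_distribution M)
    (U : set M) (X : M -> 'rV[R]_n) : Prop :=
  smooth_vf U X /\ forall q, U q -> X q \in C q.

(* nu^C_p(v, w), as an element of T_pM / C_p, i.e. as a coset of C p:
   the class of [X, Y](p) for vector fields X, Y with values in C, defined near
   p, that extend v and w. *)
Definition nu n (M : manifold R n) (C : tangent_distribution M) (p : M)
    (v w : 'rV[R]_n) : set 'rV[R]_n :=
  [set z | exists (U : set M) (X Y : M -> 'rV[R]_n),
     [/\ [/\ open U, U p, vf_valued_in C U X & vf_valued_in C U Y],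
         X p = v, Y p = w & z - lie_bracket X Y p \in C p]].

(* chi(C) = ker nu^C. The coset [nu C p v w] is zero in T_pM / C_p iff it
   contains 0. [xget] only turns the set of vectors of the kernel, which is a
   linear subspace when C is a hyperplane field, into a [{vspace _}]. *)
Definition char_dist n (M : manifold R n) (C : tangent_distribution M) :
    tangent_distribution M :=
  fun p => xget 0%VS [set K : {vspace 'rV[R]_n} |
    forall v, v \in K <->
      v \in C p /\ forall w, w \in C p -> nu C p v w 0].

Definition nu_rank n (M : manifold R n) (C : tangent_distribution M) (p : M) :
    nat :=
  (\dim (C p) - \dim (char_dist C p))%N.

(* Precontact structure of rank 2r + 1. *)
Definition precontact n (M : manifold R n) (r : nat)
    (C : tangent_distribution M) : Prop :=
  hyperplane_field C /\ forall p, nu_rank C p = (2 * r)%N.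

Definition contact n (M : manifold R n) (C : tangent_distribution M) : Prop :=
  exists2 r, precontact r C & (2 * r).+1 = n.

(* Connected integral submanifolds are images of injective immersions of
   connected manifolds tangent to D (they need not be embedded). *)
Definition connected_integral_submanifold n (M : manifold R n)
    (D : tangent_distribution M) (L : set M) : Prop :=
  exists (k : nat) (N : manifold R k) (i : N -> M),
    [/\ connected [set: N],
        [/\ smooth_map i, injective i & immersion i],
        range i = L &
        forall q, limg (tangent_map i q) = D (i q)].

Definition leaf n (M : manifold R n) (D : tangent_distribution M)
    (L : set M) : Prop :=
  connected_integral_submanifold D L /\
  forall L', connected_integral_submanifold D L' -> L `<=` L' -> L' = L.

(* The characteristic foliation of C is simple, M0 being the manifold of leaves
   and p0 the canonical projection. The points of M0 are the leaves through the
   bijection [leaf_of], and p0 y is the leaf containing y. *)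
Definition simple_with n (M : manifold R n) n0 (M0 : manifold R n0)
    (C : tangent_distribution M) (p0 : M -> M0) : Prop :=
  (exists leaf_of : M0 -> set M,
    [/\ injective leaf_of,
        range leaf_of = [set L | leaf (char_dist C) L] &
        forall y, leaf_of (p0 y) y]) /\
  [/\ smooth_map p0, range p0 = [set: M0] & submersion p0].

(* 1-forms are functions [eta] with [eta p] a linear form on T_pM = 'rV_n; they
   are smooth when their components in the charts are. *)
Definition form_in n (M : manifold R n) (q : M)
    (eta : M -> 'Hom('rV[R]_n, R^o)) (i : 'I_n) (u : 'rV[R]_n) : R :=
  let x := chart_inv (chart_at q) u in
  eta x (coord_change q x x (delta_mx 0 i)).

Definition smooth_form n (M : manifold R n) (W : set M)
    (eta : M -> 'Hom('rV[R]_n, R^o)) : Prop :=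
  forall (q : M) (i : 'I_n), smooth_on
    (chart_map (chart_at q) @` (W `&` chart_dom (chart_at q)))
    (form_in q eta i).

(* eta is a nonvanishing 1-form on the open set V that induces C there; it is a
   precontact (resp. contact) form when C is a precontact (resp. contact)
   structure. *)
Definition form_inducing n (M : manifold R n) (C : tangent_distribution M)
    (V : set M) (eta : M -> 'Hom('rV[R]_n, R^o)) : Prop :=
  [/\ open V, smooth_form V eta &
      forall p, V p -> eta p <> 0 /\ C p = lker (eta p)].

Definition pullback m n (N : manifold R m) (M : manifold R n) (f : N -> M)
    (eta : M -> 'Hom('rV[R]_n, R^o)) (p : N) : 'Hom('rV[R]_m, R^o) :=
  (eta (f p) \o tangent_map f p)%VF.

End Manifolds.

(* Main.v *)
(** Let chi be the characteristic distribution of C. Two integral submanifolds of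
    chi through the same point agree near it (a Gronwall estimate), so the union
    of two leaves sharing a point is again an integral submanifold and the leaves
    are the fibres of p0; hence chi is contained in ker Tp0. Conversely, a vector
    of ker Tp0 is tangent to a curve contained in a fibre, that is, in a leaf
    i(N). As N is second countable and the curve is uncountable, the curve
    accumulates in the topology of N at parameters as close to 0 as we like; at
    these its velocity is tangent to the leaf. So ker Tp0 = chi by continuity.

    In coordinates where p0 is linear, a local form a of C vanishes on ker Tp0,
    and i_v da is proportional to a for v in ker Tp0. Hence the kernel of a is
    constant along the fibres and a = mu p0^*(alpha) locally, with mu a
    nonvanishing function. As the leaves are connected, the kernels of the forms
    alpha define a hyperplane field C0 with C0(p0 y) = Tp0(C y). On C,
    da = mu p0^*(d alpha), so the characteristic vectors of C0 lift to chi and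
    vanish: C0 is a contact structure. *)
Require Import Defs.
From HB Require Import structures.
From mathcomp Require Import all_boot all_order all_algebra.
From mathcomp Require Import all_classical all_reals all_analysis.
From mathcomp Require Import ring lra.
Set Implicit Arguments.
Unset Strict Implicit.
Unset Printing Implicit Defensive.
Import Order.TTheory GRing.Theory Num.Theory.
Import numFieldNormedType.Exports.
Local Open Scope classical_set_scope.
Local Open Scope ring_scope.

(** The obstacle is that a leaf is only the image of an injective immersion i : N -> M. A curve of M
    lying in i(N) lifts to a map into N that is not known in advance to be continuous, so it cannot
    be differentiated there; countability of the topology of N replaces the regularity of the lift.
    For the same reason the union of two leaves is given a topology of its own rather than that of
    M. That a leaf passes through every point comes with [simple_with]; what has to be proved is
    that distinct leaves do not meet. The characteristic distribution enters the uniqueness and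
    limit arguments through linear equations [v *m Phi z = 0] with smooth coefficients: a condition
    that passes to limits and is Lipschitz in z, as the Gronwall estimate requires. Since T_pM is
    modelled by the chart chosen at p, vectors at different points cannot be compared directly.
    Local computations are therefore carried out on the parameter space of a map psi : R^n -> M,
    where C becomes the kernel of a row of coefficients. *)

Lemma near_continuous_ext (T U : topologicalType) (f g : T -> U) (x : T) :
  (\forall y \near x, f y = g y) -> {for x, continuous f} ->
  {for x, continuous g}.
Proof.
move=> fg cf; rewrite /prop_for /continuous_at -(nbhs_singleton fg).
by apply: cvg_trans cf; apply: near_eq_cvg; apply: filterS fg => y ->.
Qed.

(** * Smooth germs *)

Section ScalarDerivative.
Context {R : realType} {V : normedModType R}.
Implicit Types (f g : V -> R) (x v : V).

Lemma rderivM f g x v : derivable f x v -> derivable g x v ->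
  is_derive x v (fun y => f y * g y) (f x * 'D_v g x + g x * 'D_v f x).
Proof.
move=> df dg.
have := @is_deriveM R V f g x v _ _ (derivableP df) (derivableP dg).
exact.
Qed.

Lemma rderivV f x v : f x != 0 -> derivable f x v ->
  is_derive x v (fun y => (f y)^-1) ((- ((f x)^-1 * (f x)^-1)) * 'D_v f x).
Proof.
move=> f0 df; apply: DeriveDef; first exact: derivableV.
by rewrite deriveV // -invfM -expr2.
Qed.
End ScalarDerivative.

Section Germs.
Context {R : realType} {n : nat}.
Local Notation E := 'rV[R]_n.

(* Versions of [Ck] and [smooth_on] for the germ of a map at a point. *)
Fixpoint ckat (V : normedModType R) (k : nat) (f : E -> V) (u : E) : Prop :=
  (\forall v \near u, {for v, continuous f}) /\
  match k with
  | 0 => True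
  | k'.+1 => forall i : 'I_n,
      (\forall v \near u, derivable f v (delta_mx 0 i)) /\
      ckat k' (fun v => 'D_(delta_mx 0 i) f v) u
  end.

Definition smat (V : normedModType R) (f : E -> V) (u : E) : Prop :=
  \forall v \near u, forall k, ckat k f v.

Lemma Ck_ckat (V : normedModType R) k A (f : E -> V) u :
  open A -> A u -> Ck k A f -> ckat k f u.
Proof.
move=> oA; have nA u' : A u' -> nbhs u' A by move=> ?; exact: open_nbhs_nbhs.
elim: k f => [|k IH] f Au /= [fc H]; split => //.
- by apply: filterS (nA _ Au) => v; exact: fc.
- by apply: filterS (nA _ Au) => v; exact: fc.
- move=> i; have [di ci] := H i; split; last exact: IH.
  by apply: filterS (nA _ Au) => v; exact: di.
Qed.

Lemma ckat_Ck (V : normedModType R) k A (f : E -> V) :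
  (forall u, A u -> ckat k f u) -> Ck k A f.
Proof.
elim: k f => [|k IH] f H /=; split => //.
- by move=> u /H[/nbhs_singleton].
- by move=> u /H[/nbhs_singleton].
- move=> i; split; first by move=> u /H[_ /(_ i)[/nbhs_singleton]].
  by apply: IH => u /H[_ /(_ i)[]].
Qed.

(** The open set [A] is one neighbourhood of [u] for all orders at once. This is why [smat]
    quantifies the order inside the neighbourhood, and it makes the notion pass to nearby points. *)
Lemma smat_on (V : normedModType R) A (f : E -> V) : open A ->
  smooth_on A f <-> forall u, A u -> smat f u.
Proof.
move=> oA; split.
  move=> sf u Au; apply: filterS (open_nbhs_nbhs (conj oA Au)) => v Av k.
  exact: Ck_ckat (sf k).
by move=> sf k; apply: ckat_Ck => u /sf /nbhs_singleton; exact.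
Qed.

Lemma smat_near (V : normedModType R) (f : E -> V) u :
  smat f u -> \forall v \near u, smat f v.
Proof. by move=> sf; apply: near_join; exact: sf. Qed.

Lemma ckat_ext (V : normedModType R) k (f g : E -> V) u :
  (\forall v \near u, f v = g v) -> ckat k f u -> ckat k g u.
Proof.
have cext (f' g' : E -> V) (u' : E) : (\forall v \near u', f' v = g' v) ->
    (\forall v \near u', {for v, continuous f'}) ->
    (\forall v \near u', {for v, continuous g'}).
  move=> /near_join fg cf; near=> v.
  by apply: (@near_continuous_ext _ _ f'); near: v.
elim: k f g => [|k IH] f g fg /= [cf H]; split => //; try exact: cext cf.
have fg2 := near_join fg.
move=> i; have [di ci] := H i; split.
  by near=> v; apply: (@near_eq_derivable _ _ _ f); near: v.
by apply: IH ci; near=> v; apply: near_eq_derive; near: v.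
Unshelve. all: by end_near. Qed.

Lemma smat_ext (V : normedModType R) (f g : E -> V) u :
  (\forall v \near u, f v = g v) -> smat f u -> smat g u.
Proof.
move=> /near_join fg sf; near=> v; move=> k; apply: (@ckat_ext _ _ f).
  by near: v.
by move: k; near: v.
Unshelve. all: by end_near. Qed.

Lemma ckatS (V : normedModType R) k (f : E -> V) u :
  ckat k.+1 f u -> ckat k f u.
Proof.
elim: k f => [|k IH] f [cf H]; split => // i.
by have [? ?] := H i; split => //; exact: IH.
Qed.

Lemma ckat_cst (V : normedModType R) k (c : V) u : ckat k (fun=> c) u.
Proof.
elim: k c => [|k IH] c /=; split => //; try by near=> v; exact: cst_continuous.
move=> i; split; first by near=> v; exact: derivable_cst.
apply: (@ckat_ext _ _ (fun=> 0)); last exact: IH.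
by near=> v; rewrite derive_cst.
Unshelve. all: by end_near. Qed.

Lemma ckat_add (V : normedModType R) k (f g : E -> V) u :
  ckat k f u -> ckat k g u -> ckat k (fun v => f v + g v) u.
Proof.
elim: k f g => [|k IH] f g /= [cf Hf] [cg Hg]; split => //.
- by near=> v; apply: continuousD; near: v.
- by near=> v; apply: continuousD; near: v.
move=> i; have [df sf] := Hf i; have [dg sg] := Hg i; split.
  by near=> v; apply: derivableD; near: v.
apply: ckat_ext (IH _ _ sf sg); near=> v; rewrite deriveD //.
  by near: v.
by near: v.
Unshelve. all: by end_near. Qed.

Lemma ckat_mul k (f g : E -> R) u :
  ckat k f u -> ckat k g u -> ckat k (fun v => f v * g v) u.
Proof.
elim: k f g => [|k IH] f g ckf ckg; have [cf Hf] := ckf; have [cg Hg] := ckg.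
  split => //; apply: filterS2 cf cg => v cfv cgv; exact: continuousM.
split; first by apply: filterS2 cf cg => v cfv cgv; exact: continuousM.
move=> i; have [df sf] := Hf i; have [dg sg] := Hg i; split.
  apply: filterS2 df dg => v dfv dgv.
  exact: (@ex_derive _ _ _ _ _ _ _ (rderivM dfv dgv)).
apply: (@ckat_ext _ _ (fun v => f v * 'D_(delta_mx 0 i) g v +
   g v * 'D_(delta_mx 0 i) f v)).
  apply: filterS2 df dg => v dfv dgv.
  exact/esym/(@derive_val _ _ _ _ _ _ _ (rderivM dfv dgv)).
by apply: ckat_add; apply: IH => //; exact: ckatS.
Qed.

Lemma ckat_inv k (f : E -> R) u :
  f u != 0 -> ckat k f u -> ckat k (fun v => (f v)^-1) u.
Proof.
move=> f0; elim: k f f0 => [|k IH] f f0 ckf; have [cf Hf] := ckf;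
    have nf0 : \forall v \near u, f v != 0 by
      apply: (cvgr_neq0 _ (nbhs_singleton cf)).
  by split => //; apply: filterS2 cf nf0 => v cfv f0v; exact: continuousV.
split; first by apply: filterS2 cf nf0 => v cfv f0v; exact: continuousV.
move=> i; have [df sf] := Hf i; split.
  apply: filterS2 df nf0 => v dfv f0v.
  exact: (@ex_derive _ _ _ _ _ _ _ (rderivV f0v dfv)).
apply: (@ckat_ext _ _ (fun v => (-1 * ((f v)^-1 * (f v)^-1)) * 'D_(delta_mx 0 i) f v)).
  apply: filterS2 df nf0 => v dfv f0v; rewrite mulN1r.
  exact/esym/(@derive_val _ _ _ _ _ _ _ (rderivV f0v dfv)).
have ckV := IH _ f0 (ckatS ckf).
apply: ckat_mul => //; apply: ckat_mul; first exact: ckat_cst.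
exact: ckat_mul.
Qed.

Lemma ckat_sum (V : normedModType R) k (I : Type) (s : seq I) (P : pred I)
    (F : I -> E -> V) u :
  (forall i, P i -> ckat k (F i) u) ->
  ckat k (fun v => \sum_(i <- s | P i) F i v) u.
Proof.
move=> H; elim: s => [|i s IH].
  apply: ckat_ext (ckat_cst k 0 u); near=> v; by rewrite big_nil.
case Pi: (P i).
  apply: ckat_ext (ckat_add (H _ Pi) IH); near=> v; by rewrite big_cons Pi.
apply: ckat_ext IH; near=> v; by rewrite big_cons Pi.
Unshelve. all: by end_near. Qed.

Lemma ckat_prod k (I : Type) (s : seq I) (P : pred I) (F : I -> E -> R) u :
  (forall i, P i -> ckat k (F i) u) ->
  ckat k (fun v => \prod_(i <- s | P i) F i v) u.
Proof.
move=> H; elim: s => [|i s IH].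
  apply: (@ckat_ext _ _ (fun=> 1 : R)); last exact: ckat_cst.
  by near=> v; rewrite big_nil.
case Pi: (P i).
  apply: ckat_ext (ckat_mul (H _ Pi) IH); near=> v; by rewrite big_cons Pi.
apply: ckat_ext IH; near=> v; by rewrite big_cons Pi.
Unshelve. all: by end_near. Qed.

End Germs.

Lemma near_forall (T : topologicalType) (I : finType) (x : T)
    (P : I -> T -> Prop) :
  (forall i, \forall y \near x, P i y) -> \forall y \near x, forall i, P i y.
Proof. by move=> H; exact: filter_forall. Qed.

Lemma near_impl (T : topologicalType) (x : T) (P Q : T -> Prop) :
  (forall y, P y -> Q y) -> (\forall y \near x, P y) -> \forall y \near x, Q y.
Proof. by move=> PQ; apply: filterS. Qed.

Lemma near_impl2 (T : topologicalType) (x : T) (P1 P2 Q : T -> Prop) :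
  (forall y, P1 y -> P2 y -> Q y) ->
  (\forall y \near x, P1 y) -> (\forall y \near x, P2 y) ->
  \forall y \near x, Q y.
Proof. by move=> PQ; apply: filterS2. Qed.

Lemma near_and (T : topologicalType) (x : T) (P Q : T -> Prop) :
  (\forall y \near x, P y) -> (\forall y \near x, Q y) ->
  \forall y \near x, P y /\ Q y.
Proof. exact: filterI. Qed.

Lemma near_comp (T U : topologicalType) (f : T -> U) (x : T) (P : U -> Prop) :
  {for x, continuous f} -> (\forall y \near f x, P y) ->
  \forall z \near x, P (f z).
Proof. by move=> cf /cf. Qed.

Lemma near_normP (R : realType) (V : normedModType R) (x : V) (P : V -> Prop) :
  (\forall y \near x, P y) <->
  exists2 d : R, 0 < d & forall y, `|y - x| < d -> P y.
Proof.
split=> [/nbhs_normP[d /= d0 Hd]|[d d0 Hd]].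
  by exists d => // y; rewrite distrC; exact: Hd.
by apply/nbhs_normP; exists d => // y /=; rewrite distrC; exact: Hd.
Qed.

(** * Mean values and total differentiability *)

Section Lines.
Context {R : realType} {V W : normedModType R}.

Lemma is_derive_line (f : V -> W) (x v : V) (t : R) :
  derivable f (x + t *: v) v ->
  is_derive t 1 (fun s => f (x + s *: v)) ('D_v f (x + t *: v)).
Proof.
have e : (fun h : R => h^-1 *: (((fun s => f (x + s *: v)) \o shift t) (h *: 1) -
    f (x + t *: v))) =
  (fun h => h^-1 *: ((f \o shift (x + t *: v)) (h *: v) - f (x + t *: v))).
  apply/funext => h /=; congr (_ *: (f _ - _)).
  by rewrite [h *: 1]mulr1 scalerDl addrCA.
by move=> df; apply: DeriveDef; rewrite /derivable /derive e.
Qed.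
End Lines.

Section MeanValue.
Context {R : realType} {V : normedModType R}.

Lemma line_mvt (f : V -> R) (x v : V) (s : R) :
  (forall t : R, `|t| <= `|s| -> derivable f (x + t *: v) v) ->
  exists2 c : R, `|c| <= `|s| &
    f (x + s *: v) - f x = s * 'D_v f (x + c *: v).
Proof.
move=> df; pose g t := f (x + t *: v).
have dg (t : R) : `|t| <= `|s| -> is_derive t (1:R) g ('D_v f (x + t *: v)).
  by move=> /df; exact: is_derive_line.
have cg (a b : R) : (forall t : R, a <= t <= b -> `|t| <= `|s|) ->
    {within `[a, b], continuous g}.
  move=> ab; apply: derivable_within_continuous => t; rewrite in_itv /= => tab.
  by have [] := dg _ (ab _ tab).
have [s0|s0|s0] := ltgtP s 0.
- have ab (t : R) : s <= t <= 0 -> `|t| <= `|s|.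
    by move=> /andP[st t0]; rewrite !ler0_norm ?lerN2 // ltW.
  have dg' (t : R) : t \in `]s, 0[ -> is_derive t (1 : R) g ('D_v f (x + t *: v)).
    by rewrite in_itv /= => /andP[st t0]; apply: dg; rewrite ab // !ltW.
  have [c] := MVT s0 dg' (cg _ _ ab).
  rewrite in_itv /= => /andP[sc c0] e; exists c; first by rewrite ab // !ltW.
  move/(congr1 -%R): e; rewrite opprB /g scale0r addr0 => ->.
  by rewrite sub0r mulrN opprK mulrC.
- have ab (t : R) : 0 <= t <= s -> `|t| <= `|s|.
    by move=> /andP[t0 ts]; rewrite !ger0_norm // ltW.
  have dg' (t : R) : t \in `]0, s[ -> is_derive t (1 : R) g ('D_v f (x + t *: v)).
    by rewrite in_itv /= => /andP[st t0]; apply: dg; rewrite ab // !ltW.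
  have [c] := MVT s0 dg' (cg _ _ ab).
  rewrite in_itv /= => /andP[sc c0] e; exists c; first by rewrite ab // !ltW.
  by move: e; rewrite /g scale0r addr0 subr0 => ->; rewrite mulrC.
- by exists 0; rewrite ?normr0 // s0 scale0r addr0 subrr mul0r.
Qed.
End MeanValue.

Section Dot.
Context {R : realType} {n : nat}.

Definition dot (a v : 'rV[R]_n) : R := \sum_i a 0 i * v 0 i.

Fact dot_is_linear a : linear (dot a : _ -> R).
Proof.
move=> k u v; rewrite /dot scaler_sumr -big_split; apply: eq_bigr => i _ /=.
by rewrite !mxE mulrDr mulrCA.
Qed.
HB.instance Definition _ a := GRing.isLinear.Build _ _ _ _ (dot a) (dot_is_linear a).

Lemma dotC a b : dot a b = dot b a.
Proof. by apply: eq_bigr => i _; rewrite mulrC. Qed.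

Lemma dot_delta a i : dot a (delta_mx 0 i) = a 0 i.
Proof.
rewrite /dot (bigD1 i) //= mxE !eqxx mulr1 big1 ?addr0 // => j ji.
by rewrite mxE (negbTE ji) andbF mulr0.
Qed.

Lemma coord_norm (v : 'rV[R]_n) i : `|v 0 i| <= `|v|.
Proof.
by rewrite [leRHS]/Num.Def.normr /= mx_normrE; exact: (le_bigmax _ _ (0, i)).
Qed.

Lemma rV_norm_le (v : 'rV[R]_n) (c : R) : 0 <= c ->
  (forall i, `|v 0 i| <= c) -> `|v| <= c.
Proof.
move=> c0 H; rewrite [leLHS]/Num.Def.normr /= mx_normrE.
by apply: bigmax_le => // -[i j] _; rewrite ord1.
Qed.

Lemma dot_le (a v : 'rV[R]_n) : `|dot a v| <= n%:R * (`|a| * `|v|).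
Proof.
apply: le_trans (ler_norm_sum _ _ _) _.
rewrite mulrC mulr_natr -[X in _ *+ X]card_ord -sumr_const; apply: ler_sum => i _.
by rewrite normrM ler_pM // coord_norm.
Qed.

End Dot.

Section LinearRowMaps.
Context {R : realType} {n : nat} {V : normedModType R}.
Implicit Type f : {linear 'rV[R]_n -> V}.

Lemma linear_rV_bound f : exists2 K, 0 <= K & forall v, `|f v| <= K * `|v|.
Proof.
exists (\sum_i `|f (delta_mx 0 i)|); first exact: sumr_ge0.
move=> v; rewrite [v in leLHS]row_sum_delta linear_sum.
apply: le_trans (ler_norm_sum _ _ _) _; rewrite mulr_suml.
apply: ler_sum => i _.
by rewrite linearZ normrZ mulrC ler_wpM2l // coord_norm.
Qed.

Lemma linear_rV_continuous f : continuous f.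
Proof.
have [K K0 fK] := linear_rV_bound f.
apply: bounded_linear_continuous; apply/bounded_funP => r.
exists (K * r) => v vr; exact: le_trans (fK v) (ler_wpM2l K0 vr).
Qed.

Lemma linear_rV_differentiable f u : differentiable f u.
Proof. exact/linear_differentiable/linear_rV_continuous. Qed.

Lemma linear_rV_diff f u : 'd f u = f :> ('rV[R]_n -> V).
Proof. exact/diff_lin/linear_rV_continuous. Qed.

End LinearRowMaps.

Section PartialDerivatives.
Context {R : realType} {n : nat}.
Local Notation E := 'rV[R]_n.

Lemma linear_approx_differentiable (V : normedModType R) (f : E -> V)
    (L : {linear E -> V}) (u : E) :
  (forall e : R, 0 < e ->
    \forall v \near (0 : E), `|f (v + u) - f u - L v| <= e * `|v|) ->
  differentiable f u /\ 'd f u = L :> (E -> V).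
Proof.
move=> H.
have eq : f \o shift u = cst (f u) + (L : E -> V) +o_ (0 : E) id.
  apply/eqaddoP => e e0; apply: near_impl (H e e0) => v.
  suff -> : f (v + u) - f u - L v =
      (f \o shift u - (cst (f u) + (L : E -> V))) v by [].
  by rewrite /= opprD addrA.
have dE := diff_unique (@linear_rV_continuous _ _ _ L) eq; split => //.
by apply/diff_locallyP; rewrite dE; split => //; exact: linear_rV_continuous.
Qed.

(** One goes from u to u + v one coordinate at a time: each increment of f is a partial derivative
    at an intermediate point, which continuity at u replaces by the partial derivative at u. *)
Lemma partials_differentiable (f : E -> R) (u : E) :
  (forall i, \forall v \near u, derivable f v (delta_mx 0 i)) ->
  (forall i, {for u, continuous (fun v => 'D_(delta_mx 0 i) f v)}) ->
  differentiable f u /\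
  'd f u = dot (\row_i 'D_(delta_mx 0 i) f u) :> (E -> R).
Proof.
move=> df cf; apply: linear_approx_differentiable => e e0.
have n0 : 0 < n.+1%:R :> R by rewrite ltr0n.
(* The n errors, each at most e' times the norm of v, must add up to at most e times that norm;
   [n.+1] avoids a division by zero. *)
pose e' := e / n.+1%:R; have e'0 : 0 < e' by rewrite divr_gt0.
have H : \forall v \near u, forall i, derivable f v (delta_mx 0 i) /\
    `|'D_(delta_mx 0 i) f u - 'D_(delta_mx 0 i) f v| < e'.
  apply: near_forall => i.
  have cd : \forall v \near u, `|'D_(delta_mx 0 i) f u - 'D_(delta_mx 0 i) f v| < e'.
    by move/cvgrPdist_lt : (cf i) => /(_ _ e'0).
  apply: near_impl2 (df i) cd => v; exact: conj.
have [d d0 Hd] := (near_normP _ _).1 H.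
apply/near_normP; exists d => // v; rewrite subr0 => vd.
(* [w j] keeps the coordinates of v of index below j, so the path goes from [w 0 = 0] to [w n = v]
   by steps along the axes. *)
pose w j : E := \row_l (if (l < j)%N then v 0 l else 0).
have w0 : w 0 = 0 by apply/rowP => l; rewrite !mxE.
have wn : w n = v by apply/rowP => l; rewrite !mxE ltn_ord.
have wS (i : 'I_n) : w i.+1 = w i + v 0 i *: delta_mx 0 i.
  apply/rowP => l; rewrite !mxE eqxx /= ltnS leq_eqVlt.
  have [->|li] := eqVneq l i; first by rewrite eqxx ltnn /= mulr1 add0r.
  by rewrite (negbTE (li : l != i :> nat)) /= mulr0 addr0.
have wd (i : 'I_n) (c : R) : `|c| <= `|v 0 i| ->
    `|w i + c *: delta_mx 0 i| <= `|v|.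
  move=> cv; apply: rV_norm_le => // l; rewrite !mxE eqxx /=.
  have [->|li] := eqVneq l i.
    by rewrite ltnn add0r mulr1 (le_trans cv) // coord_norm.
  by rewrite mulr0 addr0; case: ifP; rewrite ?coord_norm // normr0.
have -> : f (v + u) - f u = \sum_(i < n) (f (u + w i.+1) - f (u + w i)).
  rewrite -(big_mkord xpredT (fun i => f (u + w i.+1) - f (u + w i))).
  rewrite (telescope_sumr (fun i => f (u + w i))) // w0 wn addr0.
  by rewrite [u + v]addrC.
rewrite /dot -sumrB; apply: le_trans (ler_norm_sum _ _ _) _.
apply: (@le_trans _ _ (\sum_(i < n) e' * `|v|)); last first.
  rewrite sumr_const card_ord -mulr_natr mulrAC ler_wpM2r //.
  by rewrite /e' -mulrA ler_piMr ?ltW // mulrC ltr_pdivrMr // mul1r ltr_nat.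
apply: ler_sum => i _.
have nd (c : R) : `|c| <= `|v 0 i| -> derivable f (u + w i + c *: delta_mx 0 i)
    (delta_mx 0 i) /\ `|'D_(delta_mx 0 i) f u -
      'D_(delta_mx 0 i) f (u + w i + c *: delta_mx 0 i)| < e'.
  move=> cv; apply: Hd; rewrite -(addrA u) [u + _]addrC addrK.
  exact: le_lt_trans (wd _ _ cv) vd.
have [c cv] := @line_mvt _ _ f (u + w i) (delta_mx 0 i) (v 0 i)
  (fun c cv => (nd c cv).1).
rewrite wS addrA => ->; rewrite mxE [X in _ - X]mulrC -mulrBr normrM mulrC.
by rewrite ler_pM // ?coord_norm // ltW // distrC; exact: (nd c cv).2.
Qed.

End PartialDerivatives.

Lemma diff_compE (R : realType) (U V W : normedModType R) (f : U -> V)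
    (g : V -> W) x v :
  differentiable f x -> differentiable g (f x) ->
  'd (g \o f) x v = 'd g (f x) ('d f x v).
Proof. by move=> df dg; have /(congr1 (fun h => h v)) := diff_comp df dg. Qed.

Section SmoothMaps.
Context {R : realType}.

Lemma ckat_near n (V : normedModType R) k (f : 'rV[R]_n -> V) u :
  ckat k f u -> \forall v \near u, ckat k f v.
Proof.
elim: k f => [|k IH] f [cf H].
  by apply: near_impl (near_join cf) => v cv; split.
have H' i : \forall v \near u, (\forall w \near v, derivable f w (delta_mx 0 i)) /\
    ckat k (fun w => 'D_(delta_mx 0 i) f w) v.
  have [df ck] := H i.
  by apply: near_impl2 (near_join df) (IH _ ck) => v; exact: conj.
by apply: near_impl2 (near_join cf) (near_forall H') => v cv Hv; split.
Qed.

Lemma ckat_le n (V : normedModType R) k l (f : 'rV[R]_n -> V) u :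
  (k <= l)%N -> ckat l f u -> ckat k f u.
Proof.
move=> /subnK <-; elim: (l - k)%N => // d IH /ckatS; exact: IH.
Qed.

Lemma ckat_continuous n (V : normedModType R) k (f : 'rV[R]_n -> V) u :
  ckat k f u -> {for u, continuous f}.
Proof. by case: k => [|k] [/nbhs_singleton]. Qed.

Lemma ckat1_diff n (f : 'rV[R]_n -> R) u : ckat 1 f u ->
  differentiable f u /\
  'd f u = dot (\row_i 'D_(delta_mx 0 i) f u) :> ('rV[R]_n -> R).
Proof.
move=> [_ H]; apply: partials_differentiable => i.
  by have [] := H i.
by have [_ [/nbhs_singleton]] := H i.
Qed.

Lemma mx_continuousP (T : topologicalType) p q (f : T -> 'M[R]_(p, q)) x :
  {for x, continuous f} <-> forall i j, {for x, continuous (fun y => f y i j)}.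
Proof.
split=> [cf i j|cf].
  apply: (@continuous_comp _ _ _ f (fun A : 'M[R]_(p, q) => A i j)) => //.
  exact: coord_continuous.
apply/cvgrPdist_le => e e0.
have H : \forall y \near x, forall ij : 'I_p * 'I_q,
    `|f x ij.1 ij.2 - f y ij.1 ij.2| <= e.
  apply: near_forall => ij.
  by move/cvgrPdist_le : (cf ij.1 ij.2) => /(_ _ e0).
apply: near_impl H => y H; rewrite [leLHS]/Num.Def.normr /= mx_normrE.
by apply: bigmax_le => [|ij _]; [exact: ltW|rewrite !mxE; exact: H].
Qed.

Lemma ckat_mxP n p q k (f : 'rV[R]_n -> 'M[R]_(p, q)) u :
  ckat k f u <-> forall i j, ckat k (fun v => f v i j) u.
Proof.
elim: k f => [|k IH] f; split.
- move=> [cf _] i j; split=> //.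
  by apply: near_impl cf => v /mx_continuousP.
- move=> H; split=> //.
  have H' : \forall v \near u, forall ij : 'I_p * 'I_q,
      {for v, continuous (fun w => f w ij.1 ij.2)}.
    by apply: near_forall => ij; have [] := H ij.1 ij.2.
  by apply: near_impl H' => v Hv; apply/mx_continuousP => i j; exact: (Hv (i, j)).
- move=> [cf H] i j; split.
    by apply: near_impl cf => v /mx_continuousP.
  move=> l; have [df ck] := H l; split.
    by apply: near_impl df => v /derivable_mxP.
  apply: (@ckat_ext _ _ _ _ (fun v => ('D_(delta_mx 0 l) f v) i j)).
    by apply: near_impl df => v dfv; rewrite derive_mx // mxE.
  by move/IH: ck.
- move=> H; split.
    have H' : \forall v \near u, forall ij : 'I_p * 'I_q,
        {for v, continuous (fun w => f w ij.1 ij.2)}.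
      by apply: near_forall => ij; have [] := H ij.1 ij.2.
    by apply: near_impl H' => v Hv; apply/mx_continuousP => i j; exact: (Hv (i, j)).
  move=> l.
  have H' : \forall v \near u, derivable f v (delta_mx 0 l).
    have H' : \forall v \near u, forall ij : 'I_p * 'I_q,
        derivable (fun w => f w ij.1 ij.2) v (delta_mx 0 l).
      by apply: near_forall => ij; have [_ /(_ l)[]] := H ij.1 ij.2.
    by apply: near_impl H' => v Hv; apply/derivable_mxP => i j; exact: (Hv (i, j)).
  split=> //; apply/IH => i j; have [_ /(_ l)[_]] := H i j.
  by apply: ckat_ext; apply: near_impl H' => v dfv; rewrite derive_mx // mxE.
Qed.

Lemma diff_coord n p q (f : 'rV[R]_n -> 'M[R]_(p, q)) u v i j :
  differentiable f u -> ('d f u v) i j = 'd (fun x => f x i j) u v.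
Proof.
move=> df.
have dc := @differentiable_coord R p q (f u) i j.
have lc : linear (fun A : 'M[R]_(p, q) => A i j : R).
  by move=> k A B; rewrite !mxE.
pose m := GRing.isLinear.Build _ _ _ _ _ lc.
pose c : {linear _ -> _} := HB.pack (fun A : 'M[R]_(p, q) => A i j : R) m.
have cE : 'd (fun A : 'M[R]_(p, q) => A i j : R) (f u) = c :> (_ -> _).
  by apply: (@diff_lin _ _ _ c); exact: coord_continuous.
have := diff_comp df dc; rewrite cE => /(congr1 (fun h => h v)) /= e.
exact: esym e.
Qed.

Lemma differentiable_mx n p q (f : 'rV[R]_n -> 'M[R]_(p, q)) u :
  (forall i j, differentiable (fun x => f x i j) u) -> differentiable f u.
Proof.
move=> df.
have -> : f = \sum_(i < p) \sum_(j < q) (fun x => f x i j *: delta_mx i j).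
  apply/funext => x; rewrite [LHS]matrix_sum_delta fct_sumE.
  by apply: eq_bigr => i _; rewrite fct_sumE.
apply: differentiable_sum => i; apply: differentiable_sum => j.
exact: differentiableZl.
Qed.

Lemma ckat1_differentiable n p q (f : 'rV[R]_n -> 'M[R]_(p, q)) u :
  ckat 1 f u -> differentiable f u.
Proof.
move=> /ckat_mxP H; apply: differentiable_mx => i j.
by have [] := ckat1_diff (H i j).
Qed.

(** By the chain rule a partial derivative of [g \o f] is a sum of products of partial derivatives
    of g, composed with f, by partial derivatives of the components of f. These factors have one
    order less, so the induction applies to them. *)
Lemma ckat_comp m n k (f : 'rV[R]_m -> 'rV[R]_n) (g : 'rV[R]_n -> R) u :
  ckat k f u -> ckat k g (f u) -> ckat k (g \o f) u.
Proof.
elim: k g => [|k IH] g cf cg.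
  have cfu := ckat_continuous cf.
  split=> //; have [cf' _] := cf; have [cg' _] := cg.
  apply: near_impl2 cf' (near_comp cfu cg') => v cfv cgv.
  exact: continuous_comp.
have cfu := ckat_continuous cf.
have [cf' _] := cf; have [cg' Hg] := cg.
split.
  apply: near_impl2 cf' (near_comp cfu cg') => v cfv cgv.
  exact: continuous_comp.
have df : \forall v \near u, differentiable f v.
  apply: near_impl (ckat_near cf) => v /(ckat_le (l := k.+1) (k := 1)) H.
  exact/ckat1_differentiable/H.
have dg' : \forall w \near f u, differentiable g w /\
   'd g w = dot (\row_i 'D_(delta_mx 0 i) g w) :> ('rV[R]_n -> R).
  apply: near_impl (ckat_near cg) => v /(ckat_le (l := k.+1) (k := 1)) H.
  exact/ckat1_diff/H.
have dg := near_comp cfu dg'.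
move=> i; split.
  apply: near_impl2 df dg => v dfv [dgv _].
  exact/diff_derivable/differentiable_comp.
apply: (@ckat_ext _ _ _ _ (fun v => \sum_j ((fun w => 'D_(delta_mx 0 j) g w) \o f) v *
    ('D_(delta_mx 0 i) f v) 0 j)).
  apply: near_impl2 df dg => v dfv [dgv e].
  rewrite (deriveE _ (differentiable_comp dfv dgv)) (diff_compE _ dfv dgv) e.
  by rewrite -(deriveE _ dfv); apply: eq_bigr => j _; rewrite mxE.
apply: ckat_sum => j _; apply: ckat_mul; first by apply: IH (ckatS cf) (Hg j).2.
by have [_ /(_ i)[_ /ckat_mxP]] := cf.
Qed.

End SmoothMaps.

Section SmoothGerms.
Context {R : realType}.

Lemma smat_continuous n (V : normedModType R) (f : 'rV[R]_n -> V) u :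
  smat f u -> {for u, continuous f}.
Proof. by move=> /nbhs_singleton/(_ 0%N)[/nbhs_singleton]. Qed.

Lemma smat_differentiable n p q (f : 'rV[R]_n -> 'M[R]_(p, q)) u :
  smat f u -> differentiable f u.
Proof. by move=> /nbhs_singleton H; exact/ckat1_differentiable/H. Qed.

Lemma smat_diffR n (f : 'rV[R]_n -> R) u : smat f u ->
  differentiable f u /\
  'd f u = dot (\row_i 'D_(delta_mx 0 i) f u) :> ('rV[R]_n -> R).
Proof. by move=> /nbhs_singleton H; exact/ckat1_diff/H. Qed.

Lemma smat_cst n (V : normedModType R) (c : V) (u : 'rV[R]_n) :
  smat (fun=> c) u.
Proof. by apply: near_impl (filterT : nbhs u setT) => v _ k; exact: ckat_cst. Qed.

Lemma smat_add n (V : normedModType R) (f g : 'rV[R]_n -> V) u :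
  smat f u -> smat g u -> smat (fun v => f v + g v) u.
Proof. by apply: near_impl2 => v sf sg k; exact: ckat_add. Qed.

Lemma smat_mul n (f g : 'rV[R]_n -> R) u :
  smat f u -> smat g u -> smat (fun v => f v * g v) u.
Proof. by apply: near_impl2 => v sf sg k; exact: ckat_mul. Qed.

Lemma smat_near_neq0 n (f : 'rV[R]_n -> R) u :
  smat f u -> f u != 0 -> \forall v \near u, f v != 0.
Proof. by move=> sf; exact: (cvgr_neq0 _ (smat_continuous sf)). Qed.

Lemma smat_inv n (f : 'rV[R]_n -> R) u :
  f u != 0 -> smat f u -> smat (fun v => (f v)^-1) u.
Proof.
move=> f0 sf; apply: near_impl2 sf (smat_near_neq0 sf f0) => v sf fv k.
exact: ckat_inv.
Qed.

Lemma smat_mxP n p q (f : 'rV[R]_n -> 'M[R]_(p, q)) u :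
  smat f u <-> forall i j, smat (fun v => f v i j) u.
Proof.
split=> [sf i j|H].
  by apply: near_impl sf => v sf k; have /ckat_mxP := sf k.
have H' : \forall v \near u, forall ij : 'I_p * 'I_q, forall k,
    ckat k (fun v => f v ij.1 ij.2) v.
  by apply: near_forall => ij; exact: H.
apply: near_impl H' => v Hv k; apply/ckat_mxP => i j; exact: (Hv (i, j)).
Qed.

Lemma smat_sum n (V : normedModType R) (I : finType) (P : pred I)
    (F : I -> 'rV[R]_n -> V) u :
  (forall i, smat (F i) u) -> smat (fun v => \sum_(i | P i) F i v) u.
Proof.
move=> H; apply: near_impl (near_forall H) => v Hv k.
by apply: ckat_sum => i _; exact: Hv.
Qed.

Lemma smat_prod n (I : finType) (P : pred I) (F : I -> 'rV[R]_n -> R) u :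
  (forall i, smat (F i) u) -> smat (fun v => \prod_(i | P i) F i v) u.
Proof.
move=> H; apply: near_impl (near_forall H) => v Hv k.
by apply: ckat_prod => i _; exact: Hv.
Qed.

Lemma smat_compR m n (f : 'rV[R]_m -> 'rV[R]_n) (g : 'rV[R]_n -> R) u :
  smat f u -> smat g (f u) -> smat (g \o f) u.
Proof.
move=> sf sg; have := near_comp (smat_continuous sf) sg.
by apply: near_impl2 sf => v sf' sg' k; exact: ckat_comp.
Qed.

Lemma smat_comp m n p q (f : 'rV[R]_m -> 'rV[R]_n) (g : 'rV[R]_n -> 'M[R]_(p, q)) u :
  smat f u -> smat g (f u) -> smat (g \o f) u.
Proof.
by move=> sf /smat_mxP sg; apply/smat_mxP => i j; exact: smat_compR (sg i j).
Qed.

Lemma smat_linearR n (f : {linear 'rV[R]_n -> R}) u : smat f u.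
Proof.
apply: near_impl (filterT : nbhs u setT) => w _ k; elim: k w => [|k IH] w.
  split=> //; near=> v; exact: linear_rV_continuous.
split; first by near=> v; exact: linear_rV_continuous.
move=> i; split; first by near=> v; exact/diff_derivable/linear_rV_differentiable.
apply: (@ckat_ext _ _ _ _ (fun=> f (delta_mx 0 i))); last exact: ckat_cst.
near=> v; rewrite deriveE; last exact: linear_rV_differentiable.
by rewrite linear_rV_diff.
Unshelve. all: by end_near. Qed.

Lemma smat_linear n p q (f : {linear 'rV[R]_n -> 'M[R]_(p, q)}) u : smat f u.
Proof.
apply/smat_mxP => i j.
have lc : linear (fun v => f v i j : R).
  by move=> k A B; rewrite linearP !mxE.
pose m := GRing.isLinear.Build _ _ _ _ _ lc.
pose c : {linear _ -> _} := HB.pack (fun v => f v i j : R) m.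
exact: (@smat_linearR _ c).
Qed.

Lemma smat_id n (u : 'rV[R]_n) : smat id u.
Proof. exact: (@smat_linear _ _ _ idfun). Qed.

Lemma smat_coord n m (f : 'rV[R]_n -> 'rV[R]_m) u i :
  smat f u -> smat (fun v => f v 0 i) u.
Proof. by move=> /smat_mxP. Qed.

Lemma smat_scale n p q (a : 'rV[R]_n -> R) (f : 'rV[R]_n -> 'M[R]_(p, q)) u :
  smat a u -> smat f u -> smat (fun v => a v *: f v) u.
Proof.
move=> sa /smat_mxP sf; apply/smat_mxP => i j.
apply: smat_ext (smat_mul sa (sf i j)).
by apply: near_impl (filterT : nbhs u setT) => v _; rewrite mxE.
Qed.

Lemma smat_opp n (V : normedModType R) (f : 'rV[R]_n -> V) u :
  smat f u -> smat (fun v => - f v) u.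
Proof.
apply: near_impl => v sf k.
elim: k f {sf}(sf k) => [|k IH] f [cf H].
  by split=> //; apply: near_impl cf => w cf; exact: continuousN.
split; first by apply: near_impl cf => w cf; exact: continuousN.
move=> i; have [df ck] := H i; split.
  by apply: near_impl df => w; exact: derivableN.
by apply: ckat_ext (IH _ ck); apply: near_impl df => w df; rewrite deriveN.
Qed.

Lemma smat_sub n (V : normedModType R) (f g : 'rV[R]_n -> V) u :
  smat f u -> smat g u -> smat (fun v => f v - g v) u.
Proof. by move=> sf sg; exact: smat_add (smat_opp sg). Qed.

Lemma smat_mulmx n p q r (A : 'rV[R]_n -> 'M[R]_(p, q))
    (B : 'rV[R]_n -> 'M[R]_(q, r)) u :
  smat A u -> smat B u -> smat (fun v => A v *m B v) u.
Proof.
move=> /smat_mxP sA /smat_mxP sB; apply/smat_mxP => i j.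
apply: (@smat_ext _ _ _ (fun v => \sum_k A v i k * B v k j)).
  by apply: near_impl (filterT : nbhs u setT) => v _; rewrite mxE.
by apply: smat_sum => k; exact: smat_mul.
Qed.

Lemma smat_det n p (A : 'rV[R]_n -> 'M[R]_p) u :
  smat A u -> smat (fun v => \det (A v)) u.
Proof.
move=> /smat_mxP sA; rewrite /determinant.
apply: smat_sum => s; apply: smat_mul; first exact: smat_cst.
by apply: smat_prod.
Qed.

Lemma smat_unitmx n p (A : 'rV[R]_n -> 'M[R]_p) u :
  smat A u -> A u \in unitmx -> \forall v \near u, A v \in unitmx.
Proof.
rewrite unitmxE unitfE => sA uA.
have := smat_near_neq0 (smat_det sA) uA.
by apply: near_impl => v; rewrite unitmxE unitfE.
Qed.

(** Cramer's formula: the entries of the inverse are cofactors, polynomial in the entries of A,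
    divided by the determinant. *)
Lemma smat_invmx n p (A : 'rV[R]_n -> 'M[R]_p) u :
  smat A u -> A u \in unitmx -> smat (fun v => invmx (A v)) u.
Proof.
move=> sA uA.
apply: (@smat_ext _ _ _ (fun v => (\det (A v))^-1 *: \adj (A v))).
  by apply: near_impl (smat_unitmx sA uA) => v uv; rewrite /invmx uv.
apply: smat_scale.
  by apply: smat_inv; [rewrite -unitfE -unitmxE|exact: smat_det].
apply/smat_mxP => i j.
apply: (@smat_ext _ _ _ (fun v => (-1) ^+ (j + i) * \det (row' j (col' i (A v))))).
  by apply: near_impl (filterT : nbhs u setT) => v _; rewrite mxE.
apply: smat_mul; first exact: smat_cst.
apply: smat_det; apply/smat_mxP => k l.
apply: (@smat_ext _ _ _ (fun v => A v (lift j k) (lift i l))).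
  by apply: near_impl (filterT : nbhs u setT) => v _; rewrite !mxE.
by move/smat_mxP: sA.
Qed.

Lemma smat_partial n (V : normedModType R) (f : 'rV[R]_n -> V) u i :
  smat f u -> smat (fun v => 'D_(delta_mx 0 i) f v) u.
Proof. by apply: near_impl => v sf k; have [_ /(_ i)[]] := sf k.+1. Qed.

Lemma smat_diff n p q (f : 'rV[R]_n -> 'M[R]_(p, q)) (w : 'rV[R]_n -> 'rV[R]_n) u :
  smat f u -> smat w u -> smat (fun v => 'd f v (w v)) u.
Proof.
move=> sf sw; apply/smat_mxP => i j.
apply: (@smat_ext _ _ _ (fun v =>
    \sum_k 'D_(delta_mx 0 k) (fun x => f x i j) v * w v 0 k)).
  apply: near_impl (smat_near sf) => v sfv.
  rewrite diff_coord; last exact: smat_differentiable.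
  have /smat_mxP/(_ i j)/smat_diffR[_ ->] := sfv.
  by apply: eq_bigr => k _; rewrite mxE.
apply: smat_sum => k; apply: smat_mul; last exact: smat_coord.
by apply: smat_partial; move/smat_mxP: sf.
Qed.

Lemma smat_dot n m (a b : 'rV[R]_n -> 'rV[R]_m) u :
  smat a u -> smat b u -> smat (fun v => dot (a v) (b v)) u.
Proof.
move=> /smat_mxP sa /smat_mxP sb.
by apply: smat_sum => i; exact: smat_mul.
Qed.

End SmoothGerms.

(** * Symmetry of second derivatives *)

Section Schwarz.
Context {R : realType} {n : nat}.
Local Notation E := 'rV[R]_n.
Implicit Types (f : E -> R) (u : E).

Lemma norm_scale_delta (c : R) (i : 'I_n) : `|c *: delta_mx 0 i : E| <= `|c|.
Proof.
rewrite normrZ ler_piMr //; apply: rV_norm_le => // j; rewrite mxE eqxx /=.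
by case: (j == i); rewrite ?normr1 ?normr0.
Qed.

(** The mean value theorem is used twice: in direction i for the difference x |-> f (x + s e_j) - f
    x, then in direction j for the partial derivative of f in direction i. Both intermediate points
    stay within 2 s of u. *)
Lemma second_difference f u (i j : 'I_n) (d s : R) :
  (forall p, `|p - u| < d -> derivable f p (delta_mx 0 i) /\
     derivable (fun q => 'D_(delta_mx 0 i) f q) p (delta_mx 0 j)) ->
  0 < s -> s *+ 2 < d ->
  exists2 p, `|p - u| <= s *+ 2 &
    f (u + s *: delta_mx 0 i + s *: delta_mx 0 j) - f (u + s *: delta_mx 0 i)
      - (f (u + s *: delta_mx 0 j) - f u) =
    s * (s * 'D_(delta_mx 0 j) (fun q => 'D_(delta_mx 0 i) f q) p).
Proof.
move=> H s0 sd.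
pose ei : E := delta_mx 0 i; pose ej : E := delta_mx 0 j.
have bd (a b : R) : `|a| <= `|s| -> `|b| <= `|s| ->
    `|u + a *: ei + b *: ej - u| <= s *+ 2.
  move=> la lb; rewrite -(addrA u) [u + _]addrC addrK.
  rewrite (le_trans (ler_normD _ _)) // mulr2n -(gtr0_norm s0).
  by rewrite lerD // (le_trans (norm_scale_delta _ _)).
have bdi (a : R) : `|a| <= `|s| -> `|u + a *: ei - u| < d.
  move=> la; have := bd a 0 la; rewrite scale0r addr0 normr0 => /(_ (normr_ge0 _)).
  by move=> /le_lt_trans; exact.
pose phi x := f (x + s *: ej) - f x.
have shift x : is_derive x ei (fun x => f (x + s *: ej)) ('D_ei f (x + s *: ej)) <->
    derivable f (x + s *: ej) ei.
  have e : (fun h : R => h^-1 *: (((fun x => f (x + s *: ej)) \o shift x) (h *: ei) -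
      f (x + s *: ej))) =
     (fun h => h^-1 *: ((f \o shift (x + s *: ej)) (h *: ei) - f (x + s *: ej))).
    by apply/funext => h /=; rewrite addrA.
  split; first by case; rewrite /derivable e.
  by move=> df; apply: DeriveDef; rewrite /derivable /derive e.
have dphi (c : R) : `|c| <= `|s| -> is_derive (u + c *: ei) ei phi
   ('D_ei f (u + c *: ei + s *: ej) - 'D_ei f (u + c *: ei)).
  move=> cs; apply: is_deriveB.
    apply/shift; exact: (H _ (le_lt_trans (bd _ _ cs (lexx _)) sd)).1.
  apply: derivableP; exact: (H _ (bdi _ cs)).1.
have [c cs] := @line_mvt _ _ phi u ei s (fun c cs => @ex_derive _ _ _ _ _ _ _ (dphi c cs)).
rewrite (@derive_val _ _ _ _ _ _ _ (dphi c cs)) {1}/phi => ->.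
have [c' c's ->] := @line_mvt _ _ (fun q => 'D_ei f q) (u + c *: ei) ej s
   (fun c' c's => (H _ (le_lt_trans (bd _ _ cs c's) sd)).2).
by exists (u + c *: ei + c' *: ej) => //; exact: bd.
Qed.

(** The two orders of differentiation produce different mean value points, so the mixed derivatives
    are only known to take a common value at two points near u; continuity brings both points to
    u. *)
Lemma eq_of_common_values (V : normedModType R) (A B : V -> R) (u : V) :
  {for u, continuous A} -> {for u, continuous B} ->
  (forall d : R, 0 < d -> exists p q, [/\ `|p - u| < d, `|q - u| < d & A p = B q]) ->
  A u = B u.
Proof.
move=> cA cB H; apply/eqP/negP => /negP neq.
have e0 : 0 < `|A u - B u| / 2 by rewrite divr_gt0 // normr_gt0 subr_eq0.
have nA : \forall p \near u, `|A u - A p| < `|A u - B u| / 2.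
  by move/cvgrPdist_lt: cA => /(_ _ e0).
have nB : \forall p \near u, `|B u - B p| < `|A u - B u| / 2.
  by move/cvgrPdist_lt: cB => /(_ _ e0).
have [d d0 Hd] := (near_normP _ _).1 (near_and nA nB).
have [p [q [pu qu e]]] := H d d0.
have [_ lt1] := Hd q qu; have [lt2 _] := Hd p pu.
have := ler_distD (A p) (A u) (B u); rewrite leNgt => /negP; apply.
by rewrite [ltRHS]splitr ltrD // e distrC.
Qed.

Lemma subrBB_swap (a b c d : R) : a - b - (c - d) = a - c - (b - d).
Proof. by rewrite !opprD !opprK !addrA; congr (_ + _); rewrite addrAC. Qed.

(** The second difference is unchanged when i and j are exchanged, and [second_difference] evaluates
    it in either order. *)
Lemma schwarz f u (i j : 'I_n) : ckat 2 f u ->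
  'D_(delta_mx 0 j) (fun q => 'D_(delta_mx 0 i) f q) u =
  'D_(delta_mx 0 i) (fun q => 'D_(delta_mx 0 j) f q) u.
Proof.
move=> [_ H].
have nd (k l : 'I_n) : exists2 d : R, 0 < d & forall p, `|p - u| < d ->
   derivable f p (delta_mx 0 k) /\
     derivable (fun q => 'D_(delta_mx 0 k) f q) p (delta_mx 0 l).
  apply/near_normP; have [dk [_ H2]] := H k; have [dl _] := H2 l.
  by apply: near_impl2 dk dl => v; exact: conj.
have cc (k l : 'I_n) : {for u, continuous (fun p =>
    'D_(delta_mx 0 l) (fun q => 'D_(delta_mx 0 k) f q) p)}.
  by have [_ [_ H2]] := H k; have [_ [/nbhs_singleton]] := H2 l.
apply: eq_of_common_values (cc i j) (cc j i) _ => d0 d00.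
have [d1 d10 H1] := nd i j; have [d2 d20 H2] := nd j i.
pose d := Num.min d0 (Num.min d1 d2).
have d_gt0 : 0 < d by rewrite !lt_min d00 d10.
(* Two steps of length s along the axes stay within 2 s = d / 2, inside all three balls. *)
pose s := d / 4.
have s0 : 0 < s by rewrite divr_gt0.
have sd : s *+ 2 < d.
  by rewrite /s -mulr_natr -mulrA gtr_pMr // [_^-1 * _]mulrC ltr_pdivrMr // mul1r ltr_nat.
have [sd0 sd1 sd2] : [/\ s *+ 2 < d0, s *+ 2 < d1 & s *+ 2 < d2].
  by move: sd; rewrite !lt_min => /and3P[-> -> ->].
have [p pu ep] := second_difference H1 s0 sd1.
have [q qu eq] := second_difference H2 s0 sd2.
exists p, q; split; [exact: le_lt_trans pu sd0|exact: le_lt_trans qu sd0|].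
have mI (a b : R) : s * (s * a) = s * (s * b) -> a = b.
  by have s1 : s != 0 by [rewrite gt_eqF]; move=> /(mulfI s1)/(mulfI s1).
apply: mI; apply: (etrans (esym ep)); apply: etrans eq.
by rewrite subrBB_swap (addrAC u).
Qed.

End Schwarz.

(** * Inverse functions and linear differential inequalities *)

(* Keeps unification from unfolding limits when it compares derivatives. *)
#[local] Opaque diff derive derivable.

Section InverseFunction.
Context {R : realType}.

Lemma jacobianE m n (f : 'rV[R]_m -> 'rV[R]_n) u v : 'd f u v = v *m 'J f u.
Proof. by rewrite mul_rV_lin1. Qed.

Lemma smat_jacobian m n (f : 'rV[R]_m -> 'rV[R]_n) u :
  smat f u -> smat (fun x => 'J f x) u.
Proof.
move=> sf; apply/smat_mxP => i j.
apply: (@smat_ext _ _ _ (fun v => ('d f v (delta_mx 0 i)) 0 j)).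
  by apply: near_impl (filterT : nbhs u setT) => v _; rewrite mxE.
by apply/smat_coord/smat_diff => //; exact: smat_cst.
Qed.

Lemma smat_gradient n (f : 'rV[R]_n -> R) u : smat f u ->
  exists2 D : 'rV[R]_n -> 'rV[R]_n, smat D u &
    \forall v \near u, differentiable f v /\ forall w, 'd f v w = dot (D v) w.
Proof.
move=> sf; exists (fun v => \row_i 'D_(delta_mx 0 i) f v).
  apply/smat_mxP => i j; apply: smat_ext (smat_partial j sf).
  by apply: near_impl (filterT : nbhs u setT) => v _; rewrite mxE.
by apply: near_impl (smat_near sf) => v /smat_diffR[? dE]; split => // w; rewrite dE.
Qed.

Lemma strict_differentiability_coord n (f : 'rV[R]_n -> R) u : smat f u ->
  forall e : R, 0 < e -> exists2 d : R, 0 < d & forall x y,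
    `|x - u| < d -> `|y - u| < d ->
    `|f x - f y - 'd f u (x - y)| <= e * `|x - y|.
Proof.
move=> sf e e0.
have [D sD nf] := smat_gradient sf.
have e'0 : 0 < e / n.+1%:R by rewrite divr_gt0.
have nD : \forall v \near u, `|D v - D u| < e / n.+1%:R.
  move/cvgrPdist_lt: (smat_continuous sD) => /(_ _ e'0).
  by apply: near_impl => v; rewrite distrC.
have [_ dEu] := nbhs_singleton nf.
have [d d0 Hd] := (near_normP _ _).1 (near_and nD nf).
(* [line_mvt] bounds c by 1 only in absolute value. The intermediate point is thus within the
   distance of y to u plus that of x to y, which is less than three times the radius. *)
exists (d / 3) => [|x y xd yd]; first by rewrite divr_gt0.
have inb (c : R) : `|c| <= `|1 : R| -> `|y + c *: (x - y) - u| < d.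
  rewrite normr1 => c1; have -> : y + c *: (x - y) - u =
    (y - u) + c *: ((x - u) - (y - u)).
    by rewrite addrAC opprB addrA subrK.
  apply: le_lt_trans (ler_normD _ _) _; rewrite normrZ.
  have := ler_wpM2r (normr_ge0 (x - u - (y - u))) c1.
  have := ler_normB (x - u) (y - u); move: xd yd; rewrite mul1r; lra.
have dl (c : R) : `|c| <= `|1 : R| -> derivable f (y + c *: (x - y)) (x - y).
  by move=> /inb/Hd[_ [df _]]; exact: diff_derivable.
have [c c1] := line_mvt dl.
rewrite scale1r mul1r [y + _]addrC subrK => ->.
have [/ltW Dc [dfc dE]] := Hd _ (inb _ c1).
move: (y + c *: (x - y)) Dc dfc dE => p Dp dfp dE.
have e1 := etrans (deriveE (x - y) dfp) (dE (x - y)).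
rewrite e1.
rewrite dEu.
have -> : dot (D p) (x - y) - dot (D u) (x - y) =
    dot (D p - D u) (x - y).
  by rewrite !(dotC _ (x - y)) linearB.
apply: le_trans (dot_le _ _) _; rewrite mulrA ler_wpM2r //.
apply: le_trans (ler_wpM2l (ler0n _ _) Dp) _.
by rewrite mulrCA ler_piMr ?ltW // ltr_pdivrMr ?ltr0n // mul1r ltr_nat.
Qed.

(** With both endpoints free, the estimate says that x |-> x - f x is a contraction near u when the
    differential of f at u is the identity; the inverse function theorem starts from this. *)
Lemma strict_differentiability m n (f : 'rV[R]_m -> 'rV[R]_n) u : smat f u ->
  forall e : R, 0 < e -> exists2 d : R, 0 < d & forall x y,
    `|x - u| < d -> `|y - u| < d ->
    `|f x - f y - 'd f u (x - y)| <= e * `|x - y|.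
Proof.
move=> sf e e0.
have H (i : 'I_n) : exists d : R, 0 < d /\ forall x y,
    `|x - u| < d -> `|y - u| < d ->
    `|f x 0 i - f y 0 i - 'd f u (x - y) 0 i| <= e * `|x - y|.
  have [d d0 Hd] := strict_differentiability_coord (smat_coord i sf) e0.
  exists d; split=> // x y xd yd.
  by rewrite diff_coord; [exact: Hd|exact: smat_differentiable].
have [d Hd] := choice H.
exists (\big[Num.min/1]_i d i).
  by apply/bigmin_gtP; split=> // i _; exact: (Hd i).1.
move=> x y /bigmin_gtP[_ xd] /bigmin_gtP[_ yd].
apply: rV_norm_le => [|i]; first by rewrite mulr_ge0 // ltW.
by rewrite !mxE; apply: (Hd i).2; [exact: xd|exact: yd].
Qed.

End InverseFunction.

(* The library declares both parents of this structure but not their join. *)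
HB.instance Definition _ (R : realType) (n : nat) :=
  Uniform_isComplete.Build 'rV[R]_n (@cauchy_cvg _).

Section LocalInverse.
Context {R : realType} {n : nat}.
Local Notation E := 'rV[R]_n.

(* The fixed points of [x |-> x - h x + y] are the solutions of [h x = y]. *)
Lemma local_inverse_contraction (h : E -> E) (u : E) (d : R) : 0 < d ->
  (forall x y, `|x - u| <= d -> `|y - u| <= d ->
     `|h x - h y - (x - y)| <= 2^-1 * `|x - y|) ->
  forall y, `|y - h u| <= d / 2 -> exists2 x, `|x - u| <= d & h x = y.
Proof.
move=> d0 H y yd.
pose U := closed_ball u d.
have UE x : U x <-> `|x - u| <= d.
  by rewrite /U closed_ballE // /closed_ball_ /= distrC.
pose phi x := x - h x + y.
have phiU : {homo phi : x / U x >-> U x}.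
  move=> x /UE xd; apply/UE.
  have uu : `|u - u| <= d by rewrite subrr normr0 ltW.
  have -> : phi x - u = - (h x - h u - (x - u)) + (y - h u).
    by apply/rowP => i; rewrite !mxE; ring.
  apply: le_trans (ler_normD _ _) _; rewrite normrN.
  by have := H x u xd uu; move: xd yd; lra.
have [|||x Ux xE] := @banach_fixed_point R E U (mkfun phiU).
- exists (2^-1)%:nng; split => /=; first by rewrite invf_lt1 // ltr1n.
  move=> [x x'] /= [/UE xd /UE xd'] .
  have -> : phi x - phi x' = - (h x - h x' - (x - x')).
    by apply/rowP => i; rewrite !mxE; ring.
  by rewrite normrN; exact: H.
- exact: closed_ball_closed.
- by exists u; apply/UE; rewrite subrr normr0 ltW.
exists x; first exact/UE.
move: xE; rewrite /mkfun /phi => /eqP.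
rewrite -subr_eq0 opprD opprB addrA [x + _]addrC subrK subr_eq0 => /eqP.
by [].
Qed.

End LocalInverse.

Section InverseFunctionTheorem.
Context {R : realType}.

Lemma ckat_comp_mx m n p q k (f : 'rV[R]_m -> 'rV[R]_n) (g : 'rV[R]_n -> 'M[R]_(p, q)) u :
  ckat k f u -> ckat k g (f u) -> ckat k (g \o f) u.
Proof.
move=> cf /ckat_mxP cg; apply/ckat_mxP => i j.
exact: (ckat_comp cf (cg i j)).
Qed.

Lemma smat_ckat n (V : normedModType R) (f : 'rV[R]_n -> V) u k :
  smat f u -> ckat k f u.
Proof. by move=> /nbhs_singleton. Qed.

Lemma diff_mulmxr m n p (f : 'rV[R]_m -> 'rV[R]_n) (B : 'M[R]_(n, p)) u v :
  differentiable f u -> 'd (fun x => f x *m B) u v = 'd f u v *m B.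
Proof.
move=> df; have dB := linear_rV_differentiable (mulmxr B) (f u).
by rewrite (diff_compE v df dB) linear_rV_diff.
Qed.

Lemma smat_mulmxr m n p (f : 'rV[R]_m -> 'rV[R]_n) (B : 'M[R]_(n, p)) u :
  smat f u -> smat (fun x => f x *m B) u.
Proof. by move=> sf; apply: smat_mulmx => //; exact: smat_cst. Qed.

(** The estimate for h between [g y] and [g y0] becomes a first-order expansion of g after applying
    the inverse Jacobian, because the bound on [g y - g y0] makes its error small compared with
    [y - y0]. *)
Lemma differentiable_inverse n (h g : 'rV[R]_n -> 'rV[R]_n) (y0 : 'rV[R]_n) (c : R) :
  0 <= c -> smat h (g y0) -> 'J h (g y0) \in unitmx ->
  (\forall y \near y0, h (g y) = y /\ `|g y - g y0| <= c * `|y - y0|) ->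
  differentiable g y0 /\ forall v, 'd g y0 v = v *m invmx ('J h (g y0)).
Proof.
move=> c0 sh uJ ng.
set J := 'J h (g y0) in uJ *.
suff [dg dE] : differentiable g y0 /\ 'd g y0 = mulmxr (invmx J) :> (_ -> _).
  by split=> // v; rewrite dE.
have [hg0 _] := nbhs_singleton ng.
apply: linear_approx_differentiable => e e0.
have [K K0 HK] := linear_rV_bound (mulmxr (invmx J) : {linear 'rV[R]_n -> 'rV[R]_n}).
(* K bounds the inverse Jacobian and c is the Lipschitz constant of g, so an error b for h costs at
   most K b c <= e for g; the added units keep the denominator positive. *)
pose b := e / ((K + 1) * (c + 1)).
have K1 : 0 < K + 1 by rewrite ltr_wpDl.
have c1 : 0 < c + 1 by rewrite ltr_wpDl.
have b0 : 0 < b by rewrite divr_gt0 // mulr_gt0.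
have [d d0 Hd] := strict_differentiability sh b0.
have [d1 d10 Hd1] := (near_normP _ _).1 ng.
apply/near_normP; exists (Num.min d1 (d / (c + 1))).
  by rewrite lt_min d10 divr_gt0.
move=> v; rewrite subr0 lt_min => /andP[v1 v2].
have [hg gle] : h (g (v + y0)) = v + y0 /\ `|g (v + y0) - g y0| <= c * `|v|.
  by have := Hd1 (v + y0); rewrite addrK; exact.
set x := g (v + y0) in hg gle *.
have xd : `|x - g y0| < d.
  apply: le_lt_trans gle _; move: v2; rewrite ltr_pdivlMr // mulrC.
  by apply: le_lt_trans; rewrite ler_wpM2r // lerDl.
have := Hd x (g y0) xd; rewrite subrr normr0 => /(_ d0).
rewrite hg hg0 addrK jacobianE -/J => approx.
have -> : x - g y0 - mulmxr (invmx J) v =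
    - mulmxr (invmx J) (v - (x - g y0) *m J).
  by rewrite linearB /= mulmxK // opprB.
rewrite normrN; apply: le_trans (HK _) _.
apply: le_trans (ler_wpM2l K0 approx) _.
apply: (@le_trans _ _ ((K + 1) * (b * ((c + 1) * `|v|)))).
  apply: ler_pM => //; [exact: mulr_ge0 (ltW b0) _|by rewrite lerDl|].
  apply: (ler_wpM2l (ltW b0)); apply: (le_trans gle).
  by rewrite ler_wpM2r // lerDl.
suff -> : (K + 1) * (b * ((c + 1) * `|v|)) = e * `|v| by [].
by rewrite /b; field; rewrite !gt_eqF.
Qed.

(** Bootstrap: the differential of g at y is the inverse of the Jacobian of h at [g y]. If g is of
    class k, so is this expression, hence g is of class k + 1. *)
Lemma ckat_inverse n (h g : 'rV[R]_n -> 'rV[R]_n) (A : set 'rV[R]_n) : open A ->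
  (forall y, A y -> smat h (g y) /\ 'J h (g y) \in unitmx) ->
  (forall y, A y -> differentiable g y /\
    forall v, 'd g y v = v *m invmx ('J h (g y))) ->
  forall y, A y -> smat g y.
Proof.
move=> oA sh dg.
have nA y : A y -> \forall z \near y, A z by move=> Ay; exact: open_nbhs_nbhs.
suff H k : forall y, A y -> ckat k g y.
  by move=> y /nA; apply: near_impl => z Az k; exact: H.
have cg y : A y -> \forall z \near y, {for z, continuous g}.
  move=> /nA; apply: near_impl => z /dg[dgz _].
  exact: differentiable_continuous.
elim: k => [|k IH] y Ay; first by split=> //; exact: cg.
split; first exact: cg.
move=> i; split.
  by apply: near_impl (nA _ Ay) => z /dg[dgz _]; exact: diff_derivable.
apply: (@ckat_ext _ _ _ _ ((fun x => delta_mx 0 i *m invmx ('J h x)) \o g)).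
  apply: near_impl (nA _ Ay) => z /dg[dgz dE].
  by rewrite (deriveE _ dgz) dE.
have [shy uJ] := sh _ Ay.
apply: ckat_comp_mx; first exact: IH.
apply: smat_ckat; apply: smat_mulmx; first exact: smat_cst.
by apply: smat_invmx => //; exact: smat_jacobian.
Qed.

(** The estimate with constant 1/2 does double duty: it makes [h x = y] solvable in a closed ball,
    and it bounds the distance of two points of the ball by twice the distance of their images. The
    latter makes the solution unique and g Lipschitz with constant 2. *)
Lemma inverse_function_id n (h : 'rV[R]_n -> 'rV[R]_n) (u : 'rV[R]_n) :
  smat h u -> (forall v, 'd h u v = v) ->
  exists g, [/\ smat g (h u), g (h u) = u,
    \forall y \near h u, h (g y) = y & \forall x \near u, g (h x) = x].
Proof.
move=> sh hid.
have uJ : 'J h u \in unitmx.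
  suff -> : 'J h u = 1%:M by exact: unitmx1.
  by apply/row_matrixP => i; rewrite !rowE -jacobianE hid mulmx1.
have half0 : 0 < 2^-1 :> R by rewrite invr_gt0.
have [d1 d10 Hd1] := strict_differentiability sh half0.
have [d2 d20 Hd2] := (near_normP _ _).1
  (near_and (smat_near sh) (smat_unitmx (smat_jacobian sh) uJ)).
(* Halved so that the closed ball of radius d lies in both open balls. *)
pose d := Num.min d1 d2 / 2.
have m0 : 0 < Num.min d1 d2 by rewrite lt_min d10.
have d0 : 0 < d by rewrite divr_gt0.
have [dd1 dd2] : d < d1 /\ d < d2.
  have : d < Num.min d1 d2 by rewrite /d ltr_pdivrMr // mulr_natr mulr2n ltrDl.
  by rewrite lt_min => /andP[].
have Hd x y : `|x - u| <= d -> `|y - u| <= d ->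
    `|h x - h y - (x - y)| <= 2^-1 * `|x - y|.
  move=> xd yd; rewrite -[X in h x - h y - X]hid.
  by apply: Hd1; [exact: le_lt_trans xd dd1|exact: le_lt_trans yd dd1].
have hinj x y : `|x - u| <= d -> `|y - u| <= d -> `|x - y| <= 2 * `|h x - h y|.
  move=> xd yd; have := Hd _ _ xd yd.
  have := ler_normB (h x - h y) (h x - h y - (x - y)).
  rewrite opprB addrC subrK; lra.
have solve := local_inverse_contraction d0 Hd.
pose g y := xget u [set x | `|x - u| <= d /\ h x = y].
have gP y : `|y - h u| <= d / 2 -> `|g y - u| <= d /\ h (g y) = y.
  move=> /solve[x xd hx]; apply: (@xgetPex _ u [set x | `|x - u| <= d /\ h x = y]).
  by exists x.
have uu : `|u - u| <= d by rewrite subrr normr0 ltW.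
pose A := [set y | `|y - h u| < d / 2].
have d20' : 0 < d / 2 by rewrite divr_gt0.
have oA : open A.
  have -> : A = ball (h u) (d / 2).
    by apply/seteqP; split => y; rewrite -ball_normE /A /= distrC.
  exact: ball_open.
have nA : \forall y \near h u, A y by apply/near_normP; exists (d / 2).
have gA y : A y -> `|g y - u| <= d /\ h (g y) = y by move=> /ltW/gP.
have gh x : `|x - u| <= d -> A (h x) -> g (h x) = x.
  move=> xd /gA[gd hg]; apply/eqP; rewrite -subr_eq0 -normr_le0.
  by have := hinj _ _ gd xd; rewrite hg subrr normr0 mulr0.
have Ahu : A (h u) by rewrite /A /= subrr normr0.
exists g; split.
- refine (@ckat_inverse n h g A oA _ _ _ Ahu).
    by move=> y /gA[gd _]; exact: Hd2 (le_lt_trans gd dd2).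
  move=> y0 Ay0; have [gd _] := gA _ Ay0.
  have [shy uJy] := Hd2 _ (le_lt_trans gd dd2).
  refine (@differentiable_inverse _ _ _ _ 2 _ shy uJy _); first by [].
  have := open_nbhs_nbhs (conj oA Ay0); apply: near_impl => y Ay.
  have [gyd hgy] := gA _ Ay; split => //.
  by have := hinj _ _ gyd gd; rewrite hgy (gA _ Ay0).2.
- exact: gh.
- by apply: near_impl nA => y /gA[].
- have nd : \forall x \near u, `|x - u| < d by apply/near_normP; exists d.
  have nhA := near_comp (smat_continuous sh) nA.
  by apply: near_impl2 nd nhA => x /ltW; exact: gh.
Qed.

Lemma inverse_function n (f : 'rV[R]_n -> 'rV[R]_n) (u : 'rV[R]_n) :
  smat f u -> 'J f u \in unitmx ->
  exists g, [/\ smat g (f u), g (f u) = u,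
    \forall y \near f u, f (g y) = y & \forall x \near u, g (f x) = x].
Proof.
move=> sf uJ; set J := 'J f u in uJ.
pose h x := f x *m invmx J.
have sh : smat h u by exact: smat_mulmxr.
have hid v : 'd h u v = v.
  by rewrite diff_mulmxr ?jacobianE ?mulmxK //; exact: smat_differentiable.
have [g [sg gu hg gh]] := inverse_function_id sh hid.
pose L : {linear 'rV[R]_n -> 'rV[R]_n} := mulmxr (invmx J).
exists (g \o L); split => //.
- exact: (@smat_comp _ _ _ _ _ L g (f u) (smat_linear L (f u)) sg).
- have cL : {for f u, continuous L} by exact: linear_rV_continuous.
  apply: near_impl (near_comp cL hg) => y /(congr1 (mulmx^~ J)).
  by rewrite /h /= !mulmxKV.
Qed.

End InverseFunctionTheorem.

Lemma diff_sub_cst (R : realType) (V W : normedModType R) (F : V -> W) (c : W)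
    (p v : V) :
  differentiable F p -> 'd (fun x => F x - c) p v = 'd F p v.
Proof.
move=> dF; have e := diffB dF (differentiable_cst c p).
have e0 : 'd (cst c : V -> W) p v = 0.
  exact: (congr1 (fun g => g v) (diff_cst c p)).
apply: (etrans (congr1 (fun g => g v) e)).
exact: etrans (congr1 (fun x => 'd F p v - x) e0) (subr0 _).
Qed.

(** * Growth estimates along segments *)

Section GronwallOnLines.
Context {R : realType}.

Lemma is_derive_coord_line m n (F : 'rV[R]_m -> 'rV[R]_n) (s v : 'rV[R]_m) (t : R) i :
  differentiable F (s + t *: v) ->
  is_derive t 1 (fun r => F (s + r *: v) 0 i) (('d F (s + t *: v) v) 0 i).
Proof.
move=> dF; have dR : derivable F (s + t *: v) v by exact: diff_derivable.
have /derivable_mxP/(_ 0 i) dRi := dR.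
have e : ('d F (s + t *: v) v) 0 i = 'D_v (fun x => F x 0 i) (s + t *: v).
  by have := congr1 (fun A : 'rV[R]_n => A 0 i)
    (etrans (esym (deriveE v dF)) (derive_mx dR)); rewrite mxE.
by rewrite e; exact: is_derive_line dRi.
Qed.

(* The derivative of [expR (- c t) * |F (s + t v)|^2] is nonpositive. *)
Lemma gronwall_line m n (F : 'rV[R]_m -> 'rV[R]_n) (s v : 'rV[R]_m) (K : R) :
  0 <= K ->
  (forall t : R, 0 <= t <= 1 -> differentiable F (s + t *: v) /\
     `|'d F (s + t *: v) v| <= K * `|F (s + t *: v)|) ->
  F s = 0 -> F (s + v) = 0.
Proof.
move=> K0 HF Fs.
(* The derivative of q is the sum of n terms 2 F_i F'_i. Each product is at most K times the squared
   maximum norm of F, which is itself at most q since it is the square of one entry. *)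
pose c := 2 * (n%:R * K).
pose q (t : R) : R := \sum_i F (s + t *: v) 0 i * F (s + t *: v) 0 i.
pose q' (t : R) : R := \sum_i (F (s + t *: v) 0 i * ('d F (s + t *: v) v) 0 i +
   F (s + t *: v) 0 i * ('d F (s + t *: v) v) 0 i).
pose E (t : R) := expR (- c * t).
have dE (t : R) : is_derive t (1 : R) E (- c * expR (- c * t)).
  have dl : is_derive t (1 : R) (fun r : R => - c * r) (- c).
    have := @is_deriveZ _ _ _ id (- c) t 1 1 (is_derive_id t 1).
    by rewrite [- c *: 1]mulr1; exact.
  have := is_derive1_comp (is_derive_expR (- c * t)) dl.
  by rewrite mulrC; exact.
have dq (t : R) : 0 <= t <= 1 -> is_derive t (1 : R) q (q' t).
  move=> t01; have [dF _] := HF t t01.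
  have dFi i := is_derive_coord_line i dF.
  have dFF i : is_derive t (1 : R) (fun r => F (s + r *: v) 0 i * F (s + r *: v) 0 i)
     (F (s + t *: v) 0 i * ('d F (s + t *: v) v) 0 i +
   F (s + t *: v) 0 i * ('d F (s + t *: v) v) 0 i).
    have := rderivM (@ex_derive _ _ _ _ _ _ _ (dFi i)) (@ex_derive _ _ _ _ _ _ _ (dFi i)).
    by rewrite (@derive_val _ _ _ _ _ _ _ (dFi i)).
  have := is_derive_sum dFF.
  by have -> : \sum_i (fun r => F (s + r *: v) 0 i * F (s + r *: v) 0 i) = q
    by [apply/funext => r; rewrite fct_sumE].
have q'le (t : R) : 0 <= t <= 1 -> q' t <= c * q t.
  move=> t01; have [_ HK] := HF t t01.
  have normq : `|F (s + t *: v)| * `|F (s + t *: v)| <= q t.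
    have [->|F0] := eqVneq (F (s + t *: v)) 0.
      by rewrite normr0 mul0r; apply: sumr_ge0 => j _; rewrite -expr2 sqr_ge0.
    have := @mx_norm_neq0 _ _ _ (F (s + t *: v)).
    rewrite -[mx_norm _]/(`|F (s + t *: v)|) normr_eq0 => /(_ F0)[[k j] /= ->].
    rewrite (ord1 k) -normrM ger0_norm; last by rewrite -expr2 sqr_ge0.
    rewrite /q (bigD1 j) //= lerDl; apply: sumr_ge0 => l _.
    by rewrite -expr2 sqr_ge0.
  apply: (@le_trans _ _ (\sum_(i < n) 2 * (K * q t))); last first.
    rewrite sumr_const card_ord.
    suff -> : c * q t = (2 * (K * q t)) *+ n by [].
    by rewrite /c -[RHS]mulr_natr; ring.
  have two (x : R) : x + x = 2 * x by ring.
  apply: ler_sum => i _; rewrite two ler_wpM2l //.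
  apply: le_trans (ler_norm _) _; rewrite normrM.
  apply: (@le_trans _ _ (`|F (s + t *: v)| * (K * `|F (s + t *: v)|))).
    apply: ler_pM => //; first exact: coord_norm.
    exact: le_trans (coord_norm _ _) HK.
  by rewrite mulrCA ler_wpM2l.
pose w t := E t * q t.
have dw (t : R) : 0 <= t <= 1 ->
    is_derive t (1 : R) w (E t * q' t + q t * (- c * expR (- c * t))).
  move=> t01.
  have := rderivM (@ex_derive _ _ _ _ _ _ _ (dE t)) (@ex_derive _ _ _ _ _ _ _ (dq t t01)).
  by rewrite (@derive_val _ _ _ _ _ _ _ (dE t)) (@derive_val _ _ _ _ _ _ _ (dq t t01)).
have oc (t : R) : t \in `]0, 1[ -> 0 <= t <= 1.
  by rewrite in_itv /= => /andP[/ltW -> /ltW ->].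
have w1 : w 1 <= w 0.
  refine (@ler0_derive1_nincr R w 0 1 _ _ _ 0 1 (lexx _) ler01 (lexx _)).
  - by move=> t /oc t01; case: (dw t t01).
  - move=> t /oc t01.
    rewrite derive1E (@derive_val _ _ _ _ _ _ _ (dw t t01)) -/(E t).
    have -> : E t * q' t + q t * (- c * E t) = E t * (q' t - c * q t) by ring.
    rewrite mulr_ge0_le0 ?expR_ge0 // subr_le0; exact: q'le.
  - apply: derivable_within_continuous => t; rewrite in_itv /= => t01.
    by have [] := dw t t01.
have q0 : q 0 = 0.
  by rewrite /q scale0r addr0 Fs big1 // => i _; rewrite mxE mul0r.
have q1 : q 1 <= 0.
  move: w1; rewrite /w q0 mulr0 pmulr_rle0 //; exact: expR_gt0.
apply/rowP => i; rewrite [RHS]mxE; apply/eqP.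
rewrite -[s + v]/(s + v) -[v in s + v]scale1r -sqrf_eq0 eq_le sqr_ge0 andbT.
apply: le_trans q1; rewrite /q (bigD1 i) //= -expr2 lerDl.
by apply: sumr_ge0 => j _; rewrite -expr2 sqr_ge0.
Qed.

(** The case K = 0 of [gronwall_line], for the map x |-> F x - F s. *)
Lemma constant_line m n (F : 'rV[R]_m -> 'rV[R]_n) (s v : 'rV[R]_m) :
  (forall t : R, 0 <= t <= 1 -> differentiable F (s + t *: v) /\
     'd F (s + t *: v) v = 0) ->
  F (s + v) = F s.
Proof.
move=> HF; apply/eqP; rewrite -subr_eq0; apply/eqP.
refine (@gronwall_line _ _ (fun x => F x - F s) s v 0 (lexx _) _ (subrr _)).
move=> t /HF[dF dF0]; split; first exact: differentiableB.
by rewrite mul0r normr_le0 diff_sub_cst // dF0.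
Qed.

End GronwallOnLines.

(** * Exterior derivatives of 1-forms in coordinates *)

Section Forms.
Context {R : realType}.

(** The row [a z] lists the coefficients of a 1-form at z. The vectors v and w are extended as
    constant fields, so the bracket term of the invariant formula for the exterior derivative
    vanishes. *)
Definition dform n (a : 'rV[R]_n -> 'rV[R]_n) (z v w : 'rV[R]_n) : R :=
  dot ('d a z v) w - dot ('d a z w) v.

Definition pull m n (phi : 'rV[R]_m -> 'rV[R]_n) (a : 'rV[R]_n -> 'rV[R]_n)
    (z : 'rV[R]_m) : 'rV[R]_m :=
  \row_i dot (a (phi z)) ('d phi z (delta_mx 0 i)).

Lemma dform_anti n (a : 'rV[R]_n -> 'rV[R]_n) z v w :
  dform a z v w = - dform a z w v.
Proof. by rewrite /dform opprB. Qed.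

Lemma dotDr n (a v w : 'rV[R]_n) : dot a (v + w) = dot a v + dot a w.
Proof. exact: linearD. Qed.

Lemma dotZr n k (a v : 'rV[R]_n) : dot a (k *: v) = k * dot a v.
Proof. exact: linearZ. Qed.

Lemma dotDl n (a b v : 'rV[R]_n) : dot (a + b) v = dot a v + dot b v.
Proof. by rewrite !(dotC _ v) dotDr. Qed.

Lemma dotZl n k (a v : 'rV[R]_n) : dot (k *: a) v = k * dot a v.
Proof. by rewrite !(dotC _ v) dotZr. Qed.

Lemma dot0l n (v : 'rV[R]_n) : dot 0 v = 0.
Proof. by rewrite dotC linear0. Qed.

Lemma dform_linear n (a : 'rV[R]_n -> 'rV[R]_n) z v : linear (dform a z v).
Proof.
move=> k w w'; rewrite /dform dotDr dotZr (linearP ('d a z)) dotDl dotZl.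
by rewrite -[_ *: _]/(k * _); ring.
Qed.

Lemma dot_pull m n (phi : 'rV[R]_m -> 'rV[R]_n) a z v :
  dot (pull phi a z) v = dot (a (phi z)) ('d phi z v).
Proof.
rewrite {2}[v]row_sum_delta !linear_sum; apply: eq_bigr => i _.
by rewrite !linearZ mxE mulrC.
Qed.

Lemma smat_pull m n (phi : 'rV[R]_m -> 'rV[R]_n) a z :
  smat phi z -> smat a (phi z) -> smat (pull phi a) z.
Proof.
move=> sp sa; apply/smat_mxP => i j.
apply: (@smat_ext _ _ _ (fun x => dot (a (phi x)) ('d phi x (delta_mx 0 j)))).
  by apply: near_impl (filterT : nbhs z setT) => x _; rewrite mxE.
apply: smat_dot; first exact: smat_comp sp sa.
by apply: smat_diff => //; exact: smat_cst.
Qed.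

Lemma diffM_value n (f g : 'rV[R]_n -> R) z v :
  differentiable f z -> differentiable g z ->
  'd (fun x => f x * g x) z v = f z * 'd g z v + g z * 'd f z v.
Proof.
move=> df dg.
have e := rderivM (@diff_derivable _ _ _ f z v df) (@diff_derivable _ _ _ g z v dg).
have dfg : differentiable (fun x => f x * g x) z by exact: differentiableM.
apply: etrans (esym (deriveE v dfg)) _; apply: etrans (@derive_val _ _ _ _ _ _ _ e) _.
have e1 := deriveE v df; have e2 := deriveE v dg.
exact: (congr2 (fun x y => f z * x + g z * y) e2 e1).
Qed.

Lemma diff_sum_value n (V : normedModType R) m (f : 'I_m -> 'rV[R]_n -> V) z v :
  (forall i, differentiable (f i) z) ->
  'd (fun x => \sum_i f i x) z v = \sum_i 'd (f i) z v.
Proof.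
move=> df.
have dE (i : 'I_m) : is_derive z v (f i) ('d (f i) z v).
  by apply: DeriveDef; [exact: diff_derivable|exact: deriveE].
have E : (fun x => \sum_i f i x) = \sum_i f i by apply/funext => x; rewrite fct_sumE.
have dS : differentiable (\sum_i f i) z by exact: differentiable_sum.
rewrite E; apply: etrans (esym (deriveE v dS)) _.
exact: (@derive_val _ _ _ _ _ _ _ (is_derive_sum dE)).
Qed.

Lemma differentiable_coord_fun n m (f : 'rV[R]_n -> 'rV[R]_m) z i :
  differentiable f z -> differentiable (fun x => f x 0 i) z.
Proof.
by move=> df; exact: (differentiable_comp df (@differentiable_coord R _ _ _ _ _)).
Qed.

Lemma diff_dot n m (f g : 'rV[R]_n -> 'rV[R]_m) z v :
  differentiable f z -> differentiable g z ->
  'd (fun x => dot (f x) (g x)) z v = dot ('d f z v) (g z) + dot (f z) ('d g z v).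
Proof.
move=> df dg.
have dfi i := differentiable_coord_fun i df.
have dgi i := differentiable_coord_fun i dg.
have dfg i : differentiable (fun x => f x 0 i * g x 0 i) z by exact: differentiableM.
rewrite /dot diff_sum_value // -big_split; apply: eq_bigr => i _.
have rearrange (a b x y x' y' : R) : x' = x -> y' = y ->
    a * y + b * x = x' * b + a * y' by move=> -> ->; ring.
apply: (etrans (diffM_value v (dfi i) (dgi i))).
exact: rearrange (diff_coord v 0 i df) (diff_coord v 0 i dg).
Qed.

Lemma diff_dot_cst n m (f : 'rV[R]_n -> 'rV[R]_m) c z v :
  differentiable f z -> 'd (fun x => dot (f x) c) z v = dot ('d f z v) c.
Proof.
move=> df; apply: (etrans (diff_dot v df (differentiable_cst c z))).
have L a t : t = 0 -> a + dot (f z) t = a by move=> ->; rewrite linear0 addr0.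
exact: L (congr1 (fun g => g v) (diff_cst c z)).
Qed.

Lemma diff_near n (V : normedModType R) (f g : 'rV[R]_n -> V) z v :
  (\forall x \near z, f x = g x) -> differentiable f z -> differentiable g z ->
  'd f z v = 'd g z v.
Proof.
move=> fg df dg; apply: etrans (esym (deriveE v df)) _.
apply: etrans (deriveE v dg); exact: near_eq_derive.
Qed.

Lemma smat_differentiableR n (f : 'rV[R]_n -> R) z : smat f z -> differentiable f z.
Proof. by case/smat_diffR. Qed.

Lemma second_diff_symR n (f : 'rV[R]_n -> R) z v w : smat f z ->
  'd (fun x => 'd f x w) z v = 'd (fun x => 'd f x v) z w.
Proof.
move=> sf; pose D x : 'rV[R]_n := \row_i 'D_(delta_mx 0 i) f x.
have DE : \forall x \near z, forall w, 'd f x w = dot (D x) w.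
  by apply: near_impl (smat_near sf) => x /smat_diffR[_ E] w'; rewrite E.
have sDi i := smat_partial i sf.
have sD : smat D z.
  apply/smat_mxP => i j; apply: smat_ext (sDi j).
  by apply: near_impl (filterT : nbhs z setT) => x _; rewrite mxE.
have key a b : 'd (fun x => 'd f x a) z b =
    \sum_i \sum_j a 0 i * b 0 j *
       'D_(delta_mx 0 j) (fun x => 'D_(delta_mx 0 i) f x) z.
  have sda : smat (fun x => dot (D x) a) z by apply: smat_dot => //; exact: smat_cst.
  have sdf : smat (fun x => 'd f x a) z.
    by apply: smat_ext sda; apply: near_impl DE => x ->.
  have e1 : 'd (fun x => 'd f x a) z b = 'd (fun x => dot (D x) a) z b.
    apply: diff_near; [by apply: near_impl DE => x ->|exact: smat_differentiableR..].
  apply: (etrans e1); apply: (etrans (diff_dot_cst a b (smat_differentiable sD))).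
  apply: eq_bigr => i _.
  have e3 : ('d D z b) 0 i =
      dot (\row_j 'D_(delta_mx 0 j) (fun x => 'D_(delta_mx 0 i) f x) z) b.
    apply: (etrans (diff_coord b 0 i (smat_differentiable sD))).
    have -> : (fun x => D x 0 i) = (fun x => 'D_(delta_mx 0 i) f x).
      by apply/funext => x; rewrite mxE.
    by have [_ E] := smat_diffR (sDi i); exact: (congr1 (fun g => g b) E).
  apply: (etrans (congr1 (fun t => t * a 0 i) e3)).
  rewrite /dot mulr_suml; apply: eq_bigr => j _; rewrite mxE.
  by rewrite mulrC -mulrA [b 0 j * _]mulrC.
apply: (etrans (key w v)); apply: (etrans _ (esym (key v w))).
rewrite exchange_big /=; apply: eq_bigr => i _; apply: eq_bigr => j _.
have rearrange (a b x y : R) : x = y -> b * a * y = a * b * x.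
  by move=> ->; rewrite [b * a]mulrC.
exact: rearrange (schwarz i j (smat_ckat 2 sf)).
Qed.

Lemma second_diff_sym m n (f : 'rV[R]_m -> 'rV[R]_n) z v w : smat f z ->
  'd (fun x => 'd f x w) z v = 'd (fun x => 'd f x v) z w.
Proof.
move=> sf; apply/rowP => i.
have key a b : ('d (fun x => 'd f x a) z b) 0 i = 'd (fun x => 'd (fun y => f y 0 i) x a) z b.
  have sa : smat (fun x => 'd f x a) z by apply: smat_diff => //; exact: smat_cst.
  have E : \forall x \near z, ('d f x a) 0 i = 'd (fun y => f y 0 i) x a.
    apply: near_impl (smat_near sf) => x sfx.
    by apply: diff_coord; exact: smat_differentiable.
  apply: etrans (diff_coord b 0 i (smat_differentiable sa)) _.
  have sai := smat_coord i sa.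
  apply: (diff_near b E); first exact: smat_differentiableR.
  exact: smat_differentiableR (smat_ext E sai).
apply: (etrans (key w v)); apply: (etrans _ (esym (key v w))).
by apply: second_diff_symR; exact: smat_coord.
Qed.

(** The terms that contain second derivatives of phi are symmetric in v and w, and cancel in the
    difference. *)
Lemma dform_pull m n (phi : 'rV[R]_m -> 'rV[R]_n) a z v w :
  smat phi z -> smat a (phi z) ->
  dform (pull phi a) z v w = dform a (phi z) ('d phi z v) ('d phi z w).
Proof.
move=> sp sa.
have key b c : dot ('d (pull phi a) z b) c =
    dot ('d a (phi z) ('d phi z b)) ('d phi z c) +
    dot (a (phi z)) ('d (fun x => 'd phi x c) z b).
  have sl := smat_pull sp sa.
  have sdc : smat (fun x => 'd phi x c) z by apply: smat_diff => //; exact: smat_cst.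
  have sap := smat_comp sp sa.
  apply: (etrans (esym (diff_dot_cst c b (smat_differentiable sl)))).
  have -> : (fun x => dot (pull phi a x) c) = (fun x => dot ((a \o phi) x) ('d phi x c)).
    by apply/funext => x; rewrite dot_pull.
  apply: (etrans (diff_dot b (smat_differentiable sap) (smat_differentiable sdc))).
  have e := diff_compE b (smat_differentiable sp) (smat_differentiable sa).
  exact: (congr1 (fun t => dot t _ + _) e).
apply: (etrans (congr2 (fun x y => x - y) (key v w) (key w v))).
have rearrange (A B : R) p X Y : X = Y -> A + dot p X - (B + dot p Y) = A - B.
  by move=> ->; ring.
exact: rearrange (second_diff_sym v w sp).
Qed.

End Forms.

(** * Forms with a common kernel *)

Section ProportionalForms.
Context {R : realType} {n : nat}.
Local Notation E := 'rV[R]_n.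
Implicit Types (a b : E -> E) (f : E -> R) (z v w : E).

Lemma dotBr (u v w : E) : dot u (v - w) = dot u v - dot u w.
Proof. exact: linearB. Qed.

(** The vectors x_j e_l - x_l e_j lie in the kernel of x; evaluating y on them determines every
    entry of y from y_j. *)
Lemma dot_eq0_proportional (x y : E) (j : 'I_n) : x 0 j != 0 ->
  (forall v, dot x v = 0 -> dot y v = 0) -> y = (y 0 j / x 0 j) *: x.
Proof.
move=> xj H; apply/rowP => l; rewrite mxE.
have : dot y (x 0 j *: delta_mx 0 l - x 0 l *: delta_mx 0 j) = 0.
  by apply: H; rewrite dotBr !dotZr !dot_delta mulrC subrr.
rewrite dotBr !dotZr !dot_delta => /eqP; rewrite subr_eq0 => /eqP e.
by rewrite mulrAC -[y 0 j * _]mulrC -e mulrAC divff // mul1r.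
Qed.

Lemma dform_near a b z v w : (\forall x \near z, a x = b x) ->
  smat a z -> smat b z -> dform a z v w = dform b z v w.
Proof.
move=> ab sa sb.
have e x : 'd a z x = 'd b z x by apply: diff_near => //; exact: smat_differentiable.
exact: (congr2 (fun x y => dot x w - dot y v) (e v) (e w)).
Qed.

Lemma diff_scale m (f : E -> R) (b : E -> 'rV[R]_m) z v :
  smat f z -> smat b z ->
  'd (fun x => f x *: b x) z v = 'd f z v *: b z + f z *: 'd b z v.
Proof.
move=> sf sb; have sfb := smat_scale sf sb.
apply/rowP => i; apply: (etrans (diff_coord v 0 i (smat_differentiable sfb))).
have -> : (fun x => (f x *: b x) 0 i) = (fun x => f x * b x 0 i).
  by apply/funext => x; rewrite mxE.
have sbi := smat_coord i sb.
apply: (etrans (diffM_value v (smat_differentiableR sf) (smat_differentiableR sbi))).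
rewrite !mxE addrC [_ * b z 0 i]mulrC.
have e := diff_coord v 0 i (smat_differentiable sb).
exact: (congr1 (fun t => f z * t + b z 0 i * 'd f z v) (esym e)).
Qed.

(** In d(f b) = df /\ b + f db the first term vanishes on the kernel of b. *)
Lemma dform_scale f b z v w : smat f z -> smat b z ->
  dot (b z) v = 0 -> dot (b z) w = 0 ->
  dform (fun x => f x *: b x) z v w = f z * dform b z v w.
Proof.
move=> sf sb bv bw.
have e c d : dot (b z) d = 0 ->
    dot ('d (fun x => f x *: b x) z c) d = f z * dot ('d b z c) d.
  move=> bd; apply: (etrans (congr1 (fun t => dot t d) (diff_scale c sf sb))).
  by rewrite dotDl !dotZl bd mulr0 add0r.
apply: (etrans (congr2 (fun x y => x - y) (e v w bw) (e w v bv))).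
by rewrite /dform mulrBr.
Qed.

Lemma near_proportional a b z (j : 'I_n) : smat a z -> smat b z -> b z 0 j != 0 ->
  (\forall x \near z, forall v, dot (b x) v = 0 -> dot (a x) v = 0) ->
  smat (fun x => a x 0 j / b x 0 j) z /\
  \forall x \near z, a x = (a x 0 j / b x 0 j) *: b x.
Proof.
move=> sa sb bj ab; split.
  by apply: smat_mul; [exact: smat_coord|apply: smat_inv => //; exact: smat_coord].
apply: near_impl2 ab (smat_near_neq0 (smat_coord j sb) bj) => x abx bjx.
exact: dot_eq0_proportional.
Qed.

Lemma rV_neq0 (x : E) : x != 0 -> exists j, x 0 j != 0.
Proof.
move=> x0; apply: contrapT => H; move/eqP: x0; apply; apply/rowP => j.
by rewrite mxE; apply: contrapT => /eqP xj; apply: H; exists j.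
Qed.

(** Two nonvanishing forms with the same kernel near z differ by a smooth factor that is nonzero at
    z, so [dform_scale] applies. Whether the exterior derivative vanishes on a pair of vectors of
    the hyperplane thus does not depend on the form chosen to describe it. *)
Lemma dform_same_kernel a b z v w : smat a z -> smat b z -> a z != 0 ->
  (\forall x \near z, forall v, dot (b x) v = 0 <-> dot (a x) v = 0) ->
  dot (a z) v = 0 -> dot (a z) w = 0 ->
  (dform a z v w = 0 <-> dform b z v w = 0).
Proof.
move=> sa sb a0 ab av aw.
have abz := nbhs_singleton ab.
have [j aj] := rV_neq0 a0.
have bj : b z 0 j != 0.
  by apply: contra_neq aj; rewrite -!dot_delta => /abz.
have ab1 : \forall x \near z, forall v, dot (b x) v = 0 -> dot (a x) v = 0.
  by apply: near_impl ab => x H v' /H.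
have [sf fE] := near_proportional sa sb bj ab1.
have bv := (abz v).2 av; have bw := (abz w).2 aw.
have dE := etrans (dform_near v w fE sa (smat_scale sf sb)) (dform_scale sf sb bv bw).
rewrite dE.
split=> [/eqP|->]; last by rewrite mulr0.
rewrite mulf_eq0 => /orP[|/eqP //].
by rewrite mulf_eq0 invr_eq0 (negbTE aj) (negbTE bj).
Qed.

End ProportionalForms.

(** * Maps into a manifold in charts *)

Section Charts.
Context {R : realType} {n : nat} {M : manifold R n}.
Implicit Types (p q s x y : M).

Lemma chart_mapE q x : chart_dom (chart_at q) x ->
  chart_inv (chart_at q) (chart_map (chart_at q) x) = x.
Proof. exact: chart_mapK. Qed.

Lemma near_chart_dom q x : chart_dom (chart_at q) x ->
  \forall y \near x, chart_dom (chart_at q) y.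
Proof. by move=> Dx; apply: open_nbhs_nbhs; split=> //; exact: chart_dom_open. Qed.

Lemma near_chart_inv q x : chart_dom (chart_at q) x ->
  \forall u \near chart_map (chart_at q) x,
    chart_dom (chart_at q) (chart_inv (chart_at q) u) /\
    chart_map (chart_at q) (chart_inv (chart_at q) u) = u.
Proof.
move=> Dx.
have : \forall u \near chart_map (chart_at q) x,
    (chart_map (chart_at q) @` chart_dom (chart_at q)) u.
  by apply: open_nbhs_nbhs; split; [exact: chart_cod_open|exists x].
by apply: near_impl => u [y Dy <-]; rewrite chart_mapE.
Qed.

Lemma chart_image_open q (W : set M) : open W ->
  open (chart_map (chart_at q) @` (W `&` chart_dom (chart_at q))).
Proof.
move=> oW; rewrite openE => _ [x [Wx Dx] <-].
have nW : \forall y \near chart_inv (chart_at q) (chart_map (chart_at q) x), W y.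
  by rewrite chart_mapE //; exact: open_nbhs_nbhs.
have := near_comp (chart_inv_continuous Dx) nW.
apply: near_impl2 (near_chart_inv Dx) => u [Du uE] Wu.
by exists (chart_inv (chart_at q) u).
Qed.

Lemma smat_transition p q x : chart_dom (chart_at p) x -> chart_dom (chart_at q) x ->
  smat (chart_map (chart_at q) \o chart_inv (chart_at p)) (chart_map (chart_at p) x).
Proof.
move=> Dp Dq.
have := @chart_compatible _ _ M p q.
have oD : open (chart_map (chart_at p) @`
    (chart_dom (chart_at p) `&` chart_dom (chart_at q))).
  by rewrite setIC; apply: chart_image_open; exact: chart_dom_open.
by move=> /(smat_on _ oD); apply; exists x.
Qed.

Lemma near_chart_inv_continuous q x : chart_dom (chart_at q) x ->
  \forall u \near chart_map (chart_at q) x, {for u, continuous (chart_inv (chart_at q))}.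
Proof.
move=> Dx; apply: near_impl (near_chart_inv Dx) => u [Du uE].
by have := chart_inv_continuous Du; rewrite uE.
Qed.

End Charts.

Section ParametrizedMaps.
Context {R : realType} {m n : nat} {M : manifold R n}.
Implicit Types (f : 'rV[R]_m -> M) (w v : 'rV[R]_m) (q : M).

(** Charts are total maps without meaning outside their domain. Continuity near w keeps f in the
    domain of the chart, so that smoothness of the coordinate expression says something about f. *)
Definition smap f w : Prop :=
  (\forall w' \near w, {for w', continuous f}) /\
  smat (chart_map (chart_at (f w)) \o f) w.

(* The differential of f at w, read in the chart [chart_at (f w)] that models
   the tangent space at [f w]. *)
Definition dmap f w : {linear 'rV[R]_m -> 'rV[R]_n} :=
  'd (chart_map (chart_at (f w)) \o f) w.

Lemma smap_continuous f w : smap f w -> {for w, continuous f}.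
Proof. by case=> /nbhs_singleton. Qed.

Lemma smat_ext_chart f w p q : {for w, continuous f} ->
  chart_dom (chart_at p) (f w) ->
  \forall w' \near w, (chart_map (chart_at q) \o f) w' =
    ((chart_map (chart_at q) \o chart_inv (chart_at p)) \o
     (chart_map (chart_at p) \o f)) w'.
Proof.
move=> cf Dp; have := near_comp cf (near_chart_dom Dp).
by apply: near_impl => w' Dw' /=; rewrite chart_mapE.
Qed.

Lemma smat_change_chart f w p q : {for w, continuous f} ->
  chart_dom (chart_at p) (f w) -> chart_dom (chart_at q) (f w) ->
  smat (chart_map (chart_at p) \o f) w -> smat (chart_map (chart_at q) \o f) w.
Proof.
move=> cf Dp Dq sp.
have e := near_impl (fun _ => @esym _ _ _) (smat_ext_chart q cf Dp).
apply: (smat_ext e); apply: (smat_comp sp).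
exact: smat_transition.
Qed.

Lemma smap_chart f w q : smap f w -> chart_dom (chart_at q) (f w) ->
  smat (chart_map (chart_at q) \o f) w.
Proof.
move=> sf Dq; have cf := smap_continuous sf; case: sf => _.
exact: smat_change_chart cf (chart_at_dom _) Dq.
Qed.

Lemma smap_of_chart f w q : (\forall w' \near w, {for w', continuous f}) ->
  chart_dom (chart_at q) (f w) -> smat (chart_map (chart_at q) \o f) w -> smap f w.
Proof.
move=> cf Dq sf; split=> //.
exact: smat_change_chart (nbhs_singleton cf) Dq (chart_at_dom _) sf.
Qed.

Lemma smap_near f w : smap f w -> \forall w' \near w, smap f w'.
Proof.
move=> sf; have cf := smap_continuous sf; case: sf => nf sf.
have nD := near_comp cf (near_chart_dom (chart_at_dom (f w))).
apply: near_impl2 (near_and (near_join nf) (smat_near sf)) nD.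
move=> w' [nf' sf'] Dw'; exact: smap_of_chart nf' Dw' sf'.
Qed.

Lemma diff_change_chart f w p q v : {for w, continuous f} ->
  chart_dom (chart_at p) (f w) -> chart_dom (chart_at q) (f w) ->
  smat (chart_map (chart_at p) \o f) w ->
  'd (chart_map (chart_at q) \o f) w v =
  coord_change p q (f w) ('d (chart_map (chart_at p) \o f) w v).
Proof.
move=> cf Dp Dq sp; have st := smat_transition Dp Dq.
have e := smat_ext_chart q cf Dp.
have sq := smat_change_chart cf Dp Dq sp.
have sc := smat_comp sp st.
apply: (etrans (diff_near v e (smat_differentiable sq) (smat_differentiable sc))).
apply: (etrans (diff_compE v (smat_differentiable sp) (smat_differentiable st))).
by rewrite /coord_change lfunE.
Qed.

Lemma diff_chart f w q v : smap f w -> chart_dom (chart_at q) (f w) ->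
  'd (chart_map (chart_at q) \o f) w v = coord_change (f w) q (f w) (dmap f w v).
Proof.
move=> sf Dq; have cf := smap_continuous sf.
exact: diff_change_chart cf (chart_at_dom _) Dq sf.2.
Qed.

Lemma dmap_chart f w q v : smap f w -> chart_dom (chart_at q) (f w) ->
  dmap f w v = coord_change q (f w) (f w) ('d (chart_map (chart_at q) \o f) w v).
Proof.
move=> sf Dq; have cf := smap_continuous sf.
exact: diff_change_chart cf Dq (chart_at_dom _) (smap_chart sf Dq).
Qed.

End ParametrizedMaps.

Section MapsComposition.
Context {R : realType} {n : nat} {M : manifold R n}.

Lemma smap_comp l m (f : 'rV[R]_m -> M) (h : 'rV[R]_l -> 'rV[R]_m) z :
  smat h z -> smap f (h z) -> smap (f \o h) z.
Proof.
move=> sh sf; have ch := smat_continuous sh; split; last exact: smat_comp sh sf.2.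
have nh : \forall z' \near z, {for z', continuous h}.
  by apply: near_impl (smat_near sh) => z'; exact: smat_continuous.
apply: near_impl2 nh (near_comp ch sf.1) => z' ch' cf'.
exact: continuous_comp.
Qed.

Lemma dmap_comp l m (f : 'rV[R]_m -> M) (h : 'rV[R]_l -> 'rV[R]_m) z v :
  smat h z -> smap f (h z) -> dmap (f \o h) z v = dmap f (h z) ('d h z v).
Proof.
move=> sh sf.
exact: (diff_compE v (smat_differentiable sh) (smat_differentiable sf.2)).
Qed.

Lemma smap_chart_inv (q x : M) : chart_dom (chart_at q) x ->
  smap (chart_inv (chart_at q)) (chart_map (chart_at q) x).
Proof.
move=> Dx; apply: (@smap_of_chart _ _ _ _ _ _ q).
- exact: near_chart_inv_continuous.
- by rewrite chart_mapE.
- apply: smat_ext (smat_id _).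
  by apply: near_impl (near_chart_inv Dx) => u [_ uE].
Qed.

Lemma diff_chart_inv (q x : M) v : chart_dom (chart_at q) x ->
  'd (chart_map (chart_at q) \o chart_inv (chart_at q)) (chart_map (chart_at q) x) v = v.
Proof.
move=> Dx; have st := smat_transition Dx Dx.
have e : \forall u \near chart_map (chart_at q) x,
    (chart_map (chart_at q) \o chart_inv (chart_at q)) u = id u.
  by apply: near_impl (near_chart_inv Dx) => u [_ uE].
apply: (etrans (diff_near v e (smat_differentiable st) (smat_differentiable (smat_id _)))).
exact: (congr1 (fun g => g v) (linear_rV_diff idfun (chart_map (chart_at q) x))).
Qed.

Lemma coord_changeE (p q x : M) v : coord_change p q x v =
  'd (chart_map (chart_at q) \o chart_inv (chart_at p)) (chart_map (chart_at p) x) v.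
Proof. by rewrite /coord_change lfunE. Qed.

Lemma coord_change_id (q x : M) v : chart_dom (chart_at q) x ->
  coord_change q q x v = v.
Proof. by move=> Dx; rewrite /coord_change lfunE; exact: diff_chart_inv. Qed.

Lemma coord_change_trans (p q s x : M) v :
  chart_dom (chart_at p) x -> chart_dom (chart_at q) x -> chart_dom (chart_at s) x ->
  coord_change q s x (coord_change p q x v) = coord_change p s x v.
Proof.
move=> Dp Dq Ds.
have sf := smap_chart_inv Dp.
have fx : chart_inv (chart_at p) (chart_map (chart_at p) x) = x by exact: chart_mapE.
have Dq' : chart_dom (chart_at q) (chart_inv (chart_at p) (chart_map (chart_at p) x)).
  by rewrite fx.
have Ds' : chart_dom (chart_at s) (chart_inv (chart_at p) (chart_map (chart_at p) x)).
  by rewrite fx.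
have := diff_change_chart v (smap_continuous sf) Dq' Ds' (smap_chart sf Dq').
rewrite fx => e; apply: (etrans (congr1 (coord_change q s x) (coord_changeE p q x v))).
exact: etrans (esym e) (esym (coord_changeE p s x v)).
Qed.

Lemma coord_changeK (p q x : M) v :
  chart_dom (chart_at p) x -> chart_dom (chart_at q) x ->
  coord_change q p x (coord_change p q x v) = v.
Proof. by move=> Dp Dq; rewrite coord_change_trans // coord_change_id. Qed.

Lemma dmap_chart_inv (q x : M) v : chart_dom (chart_at q) x ->
  dmap (chart_inv (chart_at q)) (chart_map (chart_at q) x) v = coord_change q x x v.
Proof. by move=> Dx; rewrite /dmap /coord_change lfunE /= chart_mapE. Qed.

End MapsComposition.

Section SmoothMaps.
Context {R : realType} {n n0 : nat} {M : manifold R n} {M0 : manifold R n0}.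

Lemma smooth_map_smat (g : M -> M0) p q y : smooth_map g ->
  chart_dom (chart_at p) y -> chart_dom (chart_at q) (g y) ->
  smat (chart_map (chart_at q) \o g \o chart_inv (chart_at p)) (chart_map (chart_at p) y).
Proof.
move=> [cg sg] Dp Dq.
have oD : open (chart_map (chart_at p) @`
    (chart_dom (chart_at p) `&` g @^-1` chart_dom (chart_at q))).
  rewrite setIC; apply: chart_image_open.
  by apply: open_comp => [z _|]; [exact: cg|exact: chart_dom_open].
by have /(smat_on _ oD) := sg p q; apply; exists y.
Qed.

Lemma smap_smooth_map m (g : M -> M0) (f : 'rV[R]_m -> M) w : smooth_map g ->
  smap f w -> smap (g \o f) w.
Proof.
move=> sg sf; have cf := smap_continuous sf; split.
  by apply: near_impl sf.1 => w' cf'; apply: continuous_comp => //; exact: sg.1.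
have ss := smooth_map_smat sg (chart_at_dom (f w)) (chart_at_dom (g (f w))).
apply: smat_ext (smat_comp sf.2 ss).
have := near_comp cf (near_chart_dom (chart_at_dom (f w))).
by apply: near_impl => w' Dw' /=; rewrite chart_mapE.
Qed.

Lemma dmap_smooth_map m (g : M -> M0) (f : 'rV[R]_m -> M) w v : smooth_map g ->
  smap f w -> dmap (g \o f) w v = tangent_map g (f w) (dmap f w v).
Proof.
move=> sg sf; have cf := smap_continuous sf.
have sgf := smap_smooth_map sg sf.
have ss := smooth_map_smat sg (chart_at_dom (f w)) (chart_at_dom (g (f w))).
have sc := smat_comp sf.2 ss.
have e : \forall w' \near w, (chart_map (chart_at (g (f w))) \o (g \o f)) w' =
  ((chart_map (chart_at (g (f w))) \o g \o chart_inv (chart_at (f w))) \o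
   (chart_map (chart_at (f w)) \o f)) w'.
  have := near_comp cf (near_chart_dom (chart_at_dom (f w))).
  by apply: near_impl => w' Dw' /=; rewrite chart_mapE.
apply: (etrans (diff_near v e (smat_differentiable sgf.2) (smat_differentiable sc))).
apply: (etrans (diff_compE v (smat_differentiable sf.2) (smat_differentiable ss))).
by rewrite /tangent_map lfunE.
Qed.

End SmoothMaps.

(** * The characteristic distribution in coordinates *)

Lemma mem_span_image (K : fieldType) (V : vectType K) k (F : 'I_k -> V) (v : V) :
  v \in <<[seq F i | i : 'I_k]>>%VS <-> exists c : 'I_k -> K, v = \sum_i c i *: F i.
Proof.
split=> [|[c ->]]; last first.
  apply: memv_suml => i _; apply: memvZ; apply: memv_span.
  by apply: map_f; rewrite mem_enum.
rewrite span_def big_map big_enum /= => /memv_sumP[w wP ->].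
have H i : exists c, w i = c *: F i by apply/vlineP/wP.
have [c cP] := choice H; exists c; apply: eq_bigr => i _; exact: cP.
Qed.

Section HyperplaneForms.
Context {R : realType} {n : nat} {M : manifold R n}.
Implicit Types (C : tangent_distribution M) (psi : 'rV[R]_n -> M).
Implicit Types (a : 'rV[R]_n -> 'rV[R]_n) (w : 'rV[R]_n).

(** A nonvanishing 1-form on the parameter space, given by its coefficients, whose kernel is the
    inverse image of C under the differential of psi. *)
Definition local_form C psi w a : Prop :=
  smat a w /\ \forall z \near w, a z != 0 /\
    forall v, dot (a z) v = 0 <-> dmap psi z v \in C (psi z).

Lemma smooth_vf_smat (U : set M) X (q x : M) : open U -> U x ->
  chart_dom (chart_at q) x -> smooth_vf U X ->
  smat (vf_in q X) (chart_map (chart_at q) x).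
Proof.
move=> oU Ux Dx sX.
by have /(smat_on _ (chart_image_open (q := q) oU)) := sX q; apply; exists x.
Qed.

Lemma vf_in_chart X (q y : M) : chart_dom (chart_at q) y ->
  vf_in q X (chart_map (chart_at q) y) = coord_change y q y (X y).
Proof. by move=> Dy; rewrite /vf_in chart_mapE. Qed.

Lemma near_chart_points (q x : M) (P : M -> Prop) : chart_dom (chart_at q) x ->
  (\forall y \near x, P y) ->
  \forall u \near chart_map (chart_at q) x,
    exists y, [/\ u = chart_map (chart_at q) y, chart_dom (chart_at q) y & P y].
Proof.
move=> Dx nP.
have nP' : \forall y \near chart_inv (chart_at q) (chart_map (chart_at q) x), P y.
  by rewrite chart_mapE.
have := near_comp (chart_inv_continuous Dx) nP'.
apply: near_impl2 (near_chart_inv Dx) => u [Du uE] Pu.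
by exists (chart_inv (chart_at q) u).
Qed.

End HyperplaneForms.

(** A frame of C is completed by a constant vector xi transverse to C at x. The rows of Z are this
    frame, and [a] is the first column of the inverse of Z: the component along xi, which vanishes
    exactly on C. *)
Lemma local_form_chart (R : realType) n (M : manifold R n)
    (C : tangent_distribution M) (x : M) : hyperplane_field C ->
  exists a, local_form C (chart_inv (chart_at x)) (chart_map (chart_at x) x) a.
Proof.
move=> [k kn [dimC Cx]]; subst n.
have [U [X [oU Ux sX CX]]] := Cx x.
have Dx := chart_at_dom x.
have [xi xiC] : exists xi, xi \notin C x.
  apply: contrapT => H.
  have : (fullv <= C x)%VS.
    by apply/subvP => v _; apply: contrapT => /negP vC; apply: H; exists v.
  move/dimvS; rewrite dimC dimvf /dim /= mul1n ltnn //.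
pose Z u : 'M[R]_k.+1 := \matrix_(i, j)
  (if unlift ord0 i is Some i' then vf_in x (X i') u 0 j else xi 0 j).
have sZ : smat Z (chart_map (chart_at x) x).
  apply/smat_mxP => i j.
  apply: (@smat_ext _ _ _ (fun u =>
      if unlift ord0 i is Some i' then vf_in x (X i') u 0 j else xi 0 j)).
    by apply: near_impl (filterT : nbhs (chart_map (chart_at x) x) setT) => u _; rewrite mxE.
  case: (unlift ord0 i) => [i'|]; last exact: smat_cst.
  apply: smat_coord; exact: smooth_vf_smat (sX i').
have ZE u (c : 'rV[R]_k.+1) : c *m Z u =
    c 0 ord0 *: xi + \sum_i c 0 (lift ord0 i) *: vf_in x (X i) u.
  rewrite mulmx_sum_row big_ord_recl; congr (_ *: _ + _).
    by apply/rowP => j; rewrite !mxE unlift_none.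
  by apply: eq_bigr => i _; congr (_ *: _); apply/rowP => j; rewrite !mxE liftK.
have X0 i : vf_in x (X i) (chart_map (chart_at x) x) = X i x.
  by rewrite vf_in_chart // coord_change_id.
have uZ : Z (chart_map (chart_at x) x) \in unitmx.
  rewrite -row_full_unit -sub1mx; apply/row_subP => l.
  set w := row l _.
  have full : (C x + <[xi]>)%VS = fullv.
    apply/eqP; rewrite eqEdim subvf /=.
    have : (\dim (C x) < \dim (C x + <[xi]>)%VS)%N.
      rewrite (ltn_leqif (dimv_leqif_sup (addvSl _ _))).
      by apply: contra xiC => /subvP; apply; rewrite memvE addvSr.
    by rewrite dimC dimvf /dim /= mul1n.
  have : w \in (C x + <[xi]>)%VS by rewrite full memvf.
  move=> /memv_addP[c1]; rewrite CX // => /mem_span_image[c ->].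
  move=> [_ /vlineP[d ->] wE]; apply/submxP.
  exists (\row_j (if unlift ord0 j is Some i then c i else d)).
  rewrite ZE wE mxE unlift_none addrC; congr (_ + _).
  by apply: eq_bigr => i _; rewrite mxE liftK X0.
pose a u : 'rV[R]_k.+1 := \row_j invmx (Z u) j ord0.
have aE u v : dot (a u) v = (v *m invmx (Z u)) 0 ord0.
  by rewrite mxE; apply: eq_bigr => j _; rewrite mxE mulrC.
exists a; split.
  apply/smat_mxP => i j.
  apply: (@smat_ext _ _ _ (fun u => invmx (Z u) j ord0)).
    by apply: near_impl (filterT : nbhs (chart_map (chart_at x) x) setT) => u _; rewrite mxE.
  by have /smat_mxP := smat_invmx sZ uZ.
have nU : \forall y \near x, U y by exact: open_nbhs_nbhs.
have := near_chart_points Dx nU.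
apply: near_impl2 (smat_unitmx sZ uZ) => u uZu [y [uE Dy Uy]]; split.
  apply/eqP => a0; have := aE u (delta_mx 0 ord0 *m Z u).
  rewrite mulmxK // mxE !eqxx a0 dot0l => /eqP.
  by rewrite eq_sym oner_eq0.
have Xu i : vf_in x (X i) u = coord_change y x y (X i y).
  by rewrite uE vf_in_chart.
move=> v; rewrite uE dmap_chart_inv // chart_mapE // -uE aE CX //.
have Dyy := chart_at_dom y.
split=> [v0|/mem_span_image[c cE]].
  apply/mem_span_image; exists (fun i => (v *m invmx (Z u)) 0 (lift ord0 i)).
  rewrite -{1}[v](mulmxKV uZu) ZE v0 scale0r add0r linear_sum.
  by apply: eq_bigr => i _; rewrite linearZ Xu; congr (_ *: _); exact: coord_changeK.
have -> : v = (\row_j (if unlift ord0 j is Some i then c i else 0)) *m Z u.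
  rewrite ZE mxE unlift_none scale0r add0r.
  apply: (etrans (esym (coord_changeK v Dy Dyy))).
  apply: (etrans (congr1 (coord_change y x y) cE)); rewrite linear_sum.
  by apply: eq_bigr => i _; rewrite linearZ Xu mxE liftK.
by rewrite mulmxK // mxE unlift_none.
Qed.

Lemma near_open (T : topologicalType) (x : T) (P : T -> Prop) :
  (\forall y \near x, P y) -> exists U, [/\ open U, U x & forall y, U y -> P y].
Proof.
move=> nP; exists [set y | P y]°; split; first exact: open_interior.
  exact: nP.
by move=> y; exact: interior_subset.
Qed.

Section CharacteristicDistribution.
Context {R : realType} {n : nat} {M : manifold R n}.
Implicit Types (C : tangent_distribution M) (x : M).

Local Notation kap q := (chart_map (chart_at q)).
Local Notation iot q := (chart_inv (chart_at q)).
Local Notation dom q := (chart_dom (chart_at q)).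

(** A field given by its components in the chart at x is smooth in every other chart, the change of
    components being the differential of a transition map. The property [P] of the coordinates is
    carried along so that it holds on the same open set. *)
Lemma vf_of_chart x (F : 'rV[R]_n -> 'rV[R]_n) (P : 'rV[R]_n -> Prop) :
  smat F (kap x x) -> (\forall u \near kap x x, P u) ->
  exists (U : set M) (X : M -> 'rV[R]_n), [/\ open U, U x, smooth_vf U X &
    forall y, U y -> [/\ dom x y, X y = coord_change x y y (F (kap x y)) & P (kap x y)]].
Proof.
move=> sF nP; have Dx := chart_at_dom x.
have ck : {for x, continuous (kap x)} by exact: chart_map_continuous.
have n1 := near_comp ck (smat_near sF); have n2 := near_comp ck nP.
have n3 := near_and n1 n2.
have n4 := near_and n3 (near_chart_dom Dx).
have [U [oU Ux HU]] := near_open n4.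
exists U, (fun y => coord_change x y y (F (kap x y))); split => //; last first.
  by move=> y /HU[[_ Py] Dy].
move=> q; apply/(smat_on _ (chart_image_open (q := q) oU)) => _ [y [Uy Dqy] <-].
have [[sFy _] Dy] := HU _ Uy.
have st := smat_transition Dqy Dy; have st' := smat_transition Dy Dqy.
have ty : (kap x \o iot q) (kap q y) = kap x y by rewrite /= chart_mapE.
rewrite -ty in sFy st'.
apply: smat_ext (smat_comp st (smat_diff st' sFy)).
have nU : \forall z \near y, U z by exact: open_nbhs_nbhs.
apply: near_impl (near_chart_points Dqy nU) => u [z [-> Dqz Uz]] /=.
have [[_ _] Dz] := HU _ Uz.
rewrite /vf_in !chart_mapE // coord_change_trans //; last exact: chart_at_dom.
by rewrite coord_changeE.
Qed.

Lemma lie_bracketE X Y x :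
  smat (vf_in x X) (kap x x) -> smat (vf_in x Y) (kap x x) ->
  lie_bracket X Y x = 'd (vf_in x Y) (kap x x) (X x) - 'd (vf_in x X) (kap x x) (Y x).
Proof.
move=> sX sY; have Dx := chart_at_dom x.
have e Z : vf_in x Z (kap x x) = Z x by rewrite vf_in_chart // coord_change_id.
rewrite /lie_bracket !e.
exact: (congr2 (fun a b => a - b) (deriveE _ (smat_differentiable sY))
  (deriveE _ (smat_differentiable sX))).
Qed.

Lemma mem_dmap_chart_inv C x v :
  (dmap (iot x) (kap x x) v \in C (iot x (kap x x))) = (v \in C x).
Proof.
have Dx := chart_at_dom x.
by rewrite dmap_chart_inv // coord_change_id // chart_mapE.
Qed.

(* Cartan's formula: on fields with values in [C], [b([X, Y]) = - db(X, Y)]. *)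
Lemma dot_lie_bracket C x b (U : set M) X Y :
  local_form C (iot x) (kap x x) b -> open U -> U x ->
  vf_valued_in C U X -> vf_valued_in C U Y ->
  dot (b (kap x x)) (lie_bracket X Y x) = - dform b (kap x x) (X x) (Y x).
Proof.
move=> [sb nb] oU Ux [sX CX] [sY CY].
have Dx := chart_at_dom x.
have sXc := smooth_vf_smat oU Ux Dx sX; have sYc := smooth_vf_smat oU Ux Dx sY.
have nU : \forall y \near x, U y by exact: open_nbhs_nbhs.
have eX Z : vf_in x Z (kap x x) = Z x by rewrite vf_in_chart // coord_change_id.
have key Z t : smat (vf_in x Z) (kap x x) -> (forall q, U q -> Z q \in C q) ->
    dot (b (kap x x)) ('d (vf_in x Z) (kap x x) t) =
    - dot ('d b (kap x x) t) (Z x).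
  move=> sZ CZ.
  have e0 : \forall u \near kap x x, dot (b u) (vf_in x Z u) = 0.
    apply: near_impl2 nb (near_chart_points Dx nU) => u [_ bu] [y [uE Dy Uy]].
    apply/bu; rewrite uE dmap_chart_inv // vf_in_chart // chart_mapE //.
    by rewrite coord_changeK ?CZ //; exact: chart_at_dom.
  have sbZ := smat_dot sb sZ.
  have d0 := diff_near t e0 (smat_differentiableR sbZ) (smat_differentiableR (smat_cst 0 _)).
  have c0 : 'd (fun=> 0 : R) (kap x x) t = 0.
    exact: (congr1 (fun g => g t) (diff_cst (0 : R) (kap x x))).
  have d1 := diff_dot t (smat_differentiable sb) (smat_differentiable sZ).
  have := etrans (esym d1) (etrans d0 c0).
  by rewrite eX addrC => /eqP; rewrite addr_eq0 => /eqP.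
rewrite lie_bracketE // dotBr (key _ _ sYc CY) (key _ _ sXc CX) /dform.
by rewrite opprK opprB addrC.
Qed.

Lemma extend_in_distribution C x b v :
  local_form C (iot x) (kap x x) b -> v \in C x ->
  exists (U : set M) (X : M -> 'rV[R]_n),
    [/\ open U, U x, vf_valued_in C U X & X x = v].
Proof.
move=> [sb nb] vC; have Dx := chart_at_dom x.
have [b0 bP] := nbhs_singleton nb.
have bv : dot (b (kap x x)) v = 0 by apply/bP; rewrite mem_dmap_chart_inv.
have [j bj] := rV_neq0 b0.
(* The constant field v, corrected along a coordinate direction on which b is nonzero so as to lie
   in the kernel of b; at x the correction vanishes. *)
pose F u := v - (dot (b u) v * (b u 0 j)^-1) *: delta_mx 0 j.
have sF : smat F (kap x x).
  apply: smat_sub; first exact: smat_cst.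
  apply: smat_scale; last exact: smat_cst.
  apply: smat_mul; first by apply: smat_dot => //; exact: smat_cst.
  by apply: smat_inv => //; exact: smat_coord.
have nF : \forall u \near kap x x, dmap (iot x) u (F u) \in C (iot x u).
  apply: near_impl2 nb (smat_near_neq0 (smat_coord j sb) bj) => u [_ bu] buj.
  by apply/bu; rewrite dotBr dotZr dot_delta mulfVK // subrr.
have [U [X [oU Ux sX HX]]] := vf_of_chart sF nF.
exists U, X; split => //; first split => //.
  move=> y /HX[Dy -> ]; rewrite dmap_chart_inv // chart_mapE //.
have [_ -> _] := HX x Ux.
by rewrite coord_change_id // /F bv mul0r scale0r subr0.
Qed.

Lemma smooth_vf_sub (U V : set M) X : open U -> open V -> U `<=` V ->
  smooth_vf V X -> smooth_vf U X.
Proof.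
move=> oU oV UV sX q; apply/(smat_on _ (chart_image_open (q := q) oU)).
move=> _ [y [Uy Dy] <-]; exact: (smooth_vf_smat oV (UV _ Uy)).
Qed.

Lemma vf_valued_in_sub C (U V : set M) X : open U -> open V -> U `<=` V ->
  vf_valued_in C V X -> vf_valued_in C U X.
Proof.
move=> oU oV UV [sX CX]; split; first exact: smooth_vf_sub sX.
by move=> q /UV; exact: CX.
Qed.

(** [nu] asks for some extensions of v and w. By Cartan's formula the class of their bracket modulo
    C depends only on the values at x, so the condition can be tested on any extensions, and
    [extend_in_distribution] provides them. *)
Lemma nu0P C x b v w : local_form C (iot x) (kap x x) b ->
  v \in C x -> w \in C x ->
  nu C x v w 0 <-> dform b (kap x x) v w = 0.
Proof.
move=> lb vC wC; have [sb nb] := lb; have [b0 bP] := nbhs_singleton nb.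
have inC L : L \in C x <-> dot (b (kap x x)) L = 0.
  by rewrite -mem_dmap_chart_inv; exact: iff_sym (bP L).
have key U X Y : open U -> U x -> vf_valued_in C U X -> vf_valued_in C U Y ->
    0 - lie_bracket X Y x \in C x <-> dform b (kap x x) (X x) (Y x) = 0.
  move=> oU Ux CX CY; rewrite inC sub0r linearN /= (dot_lie_bracket lb oU Ux CX CY).
  by rewrite opprK.
split=> [[U [X [Y [[oU Ux CX CY] <- <-]]]]|]; first by move/(key _ _ _ oU Ux CX CY).
have [U1 [X [oU1 U1x CX Xx]]] := extend_in_distribution lb vC.
have [U2 [Y [oU2 U2x CY Yx]]] := extend_in_distribution lb wC.
have oU : open (U1 `&` U2) by exact: openI.
have CX' : vf_valued_in C (U1 `&` U2) X by exact: (vf_valued_in_sub oU oU1).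
have CY' : vf_valued_in C (U1 `&` U2) Y by apply: (vf_valued_in_sub oU oU2) => // z [].
move=> d0; exists (U1 `&` U2), X, Y; split => //.
by apply/(key _ _ _ oU (conj U1x U2x) CX' CY'); rewrite Xx Yx.
Qed.

(** Shows that the [xget] in [char_dist] does find a subspace. The candidate K is cut out of C x by
    finitely many linear equations: projecting the basis vectors onto C x is enough to test all w of
    C x. *)
Lemma char_distP C x b v : local_form C (iot x) (kap x x) b ->
  v \in char_dist C x <->
  v \in C x /\ forall w, w \in C x -> dform b (kap x x) v w = 0.
Proof.
move=> lb.
pose g v : 'rV[R]_n := \row_j dform b (kap x x) v (projv (C x) (delta_mx 0 j)).
have lg : linear g.
  move=> k u u'; apply/rowP => j; rewrite !mxE.
  rewrite dform_anti dform_linear ![dform _ _ _ (projv _ _)]dform_anti.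
  by rewrite -[_ *: _]/(_ * _); ring.
pose m := GRing.isLinear.Build _ _ _ _ _ lg.
pose G : {linear _ -> _} := HB.pack g m.
pose K := (C x :&: lker (linfun G))%VS.
have KP u : u \in K <-> u \in C x /\ forall w, w \in C x -> dform b (kap x x) u w = 0.
  rewrite memv_cap; split=> [/andP[uC]|[uC H]].
    rewrite memv_ker lfunE /= => /eqP g0; split => // w wC.
    rewrite -(projv_id wC) [w in projv _ w]row_sum_delta linear_sum.
    pose D : {linear 'rV[R]_n -> R} := HB.pack (dform b (kap x x) u)
      (GRing.isLinear.Build _ _ _ _ _ (@dform_linear R n b (kap x x) u)).
    rewrite -[LHS]/(D _) linear_sum big1 // => j _.
    have e : D (projv (C x) (delta_mx 0 j)) = 0.
      by have := congr1 (fun r : 'rV[R]_n => r 0 j) g0; rewrite !mxE.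
    by rewrite !linearZZ e scaler0.
  apply/andP; split => //; rewrite memv_ker lfunE /=; apply/eqP/rowP => j.
  by rewrite !mxE; apply: H; exact: memv_proj.
have KP' : [set K : {vspace 'rV[R]_n} | forall v, v \in K <->
      v \in C x /\ forall w, w \in C x -> nu C x v w 0] K.
  move=> u; rewrite KP; split=> -[uC H]; split => // w wC.
    by apply/(nu0P lb) => //; exact: H.
  by apply/(nu0P lb) => //; exact: H.
have /(_ v) := xgetPex 0%VS (ex_intro _ _ KP'); rewrite -/(char_dist C x) => ->.
split=> -[vC H]; split => // w wC.
  by apply/(nu0P lb) => //; exact: H.
by apply/(nu0P lb) => //; exact: H.
Qed.

End CharacteristicDistribution.

(** * Local forms in arbitrary parametrizations *)

Section FormsAlongParametrizations.
Context {R : realType} {n : nat} {M : manifold R n}.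
Context (C : tangent_distribution M).
Implicit Types (psi : 'rV[R]_n -> M) (w z v : 'rV[R]_n).

Local Notation kap q := (chart_map (chart_at q)).
Local Notation iot q := (chart_inv (chart_at q)).
Local Notation dom q := (chart_dom (chart_at q)).

(** The parameter space has the dimension of M, so psi is a local diffeomorphism near w;
    surjectivity of the differential is the form in which this is used. *)
Definition param psi w : Prop :=
  smap psi w /\ \forall z \near w, forall t, exists v, dmap psi z v = t.

Lemma param_near psi w : param psi w -> \forall z \near w, param psi z.
Proof.
move=> [sp np].
by apply: near_impl2 (smap_near sp) (near_join np) => z; split.
Qed.

Lemma local_form_near psi w a : local_form C psi w a ->
  \forall z \near w, local_form C psi z a.
Proof.
move=> [sa na].
by apply: near_impl2 (smat_near sa) (near_join na) => z; split.
Qed.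

Lemma eq_iff (b c : bool) : b = c -> (b <-> c).
Proof. by move=> ->. Qed.

Lemma mem_dmap_chart q y v : dom q y ->
  (dmap (iot q) (kap q y) v \in C (iot q (kap q y))) = (coord_change q y y v \in C y).
Proof. by move=> Dy; rewrite dmap_chart_inv // chart_mapE. Qed.

Lemma local_form_pull psi w b : param psi w ->
  local_form C (iot (psi w)) (kap (psi w) (psi w)) b ->
  local_form C psi w (pull (kap (psi w) \o psi) b).
Proof.
move=> [sp np] [sb nb]; set x := psi w in sb nb *.
have Dx := chart_at_dom x.
have cp := smap_continuous sp.
split; first exact: smat_pull sp.2 sb.
have nb' := near_comp (smat_continuous sp.2) nb.
have nD := near_comp cp (near_chart_dom Dx).
apply: near_impl2 (near_and (smap_near sp) nb')
  (near_and np nD) => z [spz [bz0 bz]] [surj Dz].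
have key v : dot (pull (kap x \o psi) b z) v = 0 <-> dmap psi z v \in C (psi z).
  rewrite dot_pull; apply: (iff_trans (bz _)).
  have e : is_true (dmap psi z v \in C (psi z)) = is_true
     (coord_change x (psi z) (psi z) ('d (kap x \o psi) z v) \in C (psi z)).
    exact: (congr1 (fun t => is_true (t \in C (psi z))) (dmap_chart v spz Dz)).
  rewrite e; exact: eq_iff (mem_dmap_chart ('d (kap x \o psi) z v) Dz).
split=> //.
have [j bj] := rV_neq0 bz0.
apply/eqP => p0.
have [v vE] := surj (coord_change x (psi z) (psi z) (delta_mx 0 j)).
have e : 'd (kap x \o psi) z v = delta_mx 0 j.
  apply: (etrans (diff_chart v spz Dz)).
  rewrite vE coord_changeK //; exact: chart_at_dom.
have := dot_pull (kap x \o psi) b z v.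
rewrite p0 dot0l => d0; have := congr1 (dot (b ((kap x \o psi) z))) e.
by rewrite -d0 dot_delta => b0; move: bj; rewrite -b0 eqxx.
Qed.

Lemma local_form_along psi w : hyperplane_field C -> param psi w ->
  exists a, local_form C psi w a.
Proof.
move=> hC pp; have [b lb] := local_form_chart (psi w) hC.
by exists (pull (kap (psi w) \o psi) b); exact: local_form_pull.
Qed.

(** The criterion holds for the pullback of a form in the chart at [psi w], since exterior
    derivatives commute with pullbacks; [dform_same_kernel] then replaces this pullback by any other
    local form [a]. *)
Lemma char_along psi w a v : hyperplane_field C -> param psi w ->
  local_form C psi w a ->
  dmap psi w v \in char_dist C (psi w) <->
  dot (a w) v = 0 /\ forall v', dot (a w) v' = 0 -> dform a w v v' = 0.
Proof.
move=> hC pp [sa na].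
have [b lb] := local_form_chart (psi w) hC.
have [sl nl] := local_form_pull pp lb.
have [sp np] := pp.
have same : \forall z \near w, forall v', dot (pull (kap (psi w) \o psi) b z) v' = 0 <->
    dot (a z) v' = 0.
  apply: near_impl2 na nl => z [_ az] [_ lz] v'.
  exact: iff_trans (lz v') (iff_sym (az v')).
have [a0 aw] := nbhs_singleton na.
have key v1 v2 : dot (a w) v1 = 0 -> dot (a w) v2 = 0 ->
    dform a w v1 v2 = 0 <-> dform b (kap (psi w) (psi w)) (dmap psi w v1) (dmap psi w v2) = 0.
  move=> a1 a2; apply: (iff_trans (dform_same_kernel sa sl a0 same a1 a2)).
  by have := dform_pull v1 v2 sp.2 lb.1 => ->.
apply: (iff_trans (char_distP _ lb)); split=> [[vC H]|[av H]].
  have av : dot (a w) v = 0 by exact/aw.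
  split=> // v' av'; exact: (key v v' av av').2 (H _ ((aw v').1 av')).
split=> [|t tC]; first exact/aw.
have [v' tE] := nbhs_singleton np t; rewrite -tE in tC *.
have av' : dot (a w) v' = 0 by exact/aw.
exact: (key v v' av av').1 (H v' av').
Qed.

Lemma char_sub x : hyperplane_field C -> (char_dist C x <= C x)%VS.
Proof.
move=> hC; have [b lb] := local_form_chart x hC.
by apply/subvP => v /(char_distP _ lb)[].
Qed.

Lemma dform_sum_l a z v w :
  dform a z v w = \sum_i v 0 i * dform a z (delta_mx 0 i) w.
Proof.
pose D : {linear 'rV[R]_n -> R} := HB.pack (dform a z w)
  (GRing.isLinear.Build _ _ _ _ _ (@dform_linear R n a z w)).
rewrite dform_anti -[dform a z w v]/(D v) [v in LHS]row_sum_delta linear_sum -sumrN.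
by apply: eq_bigr => i _; rewrite linearZZ -[_ *: _]/(_ * _) -mulrN -dform_anti.
Qed.

Lemma dform_sum_r a z v w :
  dform a z v w = \sum_i w 0 i * dform a z v (delta_mx 0 i).
Proof.
rewrite dform_anti dform_sum_l -sumrN; apply: eq_bigr => i _.
by rewrite -mulrN -dform_anti.
Qed.

Lemma smat_dform a z (v w : 'rV[R]_n) : smat a z -> smat (fun x => dform a x v w) z.
Proof.
move=> sa; apply: smat_sub; apply: smat_dot; by [exact: smat_cst|
  apply: smat_diff => //; exact: smat_cst].
Qed.

(** Where a_j is nonzero, the vectors a_j e_l - a_l e_j span the kernel of [a]. The entries of [Om]
    are da(e_i, a_j e_l - a_l e_j), so the equations say that v is in the kernel of [a] and that
    da(v, -) vanishes on this kernel. *)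
Lemma char_matrix psi w : hyperplane_field C -> param psi w ->
  exists N (Phi : 'rV[R]_n -> 'M[R]_(n, N)), smat Phi w /\
    \forall z \near w, forall v,
      v *m Phi z = 0 <-> dmap psi z v \in char_dist C (psi z).
Proof.
move=> hC pp; have [a la] := local_form_along hC pp.
have [sa na] := la; have [a0 _] := nbhs_singleton na.
have [j aj] := rV_neq0 a0.
pose Om z : 'M[R]_n := \matrix_(i, l)
  (a z 0 j * dform a z (delta_mx 0 i) (delta_mx 0 l) -
   a z 0 l * dform a z (delta_mx 0 i) (delta_mx 0 j)).
exists (1 + n)%N, (fun z => row_mx (a z)^T (Om z)); split.
  apply/smat_mxP => i l; case: (split_ordP l) => l' ->.
    apply: (@smat_ext _ _ _ (fun z => a z 0 i)); last exact: smat_coord.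
    apply: near_impl (filterT : nbhs w setT) => z _.
    by rewrite row_mxEl mxE (ord1 l').
  apply: (@smat_ext _ _ _ (fun z =>
      a z 0 j * dform a z (delta_mx 0 i) (delta_mx 0 l') -
      a z 0 l' * dform a z (delta_mx 0 i) (delta_mx 0 j))).
    by apply: near_impl (filterT : nbhs w setT) => z _; rewrite row_mxEr mxE.
  by apply: smat_sub; apply: smat_mul; by [exact: smat_coord|exact: smat_dform].
apply: near_impl2 (near_and (param_near pp) (local_form_near la))
  (smat_near_neq0 (smat_coord j sa) aj) => z [ppz laz] azj v.
apply: iff_sym; apply: (iff_trans (char_along v hC ppz laz)).
have e1 : v *m (a z)^T = (dot (a z) v)%:M.
  apply/matrixP => k l; rewrite !mxE !ord1 eqxx mulr1n.
  by apply: eq_bigr => i _; rewrite mxE mulrC.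
have e2 l : (v *m Om z) 0 l =
    a z 0 j * dform a z v (delta_mx 0 l) - a z 0 l * dform a z v (delta_mx 0 j).
  rewrite mxE !(dform_sum_l a z v) !mulr_sumr -sumrB; apply: eq_bigr => i _.
  by rewrite mxE; ring.
rewrite mul_mx_row; split=> [[av H]|/eqP].
  rewrite e1 av; apply/eqP; rewrite row_mx_eq0; apply/andP; split.
    by apply/eqP/matrixP => k l; rewrite !mxE mul0rn.
  apply/eqP/rowP => l; rewrite e2 mxE.
  have := H (a z 0 j *: delta_mx 0 l - a z 0 l *: delta_mx 0 j).
  rewrite dotBr !dotZr !dot_delta [a z 0 l * _]mulrC subrr => /(_ erefl).
  pose D : {linear 'rV[R]_n -> R} := HB.pack (dform a z v)
    (GRing.isLinear.Build _ _ _ _ _ (@dform_linear R n a z v)).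
  by rewrite -[dform a z v _]/(D _) linearB !linearZZ.
rewrite row_mx_eq0 => /andP[/eqP v1 /eqP v2].
have av : dot (a z) v = 0.
  by have := congr1 (fun A : 'M[R]_1 => A 0 0) v1; rewrite e1 !mxE eqxx mulr1n.
split=> // v' av'; apply: (mulfI azj); rewrite mulr0 dform_sum_r mulr_sumr.
transitivity (dot (a z) v' * dform a z v (delta_mx 0 j)); last by rewrite av' mul0r.
rewrite /dot mulr_suml; apply: eq_bigr => l _.
have := e2 l; rewrite v2 mxE => /esym/eqP; rewrite subr_eq0 => /eqP e.
by rewrite mulrCA e; ring.
Qed.

End FormsAlongParametrizations.

(** * Integral submanifolds and leaves *)

Lemma near_dist (R : realType) (T : topologicalType) (V : normedModType R)
    (f : T -> V) (x : T) (e : R) : {for x, continuous f} -> 0 < e ->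
  \forall y \near x, `|f y - f x| < e.
Proof.
move=> cf e0; move/cvgrPdist_lt: cf => /(_ _ e0).
by apply: near_impl => y; rewrite distrC.
Qed.

Lemma norm_lt_of_dist (R : realType) (V : normedModType R) (x y : V) (c : R) :
  `|y - x| < c -> `|y| < `|x| + c.
Proof.
by have := ler_normD (y - x) x; rewrite subrK; lra.
Qed.

Section MatrixNorm.
Context {R : realType}.

Lemma entry_norm m n (A : 'M[R]_(m, n)) i j : `|A i j| <= `|A|.
Proof.
by rewrite [leRHS]/Num.Def.normr /= mx_normrE; exact: (le_bigmax _ _ (i, j)).
Qed.

Lemma mx_norm_le m n (A : 'M[R]_(m, n)) (c : R) : 0 <= c ->
  (forall i j, `|A i j| <= c) -> `|A| <= c.
Proof.
move=> c0 H; rewrite [leLHS]/Num.Def.normr /= mx_normrE.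
by apply: bigmax_le => // -[i j] _; exact: H.
Qed.

Lemma mulmx_norm m n p (A : 'M[R]_(m, n)) (B : 'M[R]_(n, p)) :
  `|A *m B| <= n%:R * (`|A| * `|B|).
Proof.
apply: mx_norm_le => [|i j]; first by rewrite !mulr_ge0.
rewrite mxE; apply: le_trans (ler_norm_sum _ _ _) _.
rewrite mulrC mulr_natr -[X in _ *+ X]card_ord -sumr_const; apply: ler_sum => k _.
by rewrite normrM ler_pM // entry_norm.
Qed.

Lemma smat_lipschitzR n (f : 'rV[R]_n -> R) w : smat f w ->
  exists L : R, 0 <= L /\ exists2 d : R, 0 < d & forall p q,
    `|p - w| < d -> `|q - w| < d -> `|f p - f q| <= L * `|p - q|.
Proof.
move=> sf; have [d d0 Hd] := strict_differentiability_coord sf ltr01.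
have [K K0 HK] := linear_rV_bound ('d f w).
exists (K + 1); split; first by rewrite addr_ge0.
exists d => // p q pd qd; have := Hd p q pd qd; have := HK (p - q).
have := ler_normD (f p - f q - 'd f w (p - q)) ('d f w (p - q)).
rewrite subrK; lra.
Qed.

Lemma smat_lipschitz n p q (f : 'rV[R]_n -> 'M[R]_(p, q)) w : smat f w ->
  exists L : R, 0 <= L /\ exists2 d : R, 0 < d & forall x y,
    `|x - w| < d -> `|y - w| < d -> `|f x - f y| <= L * `|x - y|.
Proof.
move=> /smat_mxP sf.
have H (ij : 'I_p * 'I_q) : exists Ld : R * R, [/\ 0 <= Ld.1, 0 < Ld.2 & forall x y,
    `|x - w| < Ld.2 -> `|y - w| < Ld.2 ->
    `|f x ij.1 ij.2 - f y ij.1 ij.2| <= Ld.1 * `|x - y|].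
  by have [L [L0 [d d0 Hd]]] := smat_lipschitzR (sf ij.1 ij.2); exists (L, d).
have [Ld HLd] := choice H.
exists (\sum_ij (Ld ij).1); split; first by apply: sumr_ge0 => ij _; case: (HLd ij).
exists (\big[Num.min/1]_ij (Ld ij).2).
  by apply/bigmin_gtP; split=> // ij _; case: (HLd ij).
move=> x y /bigmin_gtP[_ xd] /bigmin_gtP[_ yd].
have S0 : 0 <= \sum_ij (Ld ij).1 by apply: sumr_ge0 => ij _; case: (HLd ij).
apply: mx_norm_le => [|i j]; first by rewrite mulr_ge0.
have [_ _ Hij] := HLd (i, j).
rewrite !mxE; apply: le_trans (Hij x y (xd _ isT) (yd _ isT)) _.
rewrite ler_wpM2r // (bigD1 (i, j)) //= lerDl.
by apply: sumr_ge0 => ij _; case: (HLd ij).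
Qed.

Lemma perturbed_kernel_bound n N k (x g y : 'rV[R]_n) (P1 P2 : 'M[R]_(n, N))
    (P : 'M[R]_(n, k)) (Q : 'M[R]_(N + k, n)) :
  x = g - y -> x *m P = 0 -> y *m P1 = 0 -> g *m P2 = 0 ->
  `|1%:M - row_mx P2 P *m Q| < (2 * n.+1%:R)^-1 ->
  `|x| <= 2 * ((N + k)%:R * ((n%:R * (`|y| * `|P2 - P1|)) * `|Q|)).
Proof.
move=> dE xP yP gP QB; set A := row_mx P2 P in QB.
have n1 : 0 < n.+1%:R :> R by rewrite ltr0n.
have xA : x *m A = row_mx (- (y *m (P2 - P1))) 0.
  by rewrite mul_mx_row xP dE mulmxBl gP mulmxBr yP subr0 sub0r.
have xd : `|x *m A| <= n%:R * (`|y| * `|P2 - P1|).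
  rewrite xA; apply: (@le_trans _ _ `|y *m (P2 - P1)|); last exact: mulmx_norm.
  apply: mx_norm_le => // i j; case: (split_ordP j) => l ->.
    by rewrite row_mxEl mxE normrN entry_norm.
  by rewrite row_mxEr mxE normr0.
have x1 : `|x *m (1%:M - A *m Q)| <= 2^-1 * `|x|.
  apply: le_trans (mulmx_norm _ _) _.
  apply: (@le_trans _ _ (n.+1%:R * (`|x| * (2 * n.+1%:R)^-1))).
    by apply: ler_pM; rewrite ?ler_nat // ?mulr_ge0 // ler_wpM2l // ltW.
  suff -> : n.+1%:R * (`|x| * (2 * n.+1%:R)^-1) = 2^-1 * `|x| by [].
  by field; rewrite gt_eqF.
have x2 : `|x *m A *m Q| <= (N + k)%:R * ((n%:R * (`|y| * `|P2 - P1|)) * `|Q|).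
  by apply: le_trans (mulmx_norm _ _) _; rewrite ler_wpM2l // ler_wpM2r.
have := ler_normD (x *m (1%:M - A *m Q)) (x *m A *m Q).
by rewrite mulmxBr mulmx1 mulmxA subrK; move: x1 x2; rewrite mulmxBr mulmx1 mulmxA; lra.
Qed.

End MatrixNorm.

(* With [pi] a left inverse of the differential of [F2], the map [F2] is a
   graph over its projection [F2 *m pi]; both graphs solve the same linear
   differential system along lines. *)
Lemma local_uniqueness (R : realType) k1 k2 n N
    (F1 : 'rV[R]_k1 -> 'rV[R]_n) (F2 : 'rV[R]_k2 -> 'rV[R]_n)
    (Phi : 'rV[R]_n -> 'M[R]_(n, N)) (u1 : 'rV[R]_k1) (u2 : 'rV[R]_k2) :
  smat F1 u1 -> smat F2 u2 -> F1 u1 = F2 u2 -> smat Phi (F2 u2) ->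
  (\forall u \near u1, forall v, 'd F1 u v *m Phi (F1 u) = 0) ->
  (\forall u \near u2, forall v, 'd F2 u v *m Phi (F2 u) = 0) ->
  row_free ('J F2 u2) ->
  (forall x : 'rV[R]_n, x *m Phi (F2 u2) = 0 -> (x <= 'J F2 u2)%MS) ->
  exists phi : 'rV[R]_k1 -> 'rV[R]_k2,
    [/\ smat phi u1, phi u1 = u2 & \forall u \near u1, F2 (phi u) = F1 u].
Proof.
move=> sF1 sF2 F12 sPhi tan1 tan2 free2 ker2.
set w := F2 u2 in F12 sPhi ker2.
pose P := pinvmx ('J F2 u2).
have JP : 'J F2 u2 *m P = 1%:M by exact: mulmxVp.
pose h2 u := F2 u *m P; pose h1 u := F1 u *m P.
have sh2 : smat h2 u2 by exact: smat_mulmxr.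
have sh1 : smat h1 u1 by exact: smat_mulmxr.
have J2 : 'J h2 u2 = 1%:M.
  apply/row_matrixP => i; rewrite !rowE -jacobianE.
  apply: (etrans (diff_mulmxr P _ (smat_differentiable sF2))).
  by rewrite jacobianE -mulmxA JP.
have uJ2 : 'J h2 u2 \in unitmx by rewrite J2 unitmx1.
have [g2 [sg2 g2u hg2 _]] := inverse_function sh2 uJ2.
have h12 : h1 u1 = h2 u2 by rewrite /h1 F12.
have sg2' : smat g2 (h1 u1) by rewrite h12.
(* Chosen so that F2 (phi u) and F1 u have the same image under P near u1. *)
pose phi := g2 \o h1.
have sphi : smat phi u1 by exact: smat_comp.
have phi1 : phi u1 = u2 by rewrite /phi /= h12.
exists phi; split => //.
have sF2' : smat F2 (phi u1) by rewrite phi1.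
pose G := F2 \o phi.
have sG : smat G u1 by exact: smat_comp.
have Gw : G u1 = w by rewrite /G /= phi1.
pose del u := G u - F1 u.
have sdel : smat del u1 by exact: smat_sub.
have hg2' : \forall y \near h1 u1, h2 (g2 y) = y by rewrite h12.
have delP : \forall u \near u1, del u *m P = 0.
  have := near_comp (smat_continuous sh1) hg2'.
  by apply: near_impl => u e; rewrite mulmxBl -[G u *m P]/(h2 (phi u)) e subrr.
have ddelP : \forall u \near u1, forall v, 'd del u v *m P = 0.
  apply: near_impl2 (near_join delP) (smat_near sdel) => u dP sd v.
  apply: (etrans (esym (diff_mulmxr P v (smat_differentiable sd)))).
  apply: (etrans (diff_near v dP (smat_differentiable (smat_mulmxr P sd))
     (smat_differentiable (smat_cst 0 u)))).
  exact: (congr1 (fun g => g v) (diff_cst (0 : 'rV[R]_k2) u)).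
have tanG : \forall u \near u1, forall v, 'd G u v *m Phi (G u) = 0.
  have cphi := smat_continuous sphi.
  have tan2' : \forall u \near phi u1, forall v, 'd F2 u v *m Phi (F2 u) = 0 by rewrite phi1.
  apply: near_impl2 (near_and (smat_near sphi)
    (near_comp cphi (smat_near sF2'))) (near_comp cphi tan2') => u [sp sf] t2 v.
  have e := diff_compE v (smat_differentiable sp) (smat_differentiable sf).
  exact: (etrans (congr1 (fun t => t *m _) e) (t2 _)).
(* A vector killed by [Phi w] lies in the image of the differential of F2, where P is injective.
   Hence [A w] has a right inverse Q, and [A p *m Q] stays close to the identity for p near w. *)
pose A p : 'M[R]_(n, N + k2) := row_mx (Phi p) P.
have freeA : row_free (A w).
  rewrite -kermx_eq0; apply/rowV0P => x /sub_kermxP.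
  rewrite mul_mx_row => /eqP; rewrite row_mx_eq0 => /andP[/eqP xPhi /eqP xP].
  have /submxP[t xE] := ker2 _ xPhi.
  by move: xP; rewrite xE -mulmxA JP mulmx1 => ->; rewrite mul0mx.
pose Q := pinvmx (A w).
have AQ : A w *m Q = 1%:M by exact: mulmxVp.
have sA : smat A w.
  apply/smat_mxP => i j; case: (split_ordP j) => l ->.
    apply: (@smat_ext _ _ _ (fun p => Phi p i l)); last by move/smat_mxP: sPhi.
    by apply: near_impl (filterT : nbhs w setT) => p _; rewrite row_mxEl.
  apply: (@smat_ext _ _ _ (fun p => P i l)); last exact: smat_cst.
  by apply: near_impl (filterT : nbhs w setT) => p _; rewrite row_mxEr.
have sAQ : smat (fun p => A p *m Q) w by apply: smat_mulmx => //; exact: smat_cst.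
have n1 : 0 < n.+1%:R :> R by rewrite ltr0n.
have e0 : 0 < (2 * n.+1%:R)^-1 :> R by rewrite invr_gt0 mulr_gt0.
have nB : \forall p \near w, `|1%:M - A p *m Q| < (2 * n.+1%:R)^-1.
  by move/cvgrPdist_lt: (smat_continuous sAQ) => /(_ _ e0); rewrite AQ.
have [L [L0 [d d0 HL]]] := smat_lipschitz sPhi.
have nG : \forall u \near u1, `|G u - w| < d /\ `|1%:M - A (G u) *m Q| < (2 * n.+1%:R)^-1.
  have nw : \forall p \near w, `|p - w| < d by apply/near_normP; exists d.
  have nw2 : \forall p \near G u1, `|p - w| < d /\ `|1%:M - A p *m Q| < (2 * n.+1%:R)^-1.
    by rewrite Gw; exact: near_and nw nB.
  exact: near_comp (smat_continuous sG) nw2.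
have nF : \forall u \near u1, `|F1 u - w| < d.
  have nw : \forall p \near F1 u1, `|p - w| < d by rewrite F12; apply/near_normP; exists d.
  exact: near_comp (smat_continuous sF1) nw.
have sJ := smat_jacobian sF1.
have nJ : \forall u \near u1, `|'J F1 u| < `|'J F1 u1| + 1.
  apply: near_impl (near_dist (smat_continuous sJ) ltr01) => u.
  exact: norm_lt_of_dist.
(* The bound of [perturbed_kernel_bound], with the Jacobian of F1 bounded near u1 by its norm at u1
   plus one, and L a Lipschitz constant of Phi; the integer factors come from matrix products in the
   maximum norm. *)
pose K := 2 * ((N + k2)%:R * ((n%:R * ((k1%:R * (`|'J F1 u1| + 1)) * L)) * `|Q|)).
have K0 : 0 <= K by rewrite !mulr_ge0 // addr_ge0.
have bound : \forall u \near u1, differentiable del u /\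
    forall v, `|'d del u v| <= K * `|v| * `|del u|.
  have c1 := near_and tan1 tanG.
  have c2 := near_and nG nF.
  have c3 := near_and nJ ddelP.
  have c4 := near_and (smat_near sF1) (smat_near sG).
  have c5 := near_and c1 c2.
  have c6 := near_and c3 c4.
  apply: near_impl2 c5 c6 => u [[t1 tG] [[Gd GB] Fd]] [[Jd dP] [sf sg]].
  have sd : smat del u by exact: smat_sub.
  split=> [|v]; first exact: smat_differentiable.
  have dE : 'd del u v = 'd G u v - 'd F1 u v.
    exact: (congr1 (fun g => g v) (diffB (smat_differentiable sg) (smat_differentiable sf))).
  have := perturbed_kernel_bound dE (dP v) (t1 v) (tG v) GB.
  move=> /le_trans; apply.
  have yd : `|'d F1 u v| <= k1%:R * (`|'J F1 u1| + 1) * `|v|.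
    rewrite jacobianE; apply: le_trans (mulmx_norm _ _) _.
    rewrite -mulrA ler_wpM2l // mulrC ler_wpM2r //; exact: ltW.
  have Phid : `|Phi (G u) - Phi (F1 u)| <= L * `|del u| by exact: HL.
  have -> : K * `|v| * `|del u| = 2 * ((N + k2)%:R *
     ((n%:R * ((k1%:R * (`|'J F1 u1| + 1) * `|v|) * (L * `|del u|))) * `|Q|)).
    by rewrite /K; ring.
  rewrite ler_wpM2l // ler_wpM2l // ler_wpM2r // ler_wpM2l //.
  exact: ler_pM.
have [d1 d10 Hd1] := (near_normP _ _).1 bound.
apply/near_normP; exists d1 => // u ud.
have : del (u1 + (u - u1)) = 0.
  apply: (@gronwall_line _ _ _ del u1 (u - u1) (K * `|u - u1|)).
  - by rewrite mulr_ge0.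
  - move=> t /andP[t0 t1].
    have [dd bd] : differentiable del (u1 + t *: (u - u1)) /\
        forall v, `|'d del (u1 + t *: (u - u1)) v| <= K * `|v| * `|del (u1 + t *: (u - u1))|.
      apply: Hd1; rewrite [u1 + _]addrC addrK normrZ (ger0_norm t0).
      by apply: le_lt_trans ud; rewrite ler_piMl.
    by split.
  - by rewrite /del Gw F12 subrr.
rewrite addrC subrK /del => /eqP; rewrite subr_eq0 => /eqP.
by [].
Qed.

Section IntegralMaps.
Context {R : realType} {n : nat} {M : manifold R n}.
Implicit Types (C D : tangent_distribution M).

Local Notation kap q := (chart_map (chart_at q)).
Local Notation iot q := (chart_inv (chart_at q)).
Local Notation dom q := (chart_dom (chart_at q)).

Definition integral_map D k (N : manifold R k) (i : N -> M) : Prop :=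
  [/\ smooth_map i, injective i, immersion i &
      forall q, limg (tangent_map i q) = D (i q)].

Lemma param_chart_inv (q x : M) : dom q x -> param (iot q) (kap q x).
Proof.
move=> Dx; split; first exact: smap_chart_inv.
have nT : \forall y \near x, setT y by exact: filterT.
apply: near_impl (near_chart_points Dx nT) => _ [y [-> Dy _]] t.
exists (coord_change y q y t); rewrite dmap_chart_inv //.
by apply: coord_changeK => //; exact: chart_at_dom.
Qed.

Lemma tangent_mapE k (N : manifold R k) (i : N -> M) s v :
  tangent_map i s v = 'd (kap (i s) \o (i \o iot s)) (kap s s) v.
Proof. by rewrite /tangent_map lfunE. Qed.

Lemma integral_map_tangent C k (N : manifold R k) (i : N -> M) (s : N) (y : M)
    N' (Phi : 'rV[R]_n -> 'M[R]_(n, N')) :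
  integral_map (char_dist C) i -> i s = y ->
  (\forall z \near kap y y, forall v,
      v *m Phi z = 0 <-> dmap (iot y) z v \in char_dist C (iot y z)) ->
  smat (kap y \o (i \o iot s)) (kap s s) /\
  \forall u \near kap s s, forall v,
    'd (kap y \o (i \o iot s)) u v *m Phi ((kap y \o (i \o iot s)) u) = 0.
Proof.
move=> [si _ _ ti] isy PhiP; have Ds := chart_at_dom s.
have sio := smap_chart_inv Ds.
have sf := smap_smooth_map si sio.
have fs : (i \o iot s) (kap s s) = y by rewrite /= chart_mapE.
have Dy : dom y ((i \o iot s) (kap s s)) by rewrite fs; exact: chart_at_dom.
have sF := smap_chart sf Dy; split => //.
have Fs : (kap y \o (i \o iot s)) (kap s s) = kap y y by rewrite /= chart_mapE // isy.
rewrite -Fs in PhiP.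
have n1 := near_comp (smat_continuous sF) PhiP.
have n2 := near_comp (smap_continuous sf) (near_chart_dom Dy).
have n3 := near_and n1 n2.
apply: near_impl2 n3 (near_and (smap_near sf) (smap_near sio)).
move=> u [Pu Du] [sfu siu] v.
apply/Pu.
have e1 := dmap_chart v sfu Du.
have e2 := dmap_smooth_map v si siu.
have mem : dmap (i \o iot s) u v \in char_dist C ((i \o iot s) u).
  by rewrite e2 -ti memv_img // memvf.
apply/(eq_iff (mem_dmap_chart _ ('d (kap y \o (i \o iot s)) u v) Du)).
exact: (eq_ind _ (fun t => is_true (t \in char_dist C ((i \o iot s) u))) mem _ e1).
Qed.

(** [local_uniqueness] in the chart at the common point, with the equations of [char_matrix]. The
    map phi expresses one integral submanifold in the coordinates of the other; such maps become the
    transition maps when the two are glued. *)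
Lemma integral_maps_local_factor C k1 k2 (N1 : manifold R k1) (N2 : manifold R k2)
    (i1 : N1 -> M) (i2 : N2 -> M) (s1 : N1) (s2 : N2) :
  hyperplane_field C ->
  integral_map (char_dist C) i1 -> integral_map (char_dist C) i2 ->
  i1 s1 = i2 s2 ->
  exists phi : 'rV[R]_k1 -> 'rV[R]_k2,
    [/\ smat phi (kap s1 s1), phi (kap s1 s1) = kap s2 s2 &
        \forall u \near kap s1 s1, i2 (iot s2 (phi u)) = i1 (iot s1 u)].
Proof.
move=> hC I1 I2 i12; set y := i2 s2 in i12 *.
have Dy := chart_at_dom y; have D1 := chart_at_dom s1; have D2 := chart_at_dom s2.
have [N' [Phi [sPhi PhiP]]] := char_matrix hC (param_chart_inv Dy).
have [sF1 t1] := integral_map_tangent I1 i12 PhiP.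
have [sF2 t2] := integral_map_tangent I2 (erefl y) PhiP.
have [si1 _ _ _] := I1; have [si2 _ im2 ti2] := I2.
have E1 : (kap y \o (i1 \o iot s1)) (kap s1 s1) = kap y y.
  by rewrite /= chart_mapE // i12.
have E2 : (kap y \o (i2 \o iot s2)) (kap s2 s2) = kap y y by rewrite /= chart_mapE.
have dF2 v : 'd (kap y \o (i2 \o iot s2)) (kap s2 s2) v = tangent_map i2 s2 v.
  by rewrite tangent_mapE.
have free2 : row_free ('J (kap y \o (i2 \o iot s2)) (kap s2 s2)).
  rewrite -kermx_eq0; apply/rowV0P => x /sub_kermxP.
  rewrite -jacobianE dF2 => x0.
  have : x \in lker (tangent_map i2 s2) by rewrite memv_ker x0.
  by rewrite im2 memv0 => /eqP.
have ker2 (x : 'rV[R]_n) : x *m Phi ((kap y \o (i2 \o iot s2)) (kap s2 s2)) = 0 ->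
    (x <= 'J (kap y \o (i2 \o iot s2)) (kap s2 s2))%MS.
  have pP := nbhs_singleton PhiP; rewrite E2 => /pP.
  rewrite mem_dmap_chart // coord_change_id // -ti2 => /memv_imgP[t _ ->].
  by rewrite -dF2 jacobianE submxMl.
have sPhi' : smat Phi ((kap y \o (i2 \o iot s2)) (kap s2 s2)) by rewrite E2.
have [phi [sphi phi1 phiP]] :=
  local_uniqueness sF1 sF2 (etrans E1 (esym E2)) sPhi' t1 t2 free2 ker2.
exists phi; split => //.
have f1y : i1 (iot s1 (kap s1 s1)) = y by rewrite chart_mapE.
have c1 : {for kap s1 s1, continuous (i1 \o iot s1)}.
  exact: smap_continuous (smap_smooth_map si1 (smap_chart_inv D1)).
have c2 : {for kap s1 s1, continuous ((i2 \o iot s2) \o phi)}.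
  apply: continuous_comp; first exact: smat_continuous.
  rewrite phi1; exact: smap_continuous (smap_smooth_map si2 (smap_chart_inv D2)).
have nD1 : \forall u \near kap s1 s1, dom y (i1 (iot s1 u)).
  apply: (near_comp c1); apply: near_chart_dom; rewrite /= f1y //.
have nD2 : \forall u \near kap s1 s1, dom y (i2 (iot s2 (phi u))).
  by apply: (near_comp c2); apply: near_chart_dom; rewrite /= phi1 chart_mapE.
apply: near_impl2 phiP (near_and nD1 nD2) => u e [d1 d2].
by rewrite -(chart_mapE d1) -(chart_mapE d2); congr (iot y _).
Qed.

End IntegralMaps.

(** * Gluing two injectively mapped manifolds along their common points *)

Section Gluing.
Context {R : realType} {k n : nat} {M : manifold R n}.
Context (N : bool -> manifold R k) (i : forall b, N b -> M).
Arguments i : clear implicits.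

Local Notation kap q := (chart_map (chart_at q)).
Local Notation iot q := (chart_inv (chart_at q)).
Local Notation dom q := (chart_dom (chart_at q)).

Definition glued_set : set M := [set y | exists b s, i b s = y].
(** Realized as a subset of M: points of the two pieces are identified exactly when they have the
    same image, and the map to M is injective by construction. *)
Definition glued : Type := set_type glued_set.

Definition glue_map b (s : N b) : glued :=
  @exist _ _ (i b s) (mem_set (ex_intro _ b (ex_intro _ s erefl))).
Arguments glue_map : clear implicits.

Definition glue_val (x : glued) : M := val x.

(** The final topology for the two maps. It contains the topology induced from M and may be strictly
    finer, as the pieces need not be embedded. *)
Definition glue_open : set_system glued := [set A | forall b, open (glue_map b @^-1` A)].

Lemma glue_openT : glue_open setT.
Proof. by move=> b; rewrite preimage_setT; exact: openT. Qed.

Lemma glue_openI : setI_closed glue_open.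
Proof. by move=> A B oA oB b; rewrite preimage_setI; exact: openI. Qed.

Lemma glue_open_bigU (I : Type) (f : I -> set glued) :
  (forall j, glue_open (f j)) -> glue_open (\bigcup_j f j).
Proof.
by move=> of_ b; rewrite preimage_bigcup; apply: bigcup_open => j _; exact: of_.
Qed.

HB.instance Definition _ := Choice.on glued.
HB.instance Definition _ :=
  isOpenTopological.Build glued glue_openT glue_openI glue_open_bigU.

Context (i_cont : forall b, continuous (i b)).
Context (i_inj : forall b, injective (i b)).
Context (i_factor : forall b c (s : N b) (t : N c), i b s = i c t ->
  exists phi : 'rV[R]_k -> 'rV[R]_k,
    [/\ smat phi (kap s s), phi (kap s s) = kap t t &
        \forall u \near kap s s, i c (iot t (phi u)) = i b (iot s u)]).

Lemma glue_map_val b (s : N b) : glue_val (glue_map b s) = i b s.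
Proof. by []. Qed.

Lemma glue_val_inj : injective glue_val.
Proof. exact: val_inj. Qed.

Lemma glue_mapP x : exists b s, glue_map b s = x.
Proof.
case: x => y /[dup] /set_mem[b [s e]] yM; exists b, s.
by apply: val_inj.
Qed.

Lemma glue_map_inj b : injective (glue_map b).
Proof. by move=> s t /(congr1 glue_val)/i_inj. Qed.

Lemma glue_map_continuous b : continuous (glue_map b).
Proof. by apply/continuousP => A; exact. Qed.

Lemma glue_local_section b c (s : N b) (t : N c) : i b s = i c t ->
  exists g : N b -> N c, [/\ {for s, continuous g}, g s = t &
    \forall s' \near s, glue_map c (g s') = glue_map b s'].
Proof.
move=> e; have [phi [sphi phi1 phiP]] := i_factor e.
have Ds := chart_at_dom s; have Dt := chart_at_dom t.
have ck : {for s, continuous (kap s)} by exact: chart_map_continuous.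
exists (fun s' => iot t (phi (kap s s'))); split.
- apply: (@continuous_comp _ _ _ (phi \o kap s) (iot t)).
    apply: continuous_comp => //; exact: smat_continuous.
  by rewrite /= phi1; exact: chart_inv_continuous.
- by rewrite phi1 chart_mapE.
- apply: near_impl2 (near_comp ck phiP) (near_chart_dom Ds) => s' e' Ds'.
  by apply: glue_val_inj; rewrite !glue_map_val e' chart_mapE.
Qed.

(** Near a point t of another piece whose image comes from O, the local section g maps t'
    continuously to a point of O with the same image. The pieces therefore overlap in open sets, and
    their charts serve as charts of the union. *)
Lemma glue_map_open b (O : set (N b)) : open O -> open (glue_map b @` O).
Proof.
move=> oO; suff : glue_open (glue_map b @` O) by [].
move=> c; rewrite openE => t [s Os st].
have e : i c t = i b s by have /(congr1 glue_val) := st.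
have [g [cg gt gP]] := glue_local_section e.
have nO : \forall s' \near g t, O s' by rewrite gt; exact: open_nbhs_nbhs.
have n1 : \forall t' \near t, (glue_map b @` O) (glue_map c t').
  by apply: near_impl2 (near_comp cg nO) gP => t' Ot' <-; exists (g t').
exact: n1.
Qed.

Lemma near_glued b (s : N b) (P : glued -> Prop) :
  (\forall x \near glue_map b s, P x) <-> (\forall s' \near s, P (glue_map b s')).
Proof.
split=> [|/near_open[U [oU Us UP]]].
  by apply: near_comp; exact: glue_map_continuous.
have oV := glue_map_open oU.
have : \forall x \near glue_map b s, (glue_map b @` U) x.
  by apply: open_nbhs_nbhs; split => //; exists s.
by apply: near_impl => _ [s' Us' <-]; exact: UP.
Qed.

(** A left inverse of [glue_map b]; [s0] is a default for points outside its range. *)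
Definition glue_inv b (s0 : N b) (x : glued) : N b := xget s0 [set s | glue_map b s = x].

Arguments glue_inv : clear implicits.

Lemma glue_mapK b (s0 s : N b) : glue_inv b s0 (glue_map b s) = s.
Proof.
have : [set s' | glue_map b s' = glue_map b s] s by [].
by move=> /(xgetI s0)/glue_map_inj.
Qed.

Lemma glue_chart_dom_image b (s : N b) (A : set (N b)) :
  (fun x => kap s (glue_inv b s x)) @` (glue_map b @` A) = kap s @` A.
Proof.
apply/seteqP; split=> [_ [_ [t At <-] <-]|_ [t At <-]].
  by rewrite glue_mapK; exists t.
by exists (glue_map b t); [exists t|rewrite glue_mapK].
Qed.

Fact glue_chart_dom_open b (s : N b) : open (glue_map b @` dom s).
Proof. exact/glue_map_open/chart_dom_open. Qed.

Fact glue_chart_cod_open b (s : N b) :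
  open ((fun x => kap s (glue_inv b s x)) @` (glue_map b @` dom s)).
Proof. by rewrite glue_chart_dom_image; exact: chart_cod_open. Qed.

Fact glue_chart_mapK b (s : N b) x : (glue_map b @` dom s) x ->
  glue_map b (iot s (kap s (glue_inv b s x))) = x.
Proof. by move=> [t Dt <-]; rewrite glue_mapK chart_mapE. Qed.

Fact glue_chart_map_continuous b (s : N b) x : (glue_map b @` dom s) x ->
  {for x, continuous (fun x => kap s (glue_inv b s x))}.
Proof.
move=> [t Dt <-] P; rewrite glue_mapK => nP.
apply/(near_glued t (fun x => P (kap s (glue_inv b s x)))).
have := near_comp (chart_map_continuous Dt) nP.
by apply: near_impl => t'; rewrite glue_mapK.
Qed.

Fact glue_chart_inv_continuous b (s : N b) x : (glue_map b @` dom s) x ->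
  {for kap s (glue_inv b s x), continuous (fun u => glue_map b (iot s u))}.
Proof.
move=> [t Dt <-]; rewrite glue_mapK.
apply: (@continuous_comp _ _ _ (iot s) (glue_map b)); first exact: chart_inv_continuous.
exact: glue_map_continuous.
Qed.

Definition glue_chart b (s : N b) : chart R k glued :=
  Chart (@glue_chart_dom_open b s) (@glue_chart_cod_open b s)
    (@glue_chart_mapK b s) (@glue_chart_map_continuous b s)
    (@glue_chart_inv_continuous b s).

Arguments glue_chart : clear implicits.

(** A manifold comes with one chart per point: a piece and a preimage in it are chosen for each
    point, whose chart is then used. *)
Definition glue_index (x : glued) : {b : bool & N b} :=
  let (b, H) := cid (glue_mapP x) in existT _ b (projT1 (cid H)).

Lemma glue_indexP x : glue_map (projT1 (glue_index x)) (projT2 (glue_index x)) = x.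
Proof.
rewrite /glue_index; case: (cid (glue_mapP x)) => b H /=.
exact: (projT2 (cid H)).
Qed.

Definition glue_chart_at x := glue_chart (projT1 (glue_index x)) (projT2 (glue_index x)).

Lemma glue_chart_at_dom x : chart_dom (glue_chart_at x) x.
Proof.
rewrite -{2}(glue_indexP x) /glue_chart_at.
by exists (projT2 (glue_index x)) => //; exact: chart_at_dom.
Qed.

(** Near a common point of the two chart domains the transition is the map phi of [i_factor],
    preceded and followed by transitions inside each piece. *)
Lemma glue_charts_compatible b c (s : N b) (t : N c) :
  smooth_on (chart_map (glue_chart b s) @`
      (chart_dom (glue_chart b s) `&` chart_dom (glue_chart c t)))
    (chart_map (glue_chart c t) \o chart_inv (glue_chart b s)).
Proof.
apply/smat_on.
  have -> : chart_dom (glue_chart b s) `&` chart_dom (glue_chart c t) =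
      glue_map b @` (glue_map b @^-1` (glue_map c @` dom t) `&` dom s).
    apply/seteqP; split=> [x [[s' Ds' <-] Dt]|_ [s' [Dt Ds'] <-]]; first by exists s'.
    by split=> //; exists s'.
  rewrite glue_chart_dom_image; apply: chart_image_open.
  exact: (glue_map_open (chart_dom_open _) b).
move=> _ [_ [[s' Ds' <-] [t' Dt' ts]] <-] /=.
rewrite glue_mapK.
have e : i b s' = i c t' by have /(congr1 glue_val) := ts.
have [phi [sphi phi1 phiP]] := i_factor e.
have D1 := chart_at_dom s'; have D2 := chart_at_dom t'.
have st1 := smat_transition Ds' D1; have st2 := smat_transition D2 Dt'.
have E1 : (kap s' \o iot s) (kap s s') = kap s' s' by rewrite /= chart_mapE.
have E2 : (phi \o (kap s' \o iot s)) (kap s s') = kap t' t' by rewrite /= chart_mapE.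
have sphi' : smat phi ((kap s' \o iot s) (kap s s')) by rewrite E1.
have sc := smat_comp st1 sphi'.
have st2' : smat (kap t \o iot t') ((phi \o (kap s' \o iot s)) (kap s s')) by rewrite E2.
apply: smat_ext (smat_comp sc st2').
have phiP' : \forall u \near (kap s' \o iot s) (kap s s'),
    i c (iot t' (phi u)) = i b (iot s' u) by rewrite E1.
have n1 := near_comp (smat_continuous st1) phiP'.
have nD : \forall z \near s', dom s' z by exact: near_chart_dom.
apply: near_impl2 n1 (near_chart_points Ds' nD) => u e' [z [uE Dz Dz']].
rewrite /=; rewrite uE /= chart_mapE // in e' *.
have e2 : i c (iot t' (phi (kap s' z))) = i b z by rewrite e' chart_mapE.
have -> : glue_map b z = glue_map c (iot t' (phi (kap s' z))).
  by apply: glue_val_inj; rewrite !glue_map_val e2.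
by rewrite glue_mapK.
Qed.

Lemma glue_val_continuous : continuous glue_val.
Proof.
move=> x; have [b [s <-]] := glue_mapP x => P; rewrite glue_map_val => nP.
apply/(near_glued s (fun y => P (glue_val y))).
exact: (@near_comp _ _ (i b) s P (@i_cont b s) nP).
Qed.

(** Inherited from M through the continuous injection [glue_val]. *)
Lemma glue_hausdorff : hausdorff_space glued.
Proof.
move=> x y xy; apply: glue_val_inj; apply: (@manifold_hausdorff _ _ M).
move=> A B nA nB.
have [z [Az Bz]] := xy _ _ (glue_val_continuous nA) (glue_val_continuous nB).
by exists (glue_val z).
Qed.

Lemma glue_second_countable : @second_countable glued.
Proof.
pose Bs b := projT1 (cid2 (manifold_second_countable (N b))).
have BsP b : countable (Bs b) /\ basis (Bs b).
  by rewrite /Bs; case: (cid2 _).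
exists (\bigcup_(b in [set: bool]) ((fun W : set (N b) => glue_map b @` W) @` Bs b)).
  apply: bigcup_countable => [|b _]; first exact: countableP.
  apply: (sub_countable (card_image_le _ _)); exact: (BsP b).1.
split=> [_ [b _ [W BW <-]]|x].
  by apply: glue_map_open; apply: (BsP b).2.1.
have [b [s <-]] := glue_mapP x => A nA.
have {}nA : \forall s' \near s, A (glue_map b s') by exact/near_glued.
have [U [BU Us] UA] := (BsP b).2.2 s _ nA.
exists (glue_map b @` U); first by split; [exists b => //; exists U|exists s].
by move=> _ [s' Us' <-]; exact: UA.
Qed.

Lemma glue_nonempty : [set: glued] !=set0.
Proof.
have [s _] := manifold_nonempty (N true).
by exists (glue_map true s).
Qed.

Definition glued_manifold : manifold R k :=
  @Manifold R k glued glue_chart_at glue_chart_at_dom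
    (fun x y => glue_charts_compatible _ _)
    glue_nonempty glue_hausdorff glue_second_countable.

Lemma glue_val_smooth : (forall b, smooth_map (i b)) ->
  smooth_map (glue_val : glued_manifold -> M).
Proof.
move=> si; split; first exact: glue_val_continuous.
move=> x q /=; set b := projT1 (glue_index x); set s := projT2 (glue_index x).
have dE : chart_dom (glue_chart b s) `&` glue_val @^-1` dom q =
    glue_map b @` (i b @^-1` dom q `&` dom s).
  apply/seteqP; split=> [_ [[t Dt <-] Dq]|_ [t [Dq Dt] <-]]; first by exists t.
  by split => //; exists t.
have oD : open (i b @^-1` dom q).
  by apply: open_comp => [t _|]; [exact: i_cont|exact: chart_dom_open].
rewrite dE glue_chart_dom_image; apply/smat_on; first exact: chart_image_open.
move=> _ [t [Dq Dt] <-].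
exact: (smooth_map_smat (si b) Dt Dq).
Qed.

(** The chart at x is that of the chosen preimage s, so both tangent maps have literally the same
    coordinate expression. Immersivity and tangency to the distribution thus carry over from the
    pieces. *)
Lemma glue_tangent_map (x : glued_manifold) :
  let b := projT1 (glue_index x) in let s := projT2 (glue_index x) in
  glue_val x = i b s /\
  tangent_map (glue_val : glued_manifold -> M) x = tangent_map (i b) s.
Proof.
have key b (s z : N b) y : y = i b s -> z = s ->
    linfun ('d (kap y \o i b \o iot s) (kap s z)) = tangent_map (i b) s.
  by move=> -> ->.
move=> b s; have xE : glue_map b s = x by exact: glue_indexP.
have vE : glue_val x = i b s by rewrite -xE.
split; first exact: vE.
apply: (key b s (glue_inv b s x) (glue_val x)) vE _.
exact: (etrans (congr1 (glue_inv b s) (esym xE)) (glue_mapK s s)).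
Qed.

Lemma glue_connected : (forall b, connected [set: N b]) ->
  (exists s t, i true s = i false t) -> connected [set: glued_manifold].
Proof.
move=> cN [s [t st]].
have -> : [set: glued_manifold] = glue_map true @` setT `|` glue_map false @` setT.
  apply/seteqP; split=> // x _; have [[] [s' <-]] := glue_mapP x.
    by left; exists s'.
  by right; exists s'.
apply: connectedU.
- exists (glue_map true s); split; first by exists s.
  by exists t => //; apply: glue_val_inj; rewrite !glue_map_val.
- apply: connected_continuous_connected => //.
  exact/continuous_subspaceT/glue_map_continuous.
- apply: connected_continuous_connected => //.
  exact/continuous_subspaceT/glue_map_continuous.
Qed.

End Gluing.

(** * Leaves through a common point *)

Section Leaves.
Context {R : realType} {n : nat} {M : manifold R n}.
Implicit Types (C D : tangent_distribution M).

Lemma integral_map_dim D k (N : manifold R k) (i : N -> M) s :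
  integral_map D i -> \dim (D (i s)) = k.
Proof.
move=> [_ _ im ti]; rewrite -ti.
have := limg_ker_dim (tangent_map i s) fullv.
by rewrite capfv im dimv0 add0n dimvf /dim /= mul1n.
Qed.

(** Gluing requires equal dimensions: both are the dimension of the characteristic distribution at
    the common point. The common point also makes the union connected. *)
Lemma integral_union C k1 k2 (N1 : manifold R k1) (N2 : manifold R k2)
    (i1 : N1 -> M) (i2 : N2 -> M) (s1 : N1) (s2 : N2) :
  hyperplane_field C ->
  integral_map (char_dist C) i1 -> integral_map (char_dist C) i2 ->
  connected [set: N1] -> connected [set: N2] -> i1 s1 = i2 s2 ->
  connected_integral_submanifold (char_dist C) (range i1 `|` range i2).
Proof.
move=> hC I1 I2 c1 c2 e12.
have k12 : k1 = k2.
  by rewrite -(integral_map_dim s1 I1) e12 (integral_map_dim s2 I2).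
subst k2.
pose N b := if b is true then N1 else N2.
pose i b : N b -> M := match b with true => i1 | false => i2 end.
have Ib b : integral_map (char_dist C) (@i b) by case: b.
have icont b : continuous (@i b) by have [[]] := Ib b.
have iinj b : injective (@i b) by have [] := Ib b.
have ifac b c (s : N b) (t : N c) : i b s = i c t ->
  exists phi : 'rV[R]_k1 -> 'rV[R]_k1,
    [/\ smat phi (chart_map (chart_at s) s),
        phi (chart_map (chart_at s) s) = chart_map (chart_at t) t &
        \forall u \near chart_map (chart_at s) s,
          i c (chart_inv (chart_at t) (phi u)) = i b (chart_inv (chart_at s) u)].
  exact: integral_maps_local_factor hC (Ib b) (Ib c).
pose G := glued_manifold icont iinj ifac.
have tg (x : G) := glue_tangent_map x.
exists k1, G, (@glue_val _ _ _ _ N i); split.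
- apply: glue_connected; first by case.
  by exists s1, s2.
- split; [|exact: glue_val_inj|].
    by apply: glue_val_smooth => b; have [] := Ib b.
  move=> x; rewrite (tg x).2.
  by have [_ _ im _] := Ib (projT1 (glue_index x)).
- apply/seteqP; split=> [y [x _ <-]|y].
    have [[] [s <-]] := glue_mapP x; first by left; exists s.
    by right; exists s.
  case=> [[s _ <-]|[s _ <-]].
    by exists (@glue_map _ _ _ _ N i true s).
  by exists (@glue_map _ _ _ _ N i false s).
- move=> x; rewrite (tg x).2 (tg x).1.
  by have [_ _ _ ti] := Ib (projT1 (glue_index x)).
Qed.

Lemma integral_submanifoldP D L : connected_integral_submanifold D L <->
  exists k (N : manifold R k) (i : N -> M),
    [/\ connected [set: N], integral_map D i & range i = L].
Proof.
split=> [[k [N [i [cN [si ii im] rL ti]]]]|[k [N [i [cN [si ii im ti] rL]]]]].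
  by exists k, N, i.
by exists k, N, i.
Qed.

Lemma leaves_eq C L1 L2 y : hyperplane_field C ->
  leaf (char_dist C) L1 -> leaf (char_dist C) L2 -> L1 y -> L2 y -> L1 = L2.
Proof.
move=> hC [/integral_submanifoldP[k1 [N1 [i1 [c1 I1 <-]]]] max1].
move=> [/integral_submanifoldP[k2 [N2 [i2 [c2 I2 <-]]]] max2].
move=> [s1 _ s1y] [s2 _ s2y]; have e : i1 s1 = i2 s2 by rewrite s1y s2y.
have U := integral_union hC I1 I2 c1 c2 e.
rewrite -(max1 _ U); last by move=> z; left.
by apply: (max2 _ U) => z; right.
Qed.

End Leaves.

(** * The fibres of the projection *)

Section Fibres.
Context {R : realType}.

Lemma diff_add n (V : normedModType R) (f g : 'rV[R]_n -> V) u v :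
  differentiable f u -> differentiable g u ->
  'd (fun x => f x + g x) u v = 'd f u v + 'd g u v.
Proof. by move=> df dg; have /(congr1 (fun h => h v)) := diffD df dg. Qed.

Lemma diff_idE n (u v : 'rV[R]_n) : 'd (id : 'rV[R]_n -> 'rV[R]_n) u v = v.
Proof. by rewrite (linear_rV_diff idfun). Qed.

Lemma diff_mulmx m p (L : 'M[R]_(m, p)) u v :
  'd (fun z : 'rV[R]_m => z *m L) u v = v *m L.
Proof.
have di : differentiable (id : 'rV[R]_m -> 'rV[R]_m) u.
  exact: smat_differentiable (smat_id _).
by apply: etrans (diff_mulmxr L v di) (congr1 (mulmxr L) _); exact: diff_idE.
Qed.

Lemma diff_affine m p (c : 'rV[R]_p) (L : 'M[R]_(m, p)) u v :
  'd (fun z : 'rV[R]_m => c + z *m L) u v = v *m L.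
Proof.
have d1 : differentiable (fun z : 'rV[R]_m => z *m L) u.
  exact: smat_differentiable (smat_mulmxr L (smat_id _)).
have d2 : differentiable (fun _ : 'rV[R]_m => c) u by exact: differentiable_cst.
apply: etrans (diff_add v d2 d1) _.
apply: etrans (congr2 +%R (congr1 (fun h => h v) (diff_cst _ _)) (diff_mulmx L u v)) _.
exact: add0r.
Qed.

Lemma smat_affine m p (c : 'rV[R]_p) (L : 'M[R]_(m, p)) u :
  smat (fun z : 'rV[R]_m => c + z *m L) u.
Proof. by apply: smat_add; [exact: smat_cst|exact: smat_mulmxr (smat_id _)]. Qed.

Lemma diff_right_inverse n m (h : 'rV[R]_m -> 'rV[R]_n) (g : 'rV[R]_n -> 'rV[R]_m) z v :
  smat g z -> smat h (g z) -> (\forall y \near z, h (g y) = y) ->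
  'd h (g z) ('d g z v) = v.
Proof.
move=> sg sh hg.
apply: etrans (esym (diff_compE v (smat_differentiable sg) (smat_differentiable sh))) _.
apply: etrans (diff_idE z v).
exact: (diff_near v hg (smat_differentiable (smat_comp sg sh))
  (smat_differentiable (smat_id _))).
Qed.

Lemma surjective_mx_section m p (L : 'M[R]_(m, p)) :
  (forall w : 'rV[R]_p, exists v, v *m L = w) -> exists B, B *m L = 1%:M.
Proof.
move=> H; have [b bP] := choice (fun j => H (delta_mx 0 j)).
exists (\matrix_j b j); apply/row_matrixP => j.
by rewrite row_mul rowK bP rowE mulmx1.
Qed.

(** * Submersions in straightened coordinates *)

Section Submersions.
Context {n n0 : nat} {M : manifold R n} {M0 : manifold R n0}.

Local Notation kap q := (chart_map (chart_at q)).
Local Notation iot q := (chart_inv (chart_at q)).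
Local Notation dom q := (chart_dom (chart_at q)).

(* In the parametrization [psi] of [M], centred at [y], the map [f] is the
   restriction of the linear map [L]; [theta] inverts [psi], and [B] is a
   section of [L]. *)
Definition straightens (f : M -> M0) (y : M) (psi : 'rV[R]_n -> M)
    (theta : M -> 'rV[R]_n) (L : 'M[R]_(n, n0)) (B : 'M[R]_(n0, n)) :=
  [/\ B *m L = 1%:M, param psi 0,
      psi 0 = y /\ (forall v, dmap psi 0 v = v),
      [/\ {for y, continuous theta}, theta y = 0 &
          \forall y' \near y, psi (theta y') = y'] &
      \forall z \near (0 : 'rV[R]_n), dom (f y) (f (psi z)) /\
        kap (f y) (f (psi z)) = kap (f y) (f y) + z *m L].

Lemma submersion_straightens (f : M -> M0) y : smooth_map f ->
  limg (tangent_map f y) = fullv ->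
  exists psi theta L B, straightens f y psi theta L B.
Proof.
move=> sf Tf; set x := f y; have Dy := chart_at_dom y; have Dx := chart_at_dom x.
set u := kap y y; pose P := kap x \o f \o iot y.
have sP : smat P u by exact: smooth_map_smat.
have dP := smat_differentiable sP.
pose L := 'J P u.
have TL v : tangent_map f y v = v *m L by rewrite /tangent_map lfunE jacobianE.
have [B BL] : exists B, B *m L = 1%:M.
  apply: surjective_mx_section => w.
  have : w \in limg (tangent_map f y) by rewrite Tf memvf.
  by case/memv_imgP => v _ ->; exists v; rewrite TL.
have Pu : P u = kap x x by rewrite /P /= chart_mapE.
(* K projects onto the kernel of L. In h, the K-part carries the coordinates along the fibre and
   [P z *m B] those of the base: since K L = 0 and B L = 1, one gets h z L = P z - P u, and the
   differential of h at u is K + L B = 1. The inverse of h therefore makes P affine. *)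
pose K : 'M[R]_n := 1%:M - L *m B.
have KL : K *m L = 0 by rewrite mulmxBl mul1mx -mulmxA BL mulmx1 subrr.
pose c := - (u *m K + P u *m B).
pose h z := (z *m K + P z *m B) + c.
have s1 : smat (fun z : 'rV[R]_n => z *m K) u by exact: smat_mulmxr (smat_id _).
have s2 : smat (fun z => P z *m B) u by exact: smat_mulmxr.
have sh : smat h u by apply: smat_add; [exact: smat_add|exact: smat_cst].
have hid v : 'd h u v = v.
  have d1 := smat_differentiable s1; have d2 := smat_differentiable s2.
  apply: etrans (diff_add v (differentiableD d1 d2) (differentiable_cst _ _)) _.
  apply: etrans (congr2 +%R (diff_add v d1 d2) (congr1 (fun h => h v) (diff_cst _ _))) _.
  apply: etrans (addr0 _) _.
  have e1 : 'd (fun z : 'rV[R]_n => z *m K) u v = v *m K.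
    exact: diff_mulmx.
  have e2 : 'd (fun z => P z *m B) u v = v *m L *m B.
    exact: etrans (diff_mulmxr B v dP) (congr1 (mulmxr B) (jacobianE _ _ _)).
  by apply: etrans (congr2 +%R e1 e2) _; rewrite mulmxBr mulmx1 mulmxA subrK.
have hu : h u = 0 by rewrite /h subrr.
have [g [sg gu gh hg]] := inverse_function_id sh hid.
rewrite hu in sg gu gh.
have dg v : 'd g 0 v = v.
  have sh' : smat h (g 0) by rewrite gu.
  have hid' w t : w = u -> 'd h w t = t by move=> ->; exact: hid.
  exact: etrans (esym (hid' _ _ gu)) (diff_right_inverse v sg sh' gh).
have Jg : 'J g 0 \in unitmx.
  suff -> : 'J g 0 = 1%:M by exact: unitmx1.
  by apply/row_matrixP => i; rewrite !rowE -jacobianE dg mulmx1.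
have [si pi] : param (iot y) (g 0) by rewrite gu; exact: param_chart_inv.
have cg := smat_continuous sg.
have ci : {for y, continuous (kap y)} by exact: chart_map_continuous.
exists (iot y \o g), (h \o kap y), L, B; split.
- exact: BL.
- split; first exact: smap_comp sg si.
  apply: near_impl2 (near_and (near_comp cg pi) (near_comp cg (smap_near si)))
    (near_and (smat_near sg) (smat_unitmx (smat_jacobian sg) Jg)).
  move=> z [Hz siz] [sgz uz] t; have [v <-] := Hz t.
  exists (v *m invmx ('J g z)); apply: etrans (dmap_comp _ sgz siz) _.
  have eg : 'd g z (v *m invmx ('J g z)) = v.
    by apply: etrans (jacobianE _ _ _) _; exact: mulmxKV.
  exact: (congr1 (fun t => dmap (iot y) (g z) t) eg).
- split; first by rewrite /= gu chart_mapE.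
  have e w v : w = u -> dmap (iot y) w v = v.
    by move=> ->; apply: etrans (dmap_chart_inv v Dy) _; exact: coord_change_id.
  move=> v; apply: etrans (dmap_comp _ sg si) _.
  exact: etrans (congr1 (fun t => dmap (iot y) (g 0) t) (dg v)) (e _ v gu).
- split; [|exact: hu|].
    by apply: continuous_comp; [exact: ci|exact: smat_continuous sh].
  apply: near_impl2 (near_comp ci hg) (near_chart_dom Dy) => y' /= -> Dy'.
  exact: chart_mapE.
- have cf : {for (0 : 'rV[R]_n), continuous (f \o (iot y \o g))}.
    apply: continuous_comp; last exact: sf.1.
    exact: smap_continuous (smap_comp sg si).
  have nx : \forall x' \near (f \o (iot y \o g)) 0, dom x x'.
    by rewrite /= gu chart_mapE //; exact: near_chart_dom.
  apply: near_impl2 (near_comp cf nx) gh => z Dz hz; split; first exact: Dz.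
  rewrite -[in RHS]hz -Pu /h mulmxDl mulmxDl -!mulmxA KL BL mulmx0 add0r mulmx1.
  by rewrite mulNmx mulmxDl -!mulmxA KL BL mulmx0 add0r mulmx1 addrC subrK.
Qed.

Lemma straightens_tangent (f : M -> M0) y psi theta L B : smooth_map f ->
  straightens f y psi theta L B ->
  \forall z \near (0 : 'rV[R]_n), forall w, tangent_map f (psi z) (dmap psi z w) =
    coord_change (f y) (f (psi z)) (f (psi z)) (w *m L).
Proof.
move=> sf [_ [sp _] _ _ nL]; set x := f y in nL *.
apply: near_impl2 (smap_near sp) (near_join nL) => z spz nz w.
have [Dz _] := nbhs_singleton nz; have sc := smap_smooth_map sf spz.
apply: etrans (esym (dmap_smooth_map w sf spz)) _.
apply: etrans (dmap_chart w sc Dz) _.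
apply: (congr1 (fun t => coord_change x (f (psi z)) (f (psi z)) t)).
have nz' : \forall z' \near z, (kap x \o (f \o psi)) z' = kap x x + z' *m L.
  by apply: near_impl nz => z' [].
apply: etrans (diff_affine (kap x x) L z w).
exact: (diff_near w nz' (smat_differentiable (smap_chart sc Dz))
  (smat_differentiable (smat_affine _ _ _))).
Qed.

End Submersions.

(** * Tangency from accumulation points *)

Lemma countable_separated (A : set R) (d : R) : 0 < d ->
  (forall t t', A t -> A t' -> `|t' - t| < d -> t' = t) -> countable A.
Proof.
move=> d0 H; apply/countable_injP.
exists (fun t => choice.pickle (Num.floor (t / d))) => t t' /set_mem At /set_mem At'.
move=> /(pcan_inj choice.pickleK) e; apply: H => //.
have := floor_itv (t / d); have := floor_itv (t' / d); rewrite e intrD.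
move: (_%:~R) => m; rewrite !ler_pdivlMr // !ltr_pdivrMr // => /andP[a b] /andP[a' b'].
by rewrite ltr_norml; nra.
Qed.

(** S is an arbitrary map. If t is not an accumulation parameter, some basic open set b around S t
    and some k make t the only parameter within 1/(k+1) of t that S sends into b. For fixed b and k
    such parameters are separated, hence countably many, whereas an interval of positive length is
    uncountable. *)
Lemma second_countable_accumulation (T : topologicalType) (S : R -> T) (e : R) :
  0 < e -> @second_countable T ->
  exists t, `|t| < e /\ forall (P : T -> Prop) (d : R), (\forall s \near S t, P s) ->
    0 < d -> exists t', [/\ t' != t, `|t' - t| < d & P (S t')].
Proof.
move=> e0 [Bs cB [oB bB]]; apply: contrapT => H.
pose F b k := [set t : R | b (S t) /\ forall t', `|t' - t| < k.+1%:R^-1 -> b (S t') -> t' = t].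
have cF : countable (\bigcup_(b in Bs) \bigcup_(k in [set: nat]) F b k).
  apply: bigcup_countable => // b _; apply: bigcup_countable => // k _.
  apply: (@countable_separated _ (k.+1%:R^-1)) => [|t t' [bt Ht] [bt' _] tt'].
    by rewrite invr_gt0.
  exact: Ht.
have sub : `]-e, e[%classic `<=` \bigcup_(b in Bs) \bigcup_(k in [set: nat]) F b k.
  move=> t /=; rewrite in_itv /= => /andP[t1 t2].
  have te : `|t| < e by rewrite ltr_norml t1 t2.
  apply: contrapT => nF; apply: H; exists t; split=> // P d nP d0.
  have [b [Bb bt] bP] := bB (S t) P nP.
  have [k kd] := ltr_add_invr d0; rewrite add0r in kd.
  apply: contrapT => nt'; apply: nF; exists b => //; exists k => //; split=> // t' tt' bt'.
  apply/eqP/negPn/negP => neq; apply: nt'; exists t'; split=> //.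
    exact: lt_trans tt' kd.
  exact: bP.
have := countable_lebesgue_measure0 (sub_countable (subset_card_le sub) cF).
rewrite lebesgue_measure_itv /= lte_fin gtrN // => /eqP.
by rewrite -EFinB eqe opprK; apply/negP; rewrite gt_eqF // addr_gt0.
Qed.

(** F and c share secants from the common point F a = c z that shrink to zero. Those of c approach
    the direction w of its velocity, those of F the image D of its differential. The cokernel E of D
    measures the distance of w to this image, and the estimates below leave no room for [w *m E] to
    be nonzero. *)
Lemma tangent_of_accumulation k m n (F : 'rV[R]_k -> 'rV[R]_n) (a : 'rV[R]_k)
    (c : 'rV[R]_m -> 'rV[R]_n) (z v : 'rV[R]_m) :
  smat F a -> (forall s, 'd F a s = 0 -> s = 0) -> smat c z -> F a = c z ->
  (forall d : R, 0 < d -> exists (t : R) (b : 'rV[R]_k),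
    [/\ t != 0, `|t| < d, `|b - a| < d & F b = c (z + t *: v)]) ->
  exists s, 'd F a s = 'd c z v.
Proof.
move=> sF Finj sc Fac acc; pose D := 'J F a; pose E := cokermx D.
have free_D : row_free D.
  by apply: inj_row_free => s sD; apply: Finj; exact: etrans (jacobianE _ _ _) sD.
have [G DG] := row_freeP free_D.
set w := 'd c z v.
suff wE : w *m E = 0.
  have /submxP[s sD] : (w <= D)%MS by rewrite submxE; apply/eqP; exact: wE.
  by exists s; exact: etrans (jacobianE _ _ _) (esym sD).
apply: contrapT => wE.
have x0 : 0 < `|w *m E| by rewrite normr_gt0; apply/eqP.
have [c1 c10 Hc1] := linear_rV_bound (mulmxr G : {linear 'rV_n -> 'rV_k}).
have [c2 c20 Hc2] := linear_rV_bound (mulmxr E : {linear 'rV_n -> 'rV_n}).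
(* The final bound for the norm of t w E is e K times the absolute value of t: the second summand
   comes from the error on c, the first from the error on F. *)
pose K := 2 * c1 * c2 * (`|w| + `|v|) + c2 * `|v|.
have K0 : 0 <= K by rewrite !(addr_ge0, mulr_ge0).
(* e <= 1 bounds the secants of c, c1 e <= 1/2 lets the error on F be absorbed when b - a is
   estimated by the secant, and the last condition contradicts the final bound. *)
have [e [e0 e1 ec eK]] : exists e : R, [/\ 0 < e, e <= 1, c1 * e <= 2^-1 & e * K < `|w *m E|].
  have p1 : 0 < 2 * (c1 + 1) by nra.
  have p2 : 0 < K + 1 by lra.
  exists (Num.min (2 * (c1 + 1))^-1 (Num.min 1 (`|w *m E| / (K + 1)))); split.
  - by rewrite !lt_min ltr01 invr_gt0 p1 divr_gt0.
  - by rewrite !ge_min lexx orbT.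
  - apply: (@le_trans _ _ (c1 * (2 * (c1 + 1))^-1)).
      by apply: ler_wpM2l => //; rewrite ge_min lexx.
    by rewrite ler_pdivrMr //; lra.
  - apply: (@le_lt_trans _ _ (`|w *m E| / (K + 1) * K)).
      by apply: ler_wpM2r => //; rewrite !ge_min lexx !orbT.
    by rewrite mulrAC ltr_pdivrMr //; nra.
have [d1 d10 Hd1] := strict_differentiability sF e0.
have [d2 d20 Hd2] := strict_differentiability sc e0.
have v1 : 0 < `|v| + 1 by rewrite ltr_wpDl.
have d0 : 0 < Num.min d1 (d2 / (`|v| + 1)) by rewrite lt_min d10 divr_gt0.
have [t [b [t0 td bd Fb]]] := acc _ d0.
move: td bd; rewrite !lt_min => /andP[_ td] /andP[bd _].
have T0 : 0 < `|t| by rewrite normr_gt0.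
have aa : `|a - a| < d1 by rewrite subrr normr0.
have zz : `|z - z| < d2 by rewrite subrr normr0.
have tz : `|z + t *: v - z| < d2.
  rewrite addrAC subrr add0r normrZ; move: td; rewrite ltr_pdivlMr //.
  have := normr_ge0 v; nra.
have A2 := Hd1 b a bd aa; have A3 := Hd2 _ _ tz zz.
have ez : z + t *: v - z = t *: v by rewrite addrAC subrr add0r.
have A2' : `|F b - F a - (b - a) *m D| <= e * `|b - a|.
  by apply: le_trans A2; rewrite jacobianE.
have A3' : `|F b - F a - t *: w| <= e * (`|t| * `|v|).
  have e1' : 'd c z (z + t *: v - z) = t *: w by rewrite ez linearZZ.
  by have := A3; rewrite e1' ez normrZ Fb Fac.
move: A2 A3 Hd1 Hd2 => _ _ _ _.
have A1 : `|b - a| <= c1 * `|(b - a) *m D|.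
  by have := Hc1 ((b - a) *m D); rewrite /= -mulmxA DG mulmx1.
set De := F b - F a in A2' A3'.
have B1 : `|(b - a) *m D| <= `|De| + e * `|b - a|.
  have := ler_normB De (De - (b - a) *m D); rewrite subKr; lra.
have B2 : `|b - a| <= 2 * c1 * `|De|.
  have := normr_ge0 (b - a); nra.
have B3 : `|De| <= `|t| * (`|w| + `|v|).
  have := ler_normD (De - t *: w) (t *: w); rewrite subrK normrZ => B3.
  have : e * (`|t| * `|v|) <= `|t| * `|v|.
    by rewrite ler_piMl // mulr_ge0.
  lra.
have B4 : `|t| * `|w *m E| <= c2 * (e * (`|t| * `|v|)) + c2 * (e * `|b - a|).
  have -> : `|t| * `|w *m E| = `|(De - (b - a) *m D) *m E - (De - t *: w) *m E|.
    by rewrite -normrZ -mulmxBl opprB addrC addrA subrK mulmxBl -mulmxA mulmx_coker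
      mulmx0 subr0 scalemxAl.
  apply: le_trans (ler_normB _ _) _.
  have H1 := Hc2 (De - (b - a) *m D); have H2 := Hc2 (De - t *: w).
  rewrite /= in H1 H2.
  have := ler_wpM2l c20 A2'; have := ler_wpM2l c20 A3'; lra.
have B5 : `|b - a| <= 2 * c1 * (`|t| * (`|w| + `|v|)).
  by apply: le_trans B2 _; apply: ler_wpM2l => //; rewrite mulr_ge0.
have B6 : `|t| * `|w *m E| <= `|t| * (e * K).
  apply: le_trans B4 _.
  have : c2 * e * `|b - a| <= c2 * e * (2 * c1 * (`|t| * (`|w| + `|v|))).
    by apply: ler_wpM2l => //; rewrite mulr_ge0 // ltW.
  rewrite /K; lra.
have := ltr_pM2l T0 (e * K) `|w *m E|; rewrite eK => B7.
by have := lt_le_trans B7 B6; rewrite ltxx.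
Qed.

Section Projection.
Context {n n0 : nat} {M : manifold R n} {M0 : manifold R n0}.
Context {C : tangent_distribution M} {p0 : M -> M0}.
Context (hC : hyperplane_field C) (simple : simple_with C p0).

Local Notation kap q := (chart_map (chart_at q)).
Local Notation iot q := (chart_inv (chart_at q)).
Local Notation dom q := (chart_dom (chart_at q)).

Lemma fibre_integral x : exists k (N : manifold R k) (i : N -> M),
  [/\ connected [set: N], integral_map (char_dist C) i &
      forall y, p0 y = x <-> exists s, i s = y].
Proof.
have [[leaf_of [inj rng mem]] [_ sur _]] := simple.
have lf z : leaf (char_dist C) (leaf_of z).
  have : range leaf_of (leaf_of z) by exists z.
  by rewrite rng.
have fib y : p0 y = x <-> leaf_of x y.
  split=> [<-|Ly]; first exact: mem.
  by apply: inj; exact: (leaves_eq hC (lf _) (lf _) (mem y) Ly).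
have [/integral_submanifoldP[k [N [i [cN I rL]]]] _] := lf x.
exists k, N, i; split=> // y; rewrite fib -rL.
by split=> [[s _ <-]|[s <-]]; exists s.
Qed.

Lemma dmap_center m (f : 'rV[R]_m -> M) w v z : z = f w -> 'd (kap z \o f) w v = dmap f w v.
Proof. by move=> ->. Qed.

Lemma dmap_cst m (f : 'rV[R]_m -> M0) z v : (forall z', f z' = f z) -> dmap f z v = 0.
Proof.
move=> fz; have e : f = fun=> f z by apply: funext.
rewrite /dmap e.
exact: (congr1 (fun h => h v) (diff_cst _ _)).
Qed.

Lemma dmap_chart_inv_smooth k (N : manifold R k) m (L : manifold R m) (f : N -> L) s v :
  dmap (f \o iot s) (kap s s) v = tangent_map f s v.
Proof.
have e : f s = (f \o iot s) (kap s s) by rewrite /= chart_mapE //; exact: chart_at_dom.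
by rewrite tangent_mapE e.
Qed.

Lemma char_tangent_map y v : v \in char_dist C y -> tangent_map p0 y v = 0.
Proof.
have [_ [sp _ _]] := simple.
have [k [N [i [_ I fib]]]] := fibre_integral (p0 y).
have [s isy] : exists s, i s = y by apply/fib.
have Ds := chart_at_dom s; have [si _ _ ti] := I.
rewrite -isy -ti => /memv_imgP[s' _ ->].
have p0i z : p0 (i z) = p0 y by apply/fib; exists z.
have sf : smap (i \o iot s) (kap s s).
  by apply: smap_smooth_map => //; exact: smap_chart_inv.
have e : i s = (i \o iot s) (kap s s) by rewrite /= chart_mapE.
rewrite [in LHS]e -(dmap_chart_inv_smooth i s s').
apply: etrans (esym (dmap_smooth_map s' sp sf)) _.
by apply: dmap_cst => z'; rewrite /= !p0i.
Qed.

Lemma tangent_map_char y v : tangent_map p0 y v = 0 -> v \in char_dist C y.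
Proof.
have [_ [sp _ sub]] := simple.
have [psi [theta [L [B st]]]] := submersion_straightens sp (sub y).
have nT := straightens_tangent sp st.
have [_ pp [psi0 dpsi0] _ nL] := st; set x := p0 y in nL nT *.
have Dx := chart_at_dom x.
have [N' [Phi [sPhi nPhi]]] := char_matrix hC pp.
move=> Tv; have vL : v *m L = 0.
  have := nbhs_singleton nT v; rewrite dpsi0 psi0 Tv => /esym.
  by rewrite coord_change_id.
suff vPhi : v *m Phi 0 = 0.
  by have := (nbhs_singleton nPhi v).1 vPhi; rewrite dpsi0 psi0.
have [d d0 Hd] := (near_normP _ _).1 (near_and
  (near_and nL nPhi) (smap_near pp.1)).
have v1 : 0 < `|v| + 1 by rewrite ltr_wpDl.
have small (r t : R) : `|t| < r / (`|v| + 1) -> `|t *: v - 0| < r.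
  rewrite subr0 normrZ ltr_pdivlMr // => tr; apply: le_lt_trans tr.
  by rewrite ler_wpM2l // lerDl.
pose e := d / (`|v| + 1); have e0 : 0 < e by rewrite divr_gt0.
have [k [N [i [_ I fib]]]] := fibre_integral x.
(* The segment t v stays in the fibre because v L = 0, so it lifts to N point by point. For
   parameters outside ]-e, e[ the value of the lift S is arbitrary. *)
have HS (t : R) : exists s, `|t| < e -> i s = psi (t *: v).
  have [te|] := boolP (`|t| < e); last first.
    by have [s _] := manifold_nonempty N; exists s.
  have [[[Dt Lt] _] _] := Hd _ (small _ _ te).
  have /fib[s ist] : p0 (psi (t *: v)) = x.
    rewrite -(chart_mapE Dt) Lt -scalemxAl vL scaler0 addr0; exact: chart_mapE.
  by exists s.
have [S SP] := choice HS.
have key (e' : R) : 0 < e' -> e' <= e -> exists t, `|t| < e' /\ v *m Phi (t *: v) = 0.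
  move=> e'0 e'e.
  have [t [te acc]] := second_countable_accumulation S e'0 (manifold_second_countable N).
  exists t; split=> //; have te' := lt_le_trans te e'e.
  have [[_ Phit] spt] := Hd _ (small _ _ te').
  apply/Phit; have ist := SP _ te'; set s := S t in ist acc.
  have Ds := chart_at_dom s; have [si _ im ti] := I.
  rewrite -ist -ti.
  pose F := kap (i s) \o (i \o iot s).
  have sF : smat F (kap s s) by exact: smooth_map_smat si Ds (chart_at_dom _).
  have Finj s' : 'd F (kap s s) s' = 0 -> s' = 0.
    rewrite -tangent_mapE => Ts'; apply/eqP; rewrite -memv0 -(im s) memv_ker.
    exact/eqP.
  have sc : smat (kap (i s) \o psi) (t *: v) by rewrite ist; exact: spt.2.
  have Fc : F (kap s s) = (kap (i s) \o psi) (t *: v) by rewrite /F /= chart_mapE // ist.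
  have acc' (r : R) : 0 < r -> exists (t' : R) (b : 'rV[R]_k),
      [/\ t' != 0, `|t'| < r, `|b - kap s s| < r &
          F b = (kap (i s) \o psi) (t *: v + t' *: v)].
    move=> r0; have ck := chart_map_continuous Ds.
    have nP := near_and (near_chart_dom Ds) (near_dist ck r0).
    (* The second bound keeps t' inside ]-e, e[, where S is indeed a lift. *)
    have r'0 : 0 < Num.min r (e - `|t|) by rewrite lt_min r0 subr_gt0.
    have [t' [t't + [D' b']]] := acc _ _ nP r'0; rewrite lt_min => /andP[tr te''].
    exists (t' - t), (kap s (S t')); split=> //; first by rewrite subr_eq0.
    have t'e : `|t'| < e by have := ler_normD (t' - t) t; rewrite subrK; lra.
    by rewrite /F /= chart_mapE // SP // -scalerDl [t + _]addrC subrK.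
  have [s' Fs'] := tangent_of_accumulation sF Finj sc Fc acc'.
  have -> : dmap psi (t *: v) v = tangent_map i s s'.
    exact: etrans (esym (dmap_center v ist)) (etrans (esym Fs') (esym (tangent_mapE i s s'))).
  exact: memv_img (memvf _).
apply: contrapT => vPhi.
have p0' : 0 < `|v *m Phi 0| by rewrite normr_gt0; apply/eqP.
have sv : smat (fun z => v *m Phi z) 0 by apply: smat_mulmx => //; exact: smat_cst.
have [r r0 Hr] := (near_normP _ _).1 (near_dist (smat_continuous sv) p0').
have e'0 : 0 < Num.min e (r / (`|v| + 1)) by rewrite lt_min e0 divr_gt0.
have e'e : Num.min e (r / (`|v| + 1)) <= e by rewrite ge_min lexx.
have [t [+ vt]] := key _ e'0 e'e; rewrite lt_min => /andP[_ /small/Hr].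
by rewrite vt sub0r normrN ltxx.
Qed.

Lemma ker_tangent_map y : lker (tangent_map p0 y) = char_dist C y.
Proof.
apply/vspaceP => v; rewrite memv_ker.
by apply/idP/idP => [/eqP/tangent_map_char|/char_tangent_map ->].
Qed.

End Projection.

End Fibres.

(** * The projected contact structure *)

Section Contact.
Context {R : realType}.

Lemma dot_trmx m p (L : 'M[R]_(m, p)) x v : dot (x *m L^T) v = dot x (v *m L).
Proof.
have e q (b c : 'rV[R]_q) : dot b c = (b *m c^T) 0 0.
  by rewrite !mxE; apply: eq_bigr => i _; rewrite mxE.
by rewrite !e trmx_mul mulmxA.
Qed.

Lemma dot_inj m (x y : 'rV[R]_m) : (forall v, dot x v = dot y v) -> x = y.
Proof. by move=> H; apply/rowP => i; rewrite -!dot_delta. Qed.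

(** If the derivative of g in direction v is parallel to g, only the length of g varies and not its
    direction; dividing by a nonzero entry fixes the length. The proof differentiates g = g_j h and
    compares. *)
Lemma normalized_diff0 m p (g : 'rV[R]_m -> 'rV[R]_p) z v j k :
  smat g z -> g z 0 j != 0 -> 'd g z v = k *: g z ->
  'd (fun x => (g x 0 j)^-1 *: g x) z v = 0.
Proof.
move=> sg gj dg; pose h x := (g x 0 j)^-1 *: g x.
have sj := smat_coord j sg.
have sh : smat h z by apply: smat_scale => //; exact: smat_inv.
have e : \forall x \near z, g x = g x 0 j *: h x.
  apply: near_impl (smat_near_neq0 sj gj) => x gx.
  by rewrite /h scalerA divff // scale1r.
have e1 := etrans (diff_near v e (smat_differentiable sg)
  (smat_differentiable (smat_scale sj sh))) (diff_scale v sj sh).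
have e2 : 'd (fun x => g x 0 j) z v = k * g z 0 j.
  apply: etrans (esym (diff_coord v 0 j (smat_differentiable sg))) _.
  by apply: etrans (congr1 (fun t : 'rV_p => t 0 j) dg) _; rewrite mxE.
have e3 : k *: g z = (k * g z 0 j) *: h z + g z 0 j *: 'd h z v.
  exact: etrans (esym dg) (etrans e1 (congr1 (fun t => t *: h z + _) e2)).
move: e3; rewrite {1}/h scalerA mulfK // => /eqP.
by rewrite -subr_eq0 opprD addrA subrr sub0r oppr_eq0 scaler_eq0 (negbTE gj) => /eqP.
Qed.

(* If [i_v a = 0] and [i_v da] is proportional to [a] for [v] in [ker L], the
   kernel of [a] is constant along [ker L], hence [a] is, up to a factor, the
   pullback by [L] of a form. *)
Lemma basic_form m p (a : 'rV[R]_m -> 'rV[R]_m) (L : 'M[R]_(m, p)) (B : 'M[R]_(p, m)) :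
  B *m L = 1%:M -> smat a 0 -> a 0 != 0 ->
  (\forall z \near (0 : 'rV[R]_m), forall v, v *m L = 0 -> dot (a z) v = 0) ->
  (\forall z \near (0 : 'rV[R]_m), forall v w,
     v *m L = 0 -> dot (a z) w = 0 -> dform a z v w = 0) ->
  exists (h : 'rV[R]_p -> 'rV[R]_p) (mu : 'rV[R]_m -> R), [/\ smat h 0, smat mu 0 &
    \forall z \near (0 : 'rV[R]_m), a z = mu z *: (h (z *m L) *m L^T)].
Proof.
(* [g] is [a] evaluated on the section B. As [a] kills the kernel of L, and w - w L B lies in it,
   [a] is recovered from [g] through L. *)
move=> BL sa a0 vert inv; pose g z := a z *m B^T.
have sg : smat g 0 by exact: smat_mulmxr.
have n1 : \forall z \near (0 : 'rV[R]_m), a z = g z *m L^T.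
  apply: near_impl vert => z Hz; apply: dot_inj => w.
  rewrite dot_trmx dot_trmx; apply/eqP; rewrite -subr_eq0 -dotBr; apply/eqP.
  by apply: Hz; rewrite mulmxBl -!mulmxA BL mulmx1 subrr.
have g0 : g 0 != 0.
  by apply: contraNneq a0 => g0; rewrite (nbhs_singleton n1) g0 mul0mx.
have [j gj] := rV_neq0 g0.
have sj := smat_coord j sg; have nj := smat_near_neq0 sj gj.
pose H z := (g z 0 j)^-1 *: g z.
have sH : smat H 0 by apply: smat_scale => //; exact: smat_inv.
have nH : \forall z \near (0 : 'rV[R]_m), differentiable H z /\
    forall v, v *m L = 0 -> 'd H z v = 0.
  have n2 := near_and (near_join vert) inv.
  have n3 := near_and (smat_near sa) (smat_near sH).
  have n4 := near_and n2 n3.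
  apply: near_impl2 n4 nj => z [[nv iv] [saz sHz]] gjz.
  split=> [|v vL]; first exact: smat_differentiable.
  have daz := smat_differentiable saz.
  have sgz : smat g z by exact: smat_mulmxr.
  have az0 : a z != 0.
    by apply: contraNneq gjz => az0; rewrite /g az0 mul0mx mxE.
  have [l al] := rV_neq0 az0.
  (* Since the function [dot (a x) v] vanishes near z, one term of the exterior derivative drops
     out. What remains says that the derivative of [a] along v vanishes on the kernel of [a], so it
     is a multiple of [a]. *)
  have prop : 'd a z v = ('d a z v 0 l / a z 0 l) *: a z.
    apply: dot_eq0_proportional => // w aw.
    have := iv v w vL aw; rewrite /dform.
    have -> : dot ('d a z w) v = 0; last by rewrite subr0.
    apply: etrans (esym (diff_dot_cst v w daz)) _.
    have e : \forall x \near z, dot (a x) v = (fun=> 0) x.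
      by apply: near_impl nv => x; exact.
    have sd : smat (fun x => dot (a x) v) z by apply: smat_dot => //; exact: smat_cst.
    apply: etrans (diff_near w e (smat_differentiableR sd) (differentiable_cst _ _)) _.
    exact: (congr1 (fun h => h w) (diff_cst _ _)).
  apply: (@normalized_diff0 _ _ g z v j ('d a z v 0 l / a z 0 l)) => //.
  apply: etrans (diff_mulmxr B^T v daz) _.
  by apply: etrans (congr1 (mulmxr B^T) prop) _; rewrite /= -scalemxAl.
have [d d0 Hd] := (near_normP _ _).1 nH.
(* Both ends of the segment lie in the ball of radius d, hence so does the segment by convexity, and
   the derivative of H along v vanishes on it. *)
have constH s v : `|s| < d -> `|s + v| < d -> v *m L = 0 -> H (s + v) = H s.
  move=> sd svd vL; apply: constant_line => t /andP[t0 t1].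
  have /Hd[dH dH0] : `|s + t *: v - 0| < d.
    rewrite subr0; have -> : s + t *: v = (1 - t) *: s + t *: (s + v).
      by rewrite scalerDr addrA -scalerDl subrK scale1r.
    apply: le_lt_trans (ler_normD _ _) _; rewrite !normrZ.
    rewrite (ger0_norm t0) ger0_norm ?subr_ge0 //.
    apply: (@le_lt_trans _ _ (Num.max `|s| `|s + v|)); last by rewrite gt_max sd.
    have m1 : `|s| <= Num.max `|s| `|s + v| by rewrite le_max lexx.
    have m2 : `|s + v| <= Num.max `|s| `|s + v| by rewrite le_max lexx orbT.
    by move: (Num.max _ _) m1 m2 => c; nra.
  by split=> //; exact: dH0.
(* H restricted to the section B. The points z and z L B differ by a vector of the kernel of L, so
   [constH] gives H z = h (z L). *)
pose h (t : 'rV[R]_p) := H (t *m B).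
have sB : smat (fun t : 'rV[R]_p => t *m B) 0 by exact: smat_mulmxr (smat_id _).
have sL : smat (fun z : 'rV[R]_m => z *m L *m B) 0.
  by apply: smat_mulmxr; exact: smat_mulmxr (smat_id _).
have B0 : (0 : 'rV[R]_p) *m B = 0 by exact: mul0mx.
exists h, (fun z => g z 0 j); split=> //.
- by apply: (smat_comp sB); rewrite B0.
- have dz : \forall z \near (0 : 'rV[R]_m), `|z| < d.
    by apply/near_normP; exists d => // z; rewrite subr0.
  have dL : \forall z \near (0 : 'rV[R]_m), `|z *m L *m B| < d.
    have : \forall z \near (0 : 'rV[R]_m) *m L *m B, `|z| < d by rewrite !mul0mx.
    exact: near_comp (smat_continuous sL).
  have n5 := near_and dz dL.
  have n6 := near_and n1 nj.
  apply: near_impl2 n5 n6 => z [zd zLd] [az gjz].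
  have -> : h (z *m L) = H z.
    have e : z *m L *m B + (z - z *m L *m B) = z by rewrite addrC subrK.
    rewrite -[in RHS]e constH //; first by rewrite e.
    by rewrite mulmxBl -!mulmxA BL mulmx1 subrr.
  by rewrite /H -scalemxAl scalerA divff // scale1r.
Qed.

Lemma dim_dot_kernel k (D : {vspace 'rV[R]_k.+1}) a : a != 0 ->
  (forall v, v \in D <-> dot a v = 0) -> \dim D = k.
Proof.
move=> a0 aD; pose f : 'Hom('rV[R]_k.+1, R^o) := linfun (dot a : _ -> R^o).
have fE v : f v = dot a v by rewrite lfunE.
have -> : D = lker f.
  by apply/vspaceP => v; rewrite memv_ker fE; apply/idP/eqP => /aD.
have [j aj] := rV_neq0 a0.
have fT : limg f = fullv.
  apply/eqP; rewrite eqEsubv subvf /=; apply/subvP => c _.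
  apply/memv_imgP; exists ((c / a 0 j) *: delta_mx 0 j); first exact: memvf.
  by rewrite fE dotZr dot_delta divfK.
have := limg_ker_dim f fullv; rewrite capfv fT !dimvf /dim /= mul1n.
by move=> /eqP; rewrite addn1 eqSS => /eqP.
Qed.

(** Where a_j is nonzero, the fields a_j e_l - a_l e_j with l different from j form a frame of the
    kernel of [a]. Dimension 0 is excluded because it admits no nonzero form. *)
Lemma hyperplane_of_local_forms n (M : manifold R n) (D : tangent_distribution M) :
  (forall x, exists a,
    local_form D (chart_inv (chart_at x)) (chart_map (chart_at x) x) a) ->
  hyperplane_field D.
Proof.
case: n M D => [|k] M D H.
  have [x _] := manifold_nonempty M; have [a [_ na]] := H x.
  by have [j _] := rV_neq0 (nbhs_singleton na).1; case: (j).
exists k; split=> // x; have [a [sa na]] := H x.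
  have [a0 aD] := nbhs_singleton na.
  apply: (dim_dot_kernel a0) => v; rewrite aD.
  by rewrite mem_dmap_chart_inv.
have [a0 _] := nbhs_singleton na; have [j aj] := rV_neq0 a0.
pose F l u : 'rV[R]_k.+1 :=
  a u 0 j *: delta_mx 0 (lift j l) - a u 0 (lift j l) *: delta_mx 0 j.
have sF l : smat (F l) (chart_map (chart_at x) x).
  by apply: smat_sub; apply: smat_scale; by [exact: smat_coord|exact: smat_cst].
have nP := near_and na (smat_near_neq0 (smat_coord j sa) aj).
have HX l := vf_of_chart (sF l) nP.
have [U0 HU] := choice HX; have [X UX] := choice HU.
have nU : \forall y \near x, forall l, U0 l y.
  by apply: near_forall => l; have [oU Ux _ _] := UX l; exact: open_nbhs_nbhs.
have Dx := chart_at_dom x.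
have ck := chart_map_continuous Dx.
have nP' := near_and (near_comp ck nP) (near_chart_dom Dx).
have [U [oU Ux UP]] := near_open (near_and nU nP').
exists U, X; split=> // [l|q Uq].
  have [oU0 _ sX _] := UX l.
  by apply: (smooth_vf_sub oU oU0) sX => q /UP[].
have [Ul [[[aq0 aq] aqj] Dq]] := UP _ Uq.
have Dqq := chart_at_dom q.
set u := chart_map (chart_at x) q in aq0 aq aqj.
have XE l : X l q = coord_change x q q (F l u).
  by have [_ _ _ /(_ _ (Ul l))[]] := UX l.
have mem v : v \in D q <-> dot (a u) (coord_change q x q v) = 0.
  by rewrite aq mem_dmap_chart // coord_changeK.
have aF l : dot (a u) (F l u) = 0.
  by rewrite dotBr !dotZr !dot_delta mulrC subrr.
apply/vspaceP => v; apply/idP/idP => [/mem|/mem_span_image[c ->]].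
  set s := coord_change q x q v => as0; apply/mem_span_image.
  exists (fun l => s 0 (lift j l) / a u 0 j).
  pose t := s - \sum_l (s 0 (lift j l) / a u 0 j) *: F l u.
  have at0 : dot (a u) t = 0.
    have aS : dot (a u) (\sum_l (s 0 (lift j l) / a u 0 j) *: F l u) = 0.
      by rewrite linear_sum big1 // => l _; rewrite /= dotZr aF mulr0.
    by rewrite dotBr as0 aS subr0.
  have jl l' : (lift j l' == j) = false by rewrite eq_sym (negbTE (neq_lift j l')).
  have FE l l' : F l u 0 (lift j l') = a u 0 j * (l' == l)%:R.
    by rewrite !mxE !eqxx /= jl (inj_eq (@lift_inj _ j)) mulr0 subr0.
  have tl l' : t 0 (lift j l') = 0.
    rewrite mxE [X in _ + X]mxE summxE (bigD1 l') //= big1 => [|l ll'].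
      by rewrite mxE FE eqxx mulr1 divfK // addr0 subrr.
    by rewrite mxE FE eq_sym (negbTE ll') !mulr0.
  have tE : t = t 0 j *: delta_mx 0 j.
    clearbody t; apply/rowP => i; rewrite !mxE eqxx /=.
    by have [l ->|->] := unliftP j i; rewrite ?tl ?jl ?eqxx ?mulr1 ?mulr0.
  have sE : s = \sum_l (s 0 (lift j l) / a u 0 j) *: F l u.
    apply/eqP; rewrite -subr_eq0 -/t; apply/eqP.
    move: at0; rewrite tE dotZr dot_delta => /eqP.
    by rewrite mulf_eq0 (negbTE aqj) orbF => /eqP ->; rewrite scale0r.
  have -> : v = coord_change x q q s by rewrite coord_changeK.
  rewrite {1}sE linear_sum; apply: eq_bigr => l _.
  by rewrite linearZ XE.
apply: memv_suml => l _; apply: memvZ; apply/mem.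
by rewrite XE coord_changeK.
Qed.

Lemma locally_constant (T : topologicalType) (U : Type) (f : T -> U) :
  connected [set: T] -> (forall t, \forall s \near t, f s = f t) ->
  forall s t, f s = f t.
Proof.
move=> cT lf s t; pose A := [set x | f x = f t].
have oA : open A.
  by rewrite openE => x Ax; apply: near_impl (lf x) => y yx; exact: etrans yx Ax.
have cA : closed A.
  rewrite -openC openE => x Ax; apply: near_impl (lf x) => y yx Ay.
  by apply: Ax; exact: etrans (esym yx) Ay.
have AT : A = setT.
  apply: cT; first by exists t.
    by exists A => //; rewrite setTI.
  by exists A => //; rewrite setTI.
by have : A s by rewrite AT.
Qed.

(** * The projected hyperplane field *)

Section Projection.
Context {n n0 : nat} {M : manifold R n} {M0 : manifold R n0}.
Context {C : tangent_distribution M} {p0 : M -> M0}.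
Context (hC : hyperplane_field C) (simple : simple_with C p0).

Local Notation kap q := (chart_map (chart_at q)).
Local Notation iot q := (chart_inv (chart_at q)).
Local Notation dom q := (chart_dom (chart_at q)).

Let p0_smooth : smooth_map p0. Proof. by have [_ []] := simple. Qed.

Lemma dot_pull_affine m p (c : 'rV[R]_p) (L : 'M[R]_(m, p)) al z v :
  dot (pull (fun z => c + z *m L) al z) v = dot (al (c + z *m L)) (v *m L).
Proof.
apply: etrans (dot_pull _ _ _ _) _.
congr (dot _ _); exact: diff_affine.
Qed.

(** In the coordinates psi, C is the kernel of mu times the pullback of [al] by the coordinate
    expression of p0, which is affine there. The form [al] lives on M0 and is the candidate local
    form of C0 near p0 y. *)
Definition adapted y psi theta L B (al : 'rV[R]_n0 -> 'rV[R]_n0) (mu : 'rV[R]_n -> R) :=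
  [/\ straightens p0 y psi theta L B, smat al (kap (p0 y) (p0 y)), smat mu 0 &
      local_form C psi 0
        (fun z => mu z *: pull (fun z => kap (p0 y) (p0 y) + z *m L) al z)].

(** The equality of the kernel of Tp0 with the characteristic distribution supplies both hypotheses
    of [basic_form]: a characteristic vector lies in C, and its contraction with da vanishes on
    C. *)
Lemma exists_adapted y : exists psi theta L B al mu, adapted y psi theta L B al mu.
Proof.
have [_ [_ _ sub]] := simple.
have [psi [theta [L [B st]]]] := submersion_straightens p0_smooth (sub y).
have nT := straightens_tangent p0_smooth st.
have [BL pp _ _ _] := st; set x := p0 y in nT.
have [a la] := local_form_along hC pp; have [sa na] := la.
have a0 := (nbhs_singleton na).1.
have nchar : \forall z \near (0 : 'rV[R]_n), forall v, v *m L = 0 ->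
    dmap psi z v \in char_dist C (psi z).
  apply: near_impl nT => z Tz v vL.
  by rewrite -(ker_tangent_map hC simple) memv_ker Tz vL linear0.
have vert : \forall z \near (0 : 'rV[R]_n), forall v, v *m L = 0 -> dot (a z) v = 0.
  apply: near_impl2 nchar na => z cz [_ az] v vL; apply/az.
  exact: (subvP (char_sub _ hC)) (cz v vL).
have inv : \forall z \near (0 : 'rV[R]_n), forall v w,
    v *m L = 0 -> dot (a z) w = 0 -> dform a z v w = 0.
  apply: near_impl2 nchar (near_and (param_near pp) (local_form_near la)).
  move=> z cz [ppz laz] v w vL aw.
  by have [_ ->] := (char_along v hC ppz laz).1 (cz v vL).
have [h [mu [sh smu nh]]] := basic_form BL sa a0 vert inv.
pose al u := h (u - kap x x).
have sal : smat al (kap x x).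
  have ss : smat (fun u => u - kap x x) (kap x x).
    by apply: smat_sub; [exact: smat_id|exact: smat_cst].
  by apply: (smat_comp ss); rewrite subrr.
exists psi, theta, L, B, al, mu; split=> //.
have ea : \forall z \near (0 : 'rV[R]_n),
    a z = mu z *: pull (fun z => kap x x + z *m L) al z.
  apply: near_impl nh => z ->; congr (_ *: _); apply: dot_inj => v.
  by rewrite dot_trmx dot_pull_affine /al addrC addKr.
split; first exact: smat_ext ea sa.
by apply: near_impl2 ea na => z <-.
Qed.

(** The projected hyperplane at psi z is described by [al] at p0 (psi z), hence by the image point
    alone. Nearby points of one fibre therefore have the same projected hyperplane. The section B
    lifts a vector annihilated by [al] to one of C. *)
Lemma adapted_projection y psi theta L B al mu : adapted y psi theta L B al mu ->
  \forall z \near (0 : 'rV[R]_n), forall w,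
    w \in (tangent_map p0 (psi z) @: C (psi z))%VS <->
    dot (al (kap (p0 y) (p0 (psi z))))
      (coord_change (p0 (psi z)) (p0 y) (p0 (psi z)) w) = 0.
Proof.
move=> [st sal smu [_ na]].
have nT := straightens_tangent p0_smooth st.
have [BL [_ pp] _ _ nL] := st; set x := p0 y in na nT nL *.
have n1 := near_and nT nL.
have n2 := near_and na pp.
apply: near_impl2 n1 n2 => z [Tz [Dz Lz]] [[a0 az] sur] w.
set x' := p0 (psi z) in Tz Dz Lz *; have Dx' := chart_at_dom x'.
have mem v : dmap psi z v \in C (psi z) <-> dot (al (kap x x')) (v *m L) = 0.
  rewrite -az dotZl dot_pull_affine -Lz; split=> [/eqP|->]; last by rewrite mulr0.
  rewrite mulf_eq0 => /orP[/eqP mu0|/eqP //].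
  by move: a0; rewrite mu0 scale0r eqxx.
split=> [/memv_imgP[t tC ->]|aw].
  have [v vt] := sur t; rewrite -vt in tC *.
  by rewrite Tz coord_changeK //; apply/mem.
set s := coord_change x' x x' w in aw.
apply/memv_imgP; exists (dmap psi z (s *m B)).
  by apply/mem; rewrite -mulmxA BL mulmx1.
by rewrite Tz -mulmxA BL mulmx1 coord_changeK.
Qed.

(** Along i : N -> M the projected hyperplane is locally constant, in the topology of N, and N is
    connected. All these hyperplanes are subspaces of one model space, because p0 takes the same
    value at all the points i t. *)
Lemma projection_fibre_constant y y' : p0 y = p0 y' ->
  (tangent_map p0 y @: C y)%VS = (tangent_map p0 y' @: C y')%VS.
Proof.
move=> yy'.
have [k [N [i [cN [si _ _ _] fib]]]] := fibre_integral hC simple (p0 y).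
have [s <-] : exists s, i s = y by apply/fib.
have [s' <-] : exists s, i s = y' by apply/fib.
have p0i t : p0 (i t) = p0 y by apply/fib; exists t.
apply: (locally_constant (f := fun t => (tangent_map p0 (i t) @: C (i t))%VS) cN) => t.
have [psi [theta [L [B [al [mu ad]]]]]] := exists_adapted (i t).
have nP := adapted_projection ad.
have [[_ _ _ [ct t0 nt] _] _ _ _] := ad.
have nP' : \forall z \near theta (i t), forall w,
    w \in (tangent_map p0 (psi z) @: C (psi z))%VS <->
    dot (al (kap (p0 (i t)) (p0 (psi z))))
      (coord_change (p0 (psi z)) (p0 (i t)) (p0 (psi z)) w) = 0 by rewrite t0.
have nQ := near_and (near_comp ct nP') nt.
have Qt := nbhs_singleton nQ.
apply: near_impl (near_comp (si.1 t) nQ) => t'; move: Qt.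
move=> [Pt et] [Pt' et']; rewrite et in Pt; rewrite et' in Pt'.
apply/vspaceP => w; apply/idP/idP => [/Pt'|/Pt] H.
  by apply/Pt; rewrite !p0i in H *.
by apply/Pt'; rewrite !p0i in H *.
Qed.

Lemma adapted_local_form (C0 : tangent_distribution M0) y psi theta L B al mu :
  (forall y, C0 (p0 y) = (tangent_map p0 y @: C y)%VS) ->
  adapted y psi theta L B al mu ->
  local_form C0 (iot (p0 y)) (kap (p0 y) (p0 y)) al.
Proof.
move=> C0P ad; have nP := adapted_projection ad.
have [[BL _ _ _ nL] sal smu [_ na]] := ad; set x := p0 y in sal na nL nP *.
have Dx := chart_at_dom x; split=> //.
(* A local section of p0 in the coordinates psi: [kap x x + s u *m L] is u, so the point psi (s u)
   lies over the point with coordinates u. *)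
pose s (u : 'rV[R]_n0) := (u - kap x x) *m B.
have ss : smat s (kap x x).
  by apply: smat_mulmxr; apply: smat_sub; [exact: smat_id|exact: smat_cst].
have s0 : s (kap x x) = 0 by rewrite /s subrr mul0mx.
have nH := near_and nP
  (near_and nL na).
rewrite -s0 in nH.
apply: near_impl2 (near_comp (smat_continuous ss) nH) (near_chart_inv Dx).
move=> u [Pu [[Du Lu] [au _]]] [Du' uE].
have sL : kap x x + s u *m L = u by rewrite /s -mulmxA BL mulmx1 addrC subrK.
rewrite sL in Lu; set x' := p0 (psi (s u)) in Pu Du Lu.
have Dx' := chart_at_dom x'.
split=> [|v].
  apply: contraNneq au => al0; apply/eqP; apply: dot_inj => v.
  by rewrite dotZl dot_pull_affine sL al0 dot0l mulr0 s0 dot0l.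
rewrite -Lu mem_dmap_chart // C0P Pu coord_changeK //.
Qed.

Lemma contact_projection (C0 : tangent_distribution M0) r :
  (forall y, nu_rank C y = (2 * r)%N) ->
  (forall y, C0 (p0 y) = (tangent_map p0 y @: C y)%VS) -> contact C0.
Proof.
move=> rk C0P; have [_ [_ sur sub]] := simple.
have p0_surj x : exists y, p0 y = x.
  by have : range p0 x; [rewrite sur|move=> [y _ <-]; exists y].
have hC0 : hyperplane_field C0.
  apply: hyperplane_of_local_forms => x; have [y <-] := p0_surj x.
  have [psi [theta [L [B [al [mu ad]]]]]] := exists_adapted y.
  by exists al; exact: adapted_local_form ad.
(* By rank-nullity n0 is n minus the dimension of the characteristic distribution, while n exceeds
   the dimension of C by one. The inclusion of the characteristic distribution in C makes the
   truncated subtraction of [nu_rank] an exact difference. *)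
have dims : n0 = (2 * r).+1.
  have [y _] := manifold_nonempty M.
  have := limg_ker_dim (tangent_map p0 y) fullv.
  rewrite capfv sub (ker_tangent_map hC simple) !dimvf /dim /= !mul1n => d1.
  have d2 := dimvS (char_sub y hC); have := rk y; rewrite /nu_rank.
  have [k kn [dC _]] := hC; rewrite dC => rk'; rewrite dC in d2.
  apply: (@addnI (\dim (char_dist C y))); rewrite d1 -[n in LHS]kn addnS.
  by rewrite -{1}(subnK d2) rk' addnC.
have char0 x : char_dist C0 x = 0%VS.
  have [y yx] := p0_surj x; rewrite -{x}yx.
  have [psi [theta [L [B [al [mu ad]]]]]] := exists_adapted y.
  have l0 := adapted_local_form C0P ad.
  have [st sal smu la] := ad.
  have nT := straightens_tangent p0_smooth st.
  have [BL pp [psi0 dpsi0] _ _] := st; set x := p0 y in sal la l0 nT *.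
  have Dx := chart_at_dom x.
  apply/vspaceP => v0; rewrite memv0; apply/idP/eqP => [|->]; last exact: mem0v.
  move=> /(char_distP _ l0)[v0C v0d].
  have mem0 w : w \in C0 x <-> dot (al (kap x x)) w = 0.
    by rewrite (nbhs_singleton l0.2).2 mem_dmap_chart_inv.
  have e0 : kap x x + 0 *m L = kap x x by rewrite mul0mx addr0.
  pose phi (z : 'rV[R]_n) := kap x x + z *m L.
  have sphi : smat phi 0 by exact: smat_affine.
  have sal' : smat al (phi 0) by rewrite /phi e0.
  have mu0 : mu 0 != 0.
    apply: contraNneq (nbhs_singleton la.2).1 => mu0.
    by rewrite mu0 scale0r.
  have vL : v0 *m B *m L = v0 by rewrite -mulmxA BL mulmx1.
  have dotP w : dot (pull phi al 0) w = dot (al (kap x x)) (w *m L).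
    by rewrite dot_pull_affine e0.
  have av : dot (al (kap x x)) v0 = 0 by apply/mem0.
  have vchar : v0 *m B \in char_dist C y.
    have : dmap psi 0 (v0 *m B) \in char_dist C (psi 0).
      apply/(char_along _ hC pp la); split=> [|w].
        by rewrite dotZl dotP vL av mulr0.
      rewrite dotZl dotP => /eqP; rewrite mulf_eq0 (negbTE mu0) /= => /eqP aw.
      apply: etrans (dform_scale smu (smat_pull sphi sal') _ _) _.
      - by rewrite dotP vL.
      - by rewrite dotP.
      apply: etrans (congr1 _ (dform_pull (v0 *m B) w sphi sal')) _.
      rewrite (diff_affine (kap x x) L) vL (diff_affine (kap x x) L) /phi e0 v0d ?mulr0 //.
      exact/mem0.
    by rewrite dpsi0 psi0.
  have := char_tangent_map hC simple vchar.
  have := nbhs_singleton nT (v0 *m B).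
  by rewrite dpsi0 psi0 vL coord_change_id // => -> ->.
exists r; last by rewrite dims.
split=> // x; rewrite /nu_rank char0 dimv0 subn0.
have [k kn [-> _]] := hC0; move: kn; rewrite dims => [[->]].
by [].
Qed.

End Projection.

End Contact.

(** * Proportional 1-forms and pullbacks *)

Section Forms.
Context {R : realType} {n : nat} {M : manifold R n}.

Local Notation kap q := (chart_map (chart_at q)).
Local Notation iot q := (chart_inv (chart_at q)).
Local Notation dom q := (chart_dom (chart_at q)).

Lemma lfun_delta0 m (V : vectType R) (f : 'Hom('rV[R]_m, V)) :
  (forall i, f (delta_mx 0 i) = 0) -> f = 0.
Proof.
move=> H; apply/lfunP => v; rewrite zero_lfunE [v]row_sum_delta linear_sum big1 // => i _.
by rewrite linearZZ /= H scaler0.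
Qed.

Lemma lfun_rowE m (f : 'Hom('rV[R]_m, R^o)) v :
  f v = \sum_i v 0 i * f (delta_mx 0 i) :> R.
Proof.
rewrite {1}[v]row_sum_delta linear_sum; apply: eq_bigr => i _.
by rewrite linearZZ.
Qed.

Lemma form_in_chart (eta : M -> 'Hom('rV[R]_n, R^o)) q i y : dom q y ->
  form_in q eta i (kap q y) = eta y (coord_change q y y (delta_mx 0 i)).
Proof. by move=> Dy; rewrite /form_in chart_mapE. Qed.

Lemma smooth_form_smat (W : set M) (eta : M -> 'Hom('rV[R]_n, R^o)) q i y :
  open W -> W y -> dom q y -> smooth_form W eta -> smat (form_in q eta i) (kap q y).
Proof.
move=> oW Wy Dy /(_ q i)/(smat_on _ (chart_image_open (q := q) oW)).
by apply; exists y.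
Qed.

Lemma smooth_form_sub (U V : set M) (eta : M -> 'Hom('rV[R]_n, R^o)) :
  open U -> open V -> U `<=` V -> smooth_form V eta -> smooth_form U eta.
Proof.
move=> oU oV UV se q i; apply/(smat_on _ (chart_image_open (q := q) oU)).
by move=> _ [y [Uy Dy] <-]; exact: smooth_form_smat oV (UV _ Uy) Dy se.
Qed.

Lemma form_in_neq0 (eta : M -> 'Hom('rV[R]_n, R^o)) q y : dom q y -> eta y <> 0 ->
  exists i, form_in q eta i (kap q y) != 0.
Proof.
move=> Dy e0; apply: contrapT => H; apply: e0; apply/lfunP => v.
have fl : (eta y \o coord_change q y y)%VF = 0.
  apply: lfun_delta0 => l; rewrite comp_lfunE -form_in_chart //.
  by apply/eqP/negPn/negP => e; apply: H; exists l.
rewrite -(coord_changeK v (chart_at_dom y) Dy) -comp_lfunE fl.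
by rewrite !zero_lfunE.
Qed.

(** Near each point some component of eta in a chart is nonzero, and f is there the quotient of the
    corresponding components of beta and eta. *)
Lemma form_ratio_smooth (W : set M) (eta beta : M -> 'Hom('rV[R]_n, R^o)) (f : M -> R) :
  open W -> smooth_form W eta -> smooth_form W beta ->
  (forall z, W z -> eta z <> 0 /\ beta z = f z *: eta z) -> smooth_fun W f.
Proof.
move=> oW se sb H q; apply/(smat_on _ (chart_image_open (q := q) oW)) => _ [y [Wy Dy] <-].
have [e0 _] := H y Wy; have [i ei] := form_in_neq0 Dy e0.
have s1 := smooth_form_smat i oW Wy Dy se; have s2 := smooth_form_smat i oW Wy Dy sb.
apply: smat_ext (smat_mul s2 (smat_inv ei s1)).
have nW : \forall z \near y, W z by exact: open_nbhs_nbhs.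
apply: near_impl2 (smat_near_neq0 s1 ei) (near_chart_points Dy nW).
move=> _ /[swap] -[z [-> Dz Wz]].
have [_ bz] := H z Wz.
rewrite !form_in_chart // bz scale_lfunE /= chart_mapE // => ez.
by rewrite -[_ *: _]/(_ * _) mulfK.
Qed.

Lemma lfun_same_kernel m (a b : 'Hom('rV[R]_m, R^o)) : a <> 0 ->
  (forall v, b v = 0 <-> a v = 0) -> exists c, c <> 0 /\ b = c *: a.
Proof.
move=> a0 ab; have [v av] : exists v, a v != 0.
  apply: contrapT => H; apply: a0; apply/lfunP => v; rewrite zero_lfunE.
  by apply/eqP/negPn/negP => av; apply: H; exists v.
exists (b v / a v); split=> [/eqP|].
  rewrite mulf_eq0 invr_eq0 (negbTE av) orbF => /eqP /ab av0.
  by rewrite av0 eqxx in av.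
apply/lfunP => w; rewrite scale_lfunE.
have : b (w - (a w / a v) *: v) = 0.
  apply/ab; rewrite linearB linearZZ /= -[_ *: _]/(_ * _) divfK ?subrr //.
rewrite linearB linearZZ /= => /eqP; rewrite subr_eq0 => /eqP ->.
by rewrite -![_ *: _]/(_ * _) mulrAC [RHS]mulrAC [a w * _]mulrC.
Qed.

End Forms.

Section Pullback.
Context {R : realType} {n n0 : nat} {M : manifold R n} {M0 : manifold R n0}.

Local Notation kap q := (chart_map (chart_at q)).
Local Notation iot q := (chart_inv (chart_at q)).
Local Notation dom q := (chart_dom (chart_at q)).

Lemma tangent_map_chart (p : M -> M0) q y v : smooth_map p -> dom q y ->
  dmap (p \o iot q) (kap q y) v = tangent_map p y (coord_change q y y v).
Proof.
move=> sp Dy; have si := smap_chart_inv Dy.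
apply: etrans (dmap_smooth_map v sp si) _.
have e z : z = y -> tangent_map p z (dmap (iot q) (kap q y) v) =
    tangent_map p y (coord_change q y y v) by move=> ->; rewrite dmap_chart_inv.
exact: e (chart_mapE Dy).
Qed.

(** In charts, a component of the pullback is the sum over l of a partial derivative of the l-th
    coordinate of p times the l-th component of eta0 composed with p. *)
Lemma smooth_form_pullback (p : M -> M0) (W0 : set M0)
    (eta0 : M0 -> 'Hom('rV[R]_n0, R^o)) :
  smooth_map p -> open W0 -> smooth_form W0 eta0 ->
  smooth_form (p @^-1` W0) (pullback p eta0).
Proof.
move=> sp oW0 s0 q i.
have oW : open (p @^-1` W0) by apply: open_comp => // y _; exact: sp.1.
apply/(smat_on _ (chart_image_open (q := q) oW)) => _ [y [Wy Dy] <-].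
set x := p y; have Dx := chart_at_dom x.
have sP := smooth_map_smat sp Dy Dx; set P := (_ \o _) in sP.
have Py : P (kap q y) = kap x x by rewrite /P /= chart_mapE.
have sg l : smat (fun u => 'd P u (delta_mx 0 i) 0 l * form_in x eta0 l (P u)) (kap q y).
  apply: smat_mul; first by apply/smat_coord/smat_diff => //; exact: smat_cst.
  by apply: (smat_compR sP); rewrite Py; exact: smooth_form_smat oW0 Wy Dx s0.
have sS := smat_sum xpredT sg; apply: smat_ext sS.
have nx : \forall y' \near y, dom x (p y').
  exact: near_comp (sp.1 y) (near_chart_dom Dx).
apply: near_impl (near_chart_points Dy nx) => _ [y' [-> Dy' Dx']].
rewrite form_in_chart // /pullback comp_lfunE -(tangent_map_chart _ sp Dy').
set x' := p y' in Dx' *.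
have spi : smap (p \o iot q) (kap q y') by apply: smap_smooth_map => //; exact: smap_chart_inv.
have Py' : p (iot q (kap q y')) = x' by rewrite chart_mapE.
have e : dmap (p \o iot q) (kap q y') (delta_mx 0 i) =
    coord_change x x' x' ('d P (kap q y') (delta_mx 0 i)).
  have Dx'' : dom x ((p \o iot q) (kap q y')) by rewrite /= Py'.
  apply: etrans (dmap_chart _ spi Dx'') _.
  by rewrite /= Py'.
pose g := (eta0 x' \o coord_change x x' x')%VF.
apply: esym; apply: etrans (congr1 (fun t => eta0 x' t) e) _.
apply: etrans (esym (comp_lfunE _ _ _)) _; apply: etrans (lfun_rowE g _) _.
apply: eq_bigr => l _; congr (_ * _).
by rewrite comp_lfunE /P /= Py' form_in_chart.
Qed.

End Pullback.

Theorem theorem3p1 (R : realType) (n n0 r : nat)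
    (M : manifold R n) (C : tangent_distribution M)
    (M0 : manifold R n0) (p0 : M -> M0) :
  precontact r C ->
  simple_with C p0 ->
  exists C0 : tangent_distribution M0,
    unique (fun C' : tangent_distribution M0 =>
              contact C' /\
              forall y, C' (p0 y) = (tangent_map p0 y @: C y)%VS) C0 /\
    forall (y : M) (V : set M) (eta : M -> 'Hom('rV[R]_n, R^o)),
      V y -> form_inducing C V eta ->
      forall (V0 : set M0) (eta0 : M0 -> 'Hom('rV[R]_n0, R^o)),
        V0 (p0 y) -> form_inducing C0 V0 eta0 ->
        exists f : M -> R,
          smooth_fun (V `&` p0 @^-1` V0) f /\
          forall z, V z -> V0 (p0 z) ->
            f z <> 0 /\ pullback p0 eta0 z = f z *: eta z.
Proof.
move=> [hC rk] simple; have [_ [sp sur _]] := simple.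
have p0_surj x : exists y, p0 y = x.
  by have : range p0 x; [rewrite sur|move=> [y _ <-]; exists y].
have [sec secK] := choice p0_surj.
(* [sec] is a mere choice of a point in each fibre; by [projection_fibre_constant] the hyperplane
   does not depend on it. *)
pose C0 x : {vspace 'rV[R]_n0} := (tangent_map p0 (sec x) @: C (sec x))%VS.
have C0P y : C0 (p0 y) = (tangent_map p0 y @: C y)%VS.
  exact: (projection_fibre_constant hC simple (secK _)).
exists C0; split.
  split; first by split=> //; exact: (contact_projection hC simple rk C0P).
  move=> C' [_ C'P]; apply: funext => x; have [y <-] := p0_surj x.
  by rewrite C0P C'P.
move=> _ V eta _ [oV seta etaC] V0 eta0 _ [oV0 seta0 eta0C].
have oW : open (V `&` p0 @^-1` V0).
  by apply: openI => //; apply: open_comp => // y _; exact: sp.1.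
(* The factor is chosen point by point, with no constraint outside the common domain of the two
   forms; its smoothness is deduced afterwards. *)
have H z : exists c, (V `&` p0 @^-1` V0) z ->
    c <> 0 /\ pullback p0 eta0 z = c *: eta z.
  have [[Vz V0z]|nW] := pselect ((V `&` p0 @^-1` V0) z); last by exists 0.
  have [e0 Cz] := etaC z Vz; have [_ C0z] := eta0C _ V0z.
  have [|c cP] := @lfun_same_kernel _ _ _ (pullback p0 eta0 z) e0; last by exists c.
  move=> w; rewrite comp_lfunE.
  have -> : (eta z w = 0) <-> w \in C z by rewrite Cz memv_ker; split=> [/eqP|/eqP].
  have -> : (eta0 (p0 z) (tangent_map p0 z w) = 0) <-> tangent_map p0 z w \in C0 (p0 z).
    by rewrite C0z memv_ker; split=> [/eqP|/eqP].
  rewrite C0P; split=> [/memv_imgP[c cC Twc]|wC]; last exact: memv_img.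
  (* Here c is a vector of C z with the same image as w, so w - c lies in the kernel of Tp0, which
     is contained in C z. *)
  rewrite -(subrK c w); apply: memvD => //; apply: (subvP (char_sub z hC)).
  by rewrite -(ker_tangent_map hC simple) memv_ker linearB /= Twc subrr.
have [f fP] := choice H.
exists f; split=> [|z Vz V0z]; last exact: fP.
apply: (@form_ratio_smooth _ _ _ _ eta (pullback p0 eta0)) => //.
- by apply: (@smooth_form_sub _ _ _ _ V) => // z [].
- apply: (@smooth_form_sub _ _ _ _ (p0 @^-1` V0)) => //.
  + by apply: open_comp => // y _; exact: sp.1.
  + exact: smooth_form_pullback.
- by move=> z Wz; have [Vz _] := Wz; have [] := fP z Wz; have [] := etaC z Vz.
Qed.
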